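(* Let $M$ be the magnetic dispersion function defined in the context. For each $k\in\mathbb{R}^3$ there are exactly two zeros $\lambda^{\rm mag}_\pm=\pm i\nu_*(|k|)$ of $M(\lambda,k)=0$ that lie on the imaginary axis $\{\Re\lambda=0\}$. Moreover $\nu_*(|k|)>|k|$. Finally, $\nu_*$ is a $\mathcal{C}^{\lfloor N_0/2\rfloor}$ function satisfying $$c_0\sqrt{1+|k|^2}\le\nu_*(|k|)\le C_0\sqrt{1+|k|^2},$$ $$c_0\frac{|k|}{\sqrt{1+|k|^2}}\le\nu_*'(|k|)\le C_0\frac{|k|}{\sqrt{1+|k|^2}},$$ $$c_0(1+|k|^2)^{-3/2}\le\nu_*''(|k|)\le C_0,$$ uniformly with respect to $k\in\mathbb{R}^3$, for some positive constants $c_0,C_0$.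
   Context: Notation: $\langle v\rangle=\sqrt{1+|v|^2}$, $\hat v=v/\langle v\rangle$, $\mathbb{P}_k=\mathbb{I}-\frac{k\otimes k}{|k|^2}$. Equilibrium: $\mu(v)=\varphi(\langle v\rangle)$, $v\in\mathbb{R}^3$, is non-negative, $\int\mu\,dv=n_0\neq0$, $\varphi(s)=F(s^2)$, where (i) $F$ has a holomorphic extension to $\{\Re s>0\}$; (ii) for every $R>0$, $n\in\mathbb{N}$ there is $C_{R,n}$ such that $|F^{(n)}(sz)|\le C_{R,n}(s\,\Re z)^{-N_0/2-n}$ for all $s\ge1$ and all $z$ with $\Re z>0$, $|z|\le R$. $N_0\in\mathbb{N}$ is sufficiently large (larger than some absolute constant). Magnetic dispersion function: for $\Re\lambda>0$ and $k\neq0$, $$M(\lambda,k)=\lambda^2+|k|^2+\tau_0^2+\frac12\int_{\mathbb{R}^3}\frac{(ik\cdot\hat v)|\mathbb{P}_k\hat v|^2}{\lambda+ik\cdot\hat v}\varphi'(\langle v\rangle)dv,\qquad\tau_0^2=\int\frac{1+\frac23|v|^2}{(1+|v|^2)^{3/2}}\mu(v)dv,$$ extended continuously to $\{\Re\lambda=0\}$; at $k=0$ it is understood by continuity in $k$, i.e. $M(\lambda,0)=\lambda^2+\tau_0^2$. *)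

(* Defs.v *)
From HB Require Import structures.
From mathcomp Require Export all_boot all_order all_algebra.
From mathcomp Require Export complex.
From mathcomp Require Export all_classical all_reals all_analysis.
Export Order.TTheory GRing.Theory Num.Theory numFieldNormedType.Exports.

Set Implicit Arguments.
Unset Strict Implicit.
Unset Printing Implicit Defensive.

#[export] Set Implicit Arguments.
#[export] Unset Strict Implicit.
#[export] Unset Printing Implicit Defensive.

Local Open Scope ring_scope.
Local Open Scope classical_set_scope.
Local Open Scope complex_scope.

(* R[i] seen as a numFieldType, so that it carries the norm and the topology
   of numFieldNormedType and [derivable], [derive1] over it are complex
   differentiability and the complex derivative. *)
Definition Cpx (R : realType) : numClosedFieldType := R[i].

Definition open_right_half (R : realType) : set (Cpx R) :=
  [set z | 0 < complex.Re z].

Definition closed_right_half (R : realType) : set (Cpx R) :=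
  [set z | 0 <= complex.Re z].

Definition holomorphic_on (R : realType) (D : set (Cpx R))
    (F : Cpx R -> Cpx R) : Prop :=
  forall z, D z -> derivable F z 1.

Definition vec3 (R : realType) (p : R * R * R) : 'cV[R]_3 :=
  \col_(i < 3) [:: p.1.1; p.1.2; p.2]`_i.

Definition dot (R : realType) (u v : 'cV[R]_3) : R :=
  \sum_(i < 3) u i 0 * v i 0.

(* The Euclidean norm; the library norm on matrices is the sup norm. *)
Definition enorm (R : realType) (v : 'cV[R]_3) : R := Num.sqrt (dot v v).

Definition jap (R : realType) (v : 'cV[R]_3) : R :=
  Num.sqrt (1 + enorm v ^+ 2).

Definition vhat (R : realType) (v : 'cV[R]_3) : 'cV[R]_3 := (jap v)^-1 *: v.

Definition proj_perp (R : realType) (k : 'cV[R]_3) : 'M[R]_3 :=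
  1%:M - (enorm k ^+ 2)^-1 *: (k *m k^T).

Definition leb3 (R : realType) :=
  ((@lebesgue_measure R \x @lebesgue_measure R) \x @lebesgue_measure R)%E.

Definition rint3 (R : realType) (f : 'cV[R]_3 -> R) : R :=
  \int[@leb3 R]_p f (vec3 p).

Definition cint3 (R : realType) (f : 'cV[R]_3 -> Cpx R) : Cpx R :=
  rint3 (fun v => complex.Re (f v)) +i* rint3 (fun v => complex.Im (f v)).

Definition mu (R : realType) (phi : R -> R) (v : 'cV[R]_3) : R := phi (jap v).

(* [F] is the holomorphic extension to the right half-plane of the real
   function s^2 |-> phi s. *)
Record equilibrium (R : realType) (N0 : nat) (F : Cpx R -> Cpx R)
    (phi : R -> R) (n0 : R) : Prop := Equilibrium {
  equilibrium_ge0 : forall v, 0 <= mu phi v;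
  equilibrium_density : (\int[@leb3 R]_p (mu phi (vec3 p))%:E = n0%:E)%E;
  equilibrium_neq0 : n0 != 0;
  equilibrium_phiE : forall s : R, 0 < s -> F (s ^+ 2)%:C = (phi s)%:C;
  equilibrium_holomorphic : holomorphic_on (@open_right_half R) F;
  equilibrium_decay : forall (r : R) (n : nat), 0 < r -> exists C : R,
    forall (s : R) (z : Cpx R), 1 <= s -> 0 < complex.Re z -> `|z| <= r%:C ->
      `|derive1n n F (s%:C * z)| <=
        (C * (s * complex.Re z) `^ (- (N0%:R / 2) - n%:R))%:C
}.

Definition tau0sq (R : realType) (phi : R -> R) : R :=
  rint3 (fun v => (1 + 2 / 3 * enorm v ^+ 2) /
                  (1 + enorm v ^+ 2) `^ (3 / 2) * mu phi v).

Definition mag_integrand (R : realType) (phi : R -> R) (lam : Cpx R)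
    (k v : 'cV[R]_3) : Cpx R :=
  let ikv : Cpx R := 0 +i* dot k (vhat v) in
  ikv * (enorm (proj_perp k *m vhat v) ^+ 2)%:C / (lam + ikv)
  * (derive1 phi (jap v))%:C.

Definition magM_open (R : realType) (phi : R -> R) (lam : Cpx R)
    (k : 'cV[R]_3) : Cpx R :=
  if k == 0 then lam ^+ 2 + (tau0sq phi)%:C
  else lam ^+ 2 + (enorm k ^+ 2)%:C + (tau0sq phi)%:C
       + 2^-1 * cint3 (mag_integrand phi lam k).

(* [lim] is a junk value where the limit does not exist; that it does exist on
   the imaginary axis has to be asserted separately. *)
Definition magM (R : realType) (phi : R -> R) (lam : Cpx R)
    (k : 'cV[R]_3) : Cpx R :=
  if 0 < complex.Re lam then magM_open phi lam k
  else lim (magM_open phi z k @[z --> within (@open_right_half R) (nbhs lam)]).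

(* C^m on the whole line; a C^m function on the closed half-line [0, +oo[ is
   the restriction of such a function, whose derivatives at 0 are then the
   one-sided ones. *)
Definition class_C (R : realType) (m : nat) (f : R -> R) : Prop :=
  (forall j x, (j < m)%N -> derivable (derive1n j f) x 1) /\ continuous (derive1n m f).

(* Main.v *)
From HB Require Import structures.
Require Import Defs.
From mathcomp Require Import measurable_realfun ring lra.

(** Write the equilibrium as Phi(1 + |v|^2) and put r = |k|.

    In the velocity integral only t = 1 + |v|^2 and the component u of the velocity
    along k matter.  In these coordinates the Lebesgue measure becomes a multiple of
    (sqrt t) du dt on the set (1 - u^2) t >= 1 ([rint3_spherical]), the multiple
    being the area K of the unit disc, and an integration by parts in t trades the
    derivative of Phi for Phi itself ([tail_by_parts], [dispersion_reduction]).
    The outcome is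
      M(lambda, k) = lambda^2 + r^2 + lambda int q(u) / (lambda + i r u) du,
      tau_0^2 = int q(u) du,
    where q(u) = K (1 - u^2) int_(t > 1 / (1 - u^2)) Phi(t) dt is even, nonnegative,
    Lipschitz, bounded by a multiple of (1 - u^2)^2 on [-1, 1], zero outside, and,
    once it vanishes, zero up to the end point ([density]).

    A Cauchy integral of a Lipschitz function has a continuous extension to the
    axis: after a substitution in its real part (the Poisson kernel) and a
    symmetrization of its imaginary part (the conjugate kernel), dominated
    convergence applies ([continuous_cauchyR], [continuous_cauchyI]).

    Let lambda = i b.  For |b| <= r the imaginary part of M is b (pi / r) q(b / r);
    where it vanishes, q is concentrated on |u| <= |b| / r and the real part is
    positive ([dispersion_neq0]).  For |b| > r the denominator does not vanish and
    M = r^2 - b^2 + G_0(r^2 / b^2), where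
      G_n(w) = int q(u) u^(2n) / (1 - w u^2)^(n+1) du
    ([dispersion_outside]).  In terms of w = r^2 / b^2 the equation M = 0 reads
      b^2 = G_0(w) / (1 - w),   r^2 = w G_0(w) / (1 - w),
    and since the second right-hand side increases from 0 to infinity on [0, 1[, it
    determines w, hence b^2 ([wave_sq_inj], [wave_sq_surj], [zero_fun_unique]).  At
    r = 0 it gives b^2 = G_0(0) = tau_0^2.

    The curve is parametrized by the signed slope y = r / nu, so that w = y^2 and
    nothing special happens at r = 0: the function r = y sqrt(G_0(y^2) / (1 - y^2))
    has a positive derivative, and y and nu are differentiable functions of r by the
    inverse function theorem.  Their derivatives are polynomials in y, nu, the
    G_n(y^2) and D = 1 / (G_0 + w (1 - w) G_1); such expressions are closed under
    differentiation, so nu is smooth ([class_C_zero_fun]).  Explicitly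
      nu'  = y ((1 - w) G_1 + G_0) D,
      nu'' = nu (1 - w)^2 D^3 X,
      X = (1 - w) G_0^2 + (1 - w)^2 G_0 G_1 + w (G_0 - (1 - w) G_1)^2
          + 4 w (1 - w)^2 (G_0 G_2 - G_1^2).
    The bound of q by (1 - u^2)^2 keeps G_0, G_1 and (1 - w) G_2 bounded up to
    w = 1 ([moments_density]), and G_0 is bounded below by the mass of q.  The last
    term of X is nonnegative by Cauchy-Schwarz, so X lies between two positive
    constants, and the bounds follow ([zero_fun_bounds]). *)

Local Open Scope ring_scope.
Local Open Scope classical_set_scope.
Local Open Scope complex_scope.

(** * Affine changes of variable on the line *)
Section real_measurability.
Context {R : realType}.

Lemma measurable_sqrt : measurable_fun [set: R] (@Num.sqrt R).
Proof. apply: continuous_measurable_fun. exact: sqrt_continuous. Qed.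

Lemma measurable_inv : measurable_fun [set: R] (@GRing.inv R).
Proof.
have -> : @GRing.inv R = (fun x => if x == 0 then 0 else x^-1).
  by apply/funext => x; case: eqP => // ->; rewrite invr0.
apply: measurable_fun_if => //; first exact: measurable_fun_eqr.
have -> : setT `&` (fun x : R => x == 0) @^-1` [set false] = ~` [set 0].
  apply/seteqP; split => x /=; first by move=> [_ /eqP].
  by move=> /eqP/negbTE.
apply: open_continuous_measurable_fun; first exact/closed_openC/accessible_closed_set1/hausdorff_accessible/norm_hausdorff.
move=> x /set_mem /= /eqP x0; exact: inv_continuous.
Qed.
End real_measurability.

Section affine.
Local Open Scope ereal_scope.
Context {R : realType}.
Notation mu := (@lebesgue_measure R).
Implicit Types (a b : R) (f : R -> \bar R).

Let aff a b : R -> R := fun x => (a * x + b)%R.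

Lemma measurable_affine a b : measurable_fun [set: R] (aff a b).
Proof. by apply: measurable_funD => //; apply: measurable_funM. Qed.

(** Uniqueness of the Lebesgue measure reduces this to intervals. *)
Lemma lebesgue_measure_affine a b (A : set R) : a != 0%R -> measurable A ->
  mu (aff a b @^-1` A) = (`|a|^-1)%:E * mu A.
Proof.
move=> a0 mA.
have na0 : (0 < `|a|)%R by rewrite normr_gt0.
have na0' : (0 <= `|a|)%R by [].
have mf := measurable_affine a b.
pose m := mscale (NngNum na0') mu.
suff -> : mu A = pushforward m (aff a b : _ -> measurableTypeR R) A.
  by rewrite /pushforward /m /mscale/= muleA -EFinM mulVf ?gt_eqF// mul1e.
apply: lebesgue_measure_unique => //= _ [[x y]] _ <-.
rewrite /m /mscale /pushforward/=.
rewrite lebesgue_measure_itv/= lte_fin.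
have [xy|yx] := ltP x y; last first.
  rewrite set_itv_ge ?bnd_simp -?leNgt// preimage_set0 measure0 mule0//.
have [a_gt0|] := ltP 0%R a; last rewrite le_eqVlt (negbTE a0)/= => a_lt0.
  rewrite (_ : _ @^-1` _ = `]((x - b) / a)%R, ((y - b) / a)%R]%classic); last first.
    apply/seteqP; split => z /=; rewrite !in_itv/= /aff ltr_pdivrMr// ler_pdivlMr//;
      by rewrite (mulrC z) ltrBlDr lerBrDr.
  rewrite lebesgue_measure_itv/= lte_fin ltr_pM2r ?invr_gt0// ltrD2r xy.
  rewrite gtr0_norm// -!EFinD -EFinM; congr (_%:E); by field.
rewrite (_ : _ @^-1` _ = `[((y - b) / a)%R, ((x - b) / a)%R[%classic); last first.
  apply/seteqP; split => z /=; rewrite !in_itv/= /aff ltr_ndivlMr// ler_ndivrMr//;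
     by rewrite (mulrC z) ltrBlDr lerBrDr andbC.
rewrite lebesgue_measure_itv/= lte_fin ltr_nM2r ?invr_lt0// ltrD2r xy.
rewrite ltr0_norm// -!EFinD -EFinM; congr (_%:E); by field.
Qed.

Lemma ge0_integral_affine f a b : a != 0%R -> measurable_fun setT f ->
  (forall x, 0 <= f x) ->
  \int[mu]_x f (a * x + b)%R = (`|a|^-1)%:E * \int[mu]_x f x.
Proof.
move=> a0 mf f0.
have na0 : (0 <= `|a|^-1)%R by rewrite invr_ge0.
transitivity (\int[pushforward mu (aff a b : _ -> measurableTypeR R)]_x f x).
  by rewrite ge0_integral_pushforward//; exact: measurable_affine.
transitivity (\int[mscale (NngNum na0) mu]_x f x).
  apply: eq_measure_integral => [|mf' A mA _]; first exact: measurable_affine.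
  exact: lebesgue_measure_affine.
exact: (@ge0_integral_mscale _ _ _ mu).
Qed.

Lemma pmuleBr (k : R) (A B : \bar R) : (0 < k)%R -> 0 <= A -> 0 <= B ->
  k%:E * A - k%:E * B = k%:E * (A - B).
Proof.
move=> k0; have kE : 0 < k%:E by rewrite lte_fin.
case: A => [a| |] //; case: B => [b| |] // _ _.
- exact: (congr1 EFin (esym (mulrBr k a b))).
- by rewrite gt0_muley//= gt0_muleNy.
- by rewrite gt0_muley//= gt0_muley.
- by rewrite gt0_muley//= gt0_muleNy.
Qed.

(** Positive and negative parts are treated separately; when their difference is
    not finite, both sides are 0 by the convention for real-valued integrals. *)
Lemma Rintegral_affine (f : R -> R) a b : a != 0%R -> measurable_fun setT f ->
  (\int[mu]_x f (a * x + b) = `|a|^-1 * \int[mu]_x f x)%R.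
Proof.
move=> a0 mf; rewrite /Rintegral; set g : R -> \bar R := EFin \o f.
have mg : measurable_fun setT g by exact/measurable_EFinP.
have k0 : (0 < `|a|^-1)%R by rewrite invr_gt0 normr_gt0.
suff -> : \int[mu]_x (f (a * x + b))%:E = (`|a|^-1)%:E * \int[mu]_x g x.
  have [|] := boolP (\int[mu]_x g x \is a fin_num).
    by move=> h; rewrite -{1}(fineK h).
  by case: (\int[mu]_x g x) => //= _; rewrite ?gt0_muley ?gt0_muleNy ?lte_fin//= mulr0.
have Ep : \int[mu]_x (g \o aff a b)^\+ x = (`|a|^-1)%:E * \int[mu]_x g^\+ x.
  by rewrite funepos_comp; apply: ge0_integral_affine => //; exact: measurable_funepos.
have En : \int[mu]_x (g \o aff a b)^\- x = (`|a|^-1)%:E * \int[mu]_x g^\- x.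
  by rewrite funeneg_comp; apply: ge0_integral_affine => //; exact: measurable_funeneg.
rewrite -[LHS]/(\int[mu]_x (g \o aff a b) x) integralE Ep En [in RHS]integralE.
by apply: pmuleBr => //; exact: integral_ge0.
Qed.

End affine.

(** * Rotations of the plane *)
Section plane.
Local Open Scope ereal_scope.
Context {R : realType}.
Notation mu := (@lebesgue_measure R).

(** Tonelli turns the shear into a translation of the inner variable. *)
Lemma ge0_integral_shear1 (g : R * R -> \bar R) (a : R) :
  measurable_fun setT g -> (forall p, 0 <= g p) ->
  \int[mu \x mu]_p g (p.1 + a * p.2, p.2)%R = \int[mu \x mu]_p g p.
Proof.
move=> mg g0.
have mh : measurable_fun setT (fun p : R * R => g (p.1 + a * p.2, p.2)%R).
  apply: (measurableT_comp mg); apply: measurable_fun_pair => //.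
  by apply: measurable_funD => //; exact: measurable_funM.
rewrite !fubini_tonelli2//; apply: eq_integral => y _; rewrite /fubini_G/=.
have := @ge0_integral_affine R (fun x => g (x, y)) 1 (a * y)%R.
rewrite normr1 invr1 mul1e => <-//; last exact: measurable_fun_pair1.
by apply: eq_integral => x _; rewrite mul1r.
Qed.

Lemma ge0_integral_shear2 (g : R * R -> \bar R) (a : R) :
  measurable_fun setT g -> (forall p, 0 <= g p) ->
  \int[mu \x mu]_p g (p.1, a * p.1 + p.2)%R = \int[mu \x mu]_p g p.
Proof.
move=> mg g0.
have mh : measurable_fun setT (fun p : R * R => g (p.1, a * p.1 + p.2)%R).
  apply: (measurableT_comp mg); apply: measurable_fun_pair => //.
  by apply: measurable_funD => //; exact: measurable_funM.
rewrite !fubini_tonelli1//; apply: eq_integral => x _; rewrite /fubini_F/=.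
have := @ge0_integral_affine R (fun y => g (x, y)) 1 (a * x)%R.
rewrite normr1 invr1 mul1e => <-//; last exact: measurable_fun_pair2.
by apply: eq_integral => y _; rewrite mul1r addrC.
Qed.

Lemma ge0_integral_scale2 (g : R * R -> \bar R) (a : R) : a != 0%R ->
  measurable_fun setT g -> (forall p, 0 <= g p) ->
  \int[mu \x mu]_p g (a * p.1, a * p.2)%R =
  (`|a| ^- 2)%:E * \int[mu \x mu]_p g p.
Proof.
move=> a0 mg g0.
have mh : measurable_fun setT (fun p : R * R => g (a * p.1, a * p.2)%R).
  by apply: (measurableT_comp mg); apply: measurable_fun_pair => //;
    exact: measurable_funM.
have na : 0 <= (`|a|^-1)%:E by rewrite lee_fin invr_ge0.
have mG : measurable_fun setT (fun x => \int[mu]_y g (x, y)).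
  exact: measurable_fun_fubini_tonelli_F.
rewrite !fubini_tonelli1// /fubini_F/=.
transitivity (\int[mu]_x ((`|a|^-1)%:E * \int[mu]_y g (a * x, y)%R)).
  apply: eq_integral => x _.
  rewrite -(@ge0_integral_affine R (fun y => g (a * x, y)%R) a 0)//.
    by apply: eq_integral => y _; rewrite addr0.
  exact: measurable_fun_pair2.
rewrite ge0_integralZl//.
- rewrite expr2 invfM EFinM -muleA; congr (_ * _).
  rewrite -(@ge0_integral_affine R (fun x => \int[mu]_y g (x, y)) a 0)//.
    by apply: eq_integral => y _; rewrite addr0.
  by move=> x; exact: integral_ge0.
- by apply: (measurableT_comp mG); exact: measurable_funM.
- by move=> x _; exact: integral_ge0.
Qed.

(** A rotation is a product of three shears, unless it is plus or minus the
    identity. *)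
Lemma ge0_integral_rot (g : R * R -> \bar R) (c s : R) :
  (c ^+ 2 + s ^+ 2 = 1)%R -> measurable_fun setT g -> (forall p, 0 <= g p) ->
  \int[mu \x mu]_p g (c * p.1 - s * p.2, s * p.1 + c * p.2)%R =
  \int[mu \x mu]_p g p.
Proof.
move=> cs mg g0; have [s0|s0] := eqVneq s 0%R.
  have nc : `|c|%R = 1%R.
    by move: cs; rewrite s0 expr0n addr0 => /eqP; rewrite sqr_norm_eq1 => /eqP.
  have c0 : c != 0%R by rewrite -normr_gt0 nc.
  have := ge0_integral_scale2 c0 mg g0.
  rewrite nc expr1n invr1 mul1e => <-.
  by apply: eq_integral => -[x y] _ /=; rewrite s0 !mul0r subr0 add0r.
pose a := ((c - 1) / s)%R.
pose g1 p := g (p.1 + a * p.2, p.2)%R.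
pose g2 p := g1 (p.1, s * p.1 + p.2)%R.
have mg1 : measurable_fun setT g1.
  apply: (measurableT_comp mg); apply: measurable_fun_pair => //.
  by apply: measurable_funD => //; exact: measurable_funM.
have mg2 : measurable_fun setT g2.
  apply: (measurableT_comp mg1); apply: measurable_fun_pair => //.
  by apply: measurable_funD => //; exact: measurable_funM.
transitivity (\int[mu \x mu]_p g2 (p.1 + a * p.2, p.2)%R); last first.
  rewrite ge0_integral_shear1// /g2; last by move=> p; exact: g0.
  rewrite ge0_integral_shear2// /g1; last by move=> p; exact: g0.
  by rewrite ge0_integral_shear1.
apply: eq_integral => -[x y] _ /=; rewrite /g2 /g1/=.
have aS : (a * s = c - 1)%R by rewrite /a mulfVK.
have aC : (a * (1 + c) = - s)%R.
  apply: (mulfI s0); rewrite mulrA (mulrC s) aS mulrN -expr2.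
  by rewrite (_ : s ^+ 2 = 1 - c ^+ 2)%R; [ring|rewrite -cs; ring].
have -> : (s * (x + a * y) + y = s * x + c * y)%R.
  by rewrite mulrDr mulrA (mulrC s a) aS; ring.
congr (g (_, _)).
rewrite (_ : (x + a * y + _)%R = (x + a * s * x + a * (1 + c) * y)%R); last by ring.
by rewrite aS aC; ring.
Qed.

End plane.

(** * Polar coordinates in the plane *)
Section radial.
Local Open Scope ereal_scope.
Context {R : realType}.
Notation mu := (@lebesgue_measure R).

Let le_area (A B : set (R * R)) : measurable A -> measurable B -> A `<=` B ->
  (mu \x mu) A <= (mu \x mu) B.
Proof.
move=> mA mB AB; apply: (@le_measure _ _ _ (mu \x mu)) => //; rewrite inE.
- exact: mA.
- exact: mB.
Qed.

Let N (p : R * R) : R := (p.1 ^+ 2 + p.2 ^+ 2)%R.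

Lemma measurable_sqnorm2 : measurable_fun [set: R * R] N.
Proof. by apply: measurable_funD; apply: measurable_funX. Qed.

Let disc (b : R) : set (R * R) := [set p | N p <= b]%R.

Let mdisc b : measurable (disc b).
Proof.
rewrite (_ : disc b = N @^-1` `]-oo, b]); last first.
  by apply/seteqP; split => p; rewrite /= in_itv.
by rewrite -[X in measurable X]setTI; exact: measurable_sqnorm2.
Qed.

Definition disc_area : R := fine ((mu \x mu) (disc 1)).

Lemma disc_area_ge0 : (0 <= disc_area)%R.
Proof. by rewrite fine_ge0. Qed.

Let disc1E : (mu \x mu) (disc 1) = disc_area%:E.
Proof.
rewrite fineK// ge0_fin_numE//.
pose I : set R := `[(-1)%R, 1%R]%classic.
have mI : measurable I by exact: measurable_itv.
apply: (@le_lt_trans _ _ ((mu \x mu) (I `*` I))).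
  apply: le_area => //; first exact: measurableX.
  move=> [x y]; rewrite /disc /N /= => h; split; rewrite /I /= in_itv/= -ler_norml;
    rewrite -(@ler_pXn2r _ 2)// ?nnegrE// real_normK ?num_real// expr1n.
    by apply: le_trans h; rewrite lerDl sqr_ge0.
  by apply: le_trans h; rewrite lerDr sqr_ge0.
have muI : mu I = 2%:E.
  by rewrite lebesgue_measure_itv/= lte_fin ifT ?gtrN// -EFinD opprK.
have -> : (mu \x mu) (I `*` I) = 2%:E * 2%:E.
  by rewrite product_measure1E//; congr (_ * _); exact: muI.
by rewrite -EFinM ltry.
Qed.

Let discE (b : R) : (0 <= b)%R -> (mu \x mu) (disc b) = (disc_area * b)%:E.
Proof.
rewrite le_eqVlt => /predU1P[<-|b0].
  rewrite mulr0; apply/eqP; rewrite eq_le measure_ge0 andbT.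
  rewrite (_ : 0%:E = (mu \x mu) ([set 0%R] `*` [set 0%R])).
    apply: le_area => //; first exact: measurableX.
    move=> [x y]; rewrite /disc /N /= => h.
    have := sqr_ge0 x; have := sqr_ge0 y => hy hx.
    by split; apply/eqP; rewrite -sqrf_eq0 eq_le ?hx ?hy andbT; lra.
  transitivity (0%:E * 0%:E : \bar R); first by rewrite mule0.
  by rewrite product_measure1E//; congr (_ * _); exact/esym/lebesgue_measure_set1.
have sb0 : Num.sqrt b != 0%R by rewrite gt_eqF// sqrtr_gt0.
have mg : measurable_fun setT (fun p => (\1_(disc b) p)%:E : \bar R).
  by apply/measurable_EFinP; exact: measurable_indic.
have indE c : \int[mu \x mu]_p (\1_(disc c) p)%:E = (mu \x mu) (disc c).
  by rewrite integral_indic ?setIT//; exact: mdisc.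
have NE (x y : R) : (N (Num.sqrt b * x, Num.sqrt b * y) <= b)%R = (N (x, y) <= 1)%R.
  rewrite /N/= !exprMn sqr_sqrtr ?(ltW b0)// -mulrDr.
  by rewrite -{2}[b]mulr1 ler_pM2l.
have H := ge0_integral_scale2 sb0 mg.
have {H} : (mu \x mu) (disc 1) = (b^-1)%:E * (mu \x mu) (disc b).
  rewrite -[in RHS]indE; move: H; rewrite ger0_norm// sqr_sqrtr ?(ltW b0)// => <-.
    rewrite -indE; apply: eq_integral => -[x y] _.
    rewrite !indicE; congr ((_ : bool)%:R%:E).
    by apply/idP/idP => /set_mem h; apply/mem_set; move: h; rewrite /disc/= NE.
  by move=> p; rewrite lee_fin.
rewrite disc1E EFinM => ->.
by rewrite muleAC -EFinM mulVf ?mul1e// gt_eqF.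
Qed.

Let disc_lt0 (b : R) : (b < 0)%R -> disc b = set0.
Proof.
move=> b0; rewrite -subset0 => -[x y]; rewrite /disc /N /= => h.
have := sqr_ge0 x; have := sqr_ge0 y; lra.
Qed.

Let disc_fin (b : R) : (mu \x mu) (disc b) < +oo.
Proof.
have [b0|b0] := leP 0%R b; first by rewrite discE// ltry.
by rewrite disc_lt0// measure0.
Qed.

(** The squared distance to the origin pushes the area of the plane forward to
    a multiple of the length of the half-line: both agree on intervals, because
    the area of a disc is quadratic in the radius. *)
Lemma ge0_integral_radial (g : R -> \bar R) :
  measurable_fun setT g -> (forall x, 0 <= g x) ->
  \int[mu \x mu]_p g (p.1 ^+ 2 + p.2 ^+ 2)%R =
  disc_area%:E * \int[mu]_(x in `[0%R, +oo[) g x.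
Proof.
move=> mg g0.
pose nu : {measure set (measurableTypeR R) -> \bar R} :=
  @measure_function_pushforward__canonical__measure_function_Measure
    _ _ _ (measurableTypeR R) _ (mu \x mu) N measurable_sqnorm2.
have mD : measurable (`[0%R, +oo[ : set (measurableTypeR R)) by [].
pose m2 : {measure set (measurableTypeR R) -> \bar R} :=
  mscale (NngNum disc_area_ge0) (mrestr mu mD).
have nuE A : measurable A -> nu A = m2 A.
  apply: (@measure_unique _ R (measurableTypeR R) (@ocitv R)
    (fun n => `](- n%:R)%R, n%:R]%classic) _ _ _ _ nu m2) => //.
  - exact: ocitvI.
  - by move=> n; exists ((- n%:R)%R, n%:R).
  - exact: bigcup_itvT.
  - move=> _ [[a b]] _ <- /=.
    have [ab|ba] := ltP a b; last first.
      rewrite set_itv_ge ?bnd_simp -?leNgt// /pushforward preimage_set0.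
      by rewrite measure0 /mscale/= /mrestr set0I measure0 mule0.
    transitivity ((mu \x mu) (disc b) - (mu \x mu) (disc a)).
      have E := @measureD _ _ _ (mu \x mu) _ _ (mdisc b) (mdisc a) (disc_fin b).
      rewrite (setIidr (_ : disc a `<=` disc b)) in E; last first.
        by move=> p /= h; apply: le_trans h (ltW ab).
      refine (etrans (congr1 (mu \x mu) _) E).
      apply/seteqP; split => p; rewrite /disc /= in_itv/=.
        by move=> /andP[h1 h2]; split => //; apply/negP; rewrite -ltNge.
      by move=> [h1 /negP]; rewrite -ltNge h1 => ->.
    rewrite /m2 /mscale/= /mrestr.
    have [a0|a0] := leP 0%R a.
      rewrite !discE ?(le_trans a0 (ltW ab))// setIidl; last first.
        move=> x /=; rewrite !in_itv/= andbT => /andP[h _].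
        exact: le_trans a0 (ltW h).
      by rewrite lebesgue_measure_itv/= lte_fin ab -!EFinD -EFinM mulrBr.
    rewrite (disc_lt0 a0) measure0 sube0.
    have [b0|b0] := leP 0%R b.
      rewrite discE// (_ : _ `&` _ = `[0%R, b]%classic).
        rewrite lebesgue_measure_itv/= lte_fin; case: ltgtP b0 => // [_ _|<- _].
          by rewrite -EFinD -EFinM subr0.
        by rewrite mulr0 mule0.
      apply/seteqP; split => x /=; rewrite !in_itv/= ?andbT.
        by move=> [/andP[_ ->] ->].
      by move=> /andP[h1 h2]; rewrite h2 (lt_le_trans a0).
    rewrite disc_lt0// measure0 (_ : _ `&` _ = set0) ?measure0 ?mule0//.
    rewrite -subset0 => x /=; rewrite !in_itv/= andbT => -[/andP[_ h1] h2].
    by have := lt_le_trans (le_lt_trans h2 (le_lt_trans h1 b0)) (lexx _); rewrite ltxx.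
  - move=> n; rewrite /nu/= (@le_lt_trans _ _ ((mu \x mu) (disc n%:R)))//.
      apply: le_area => //.
        by rewrite -[X in measurable X]setTI; exact: measurable_sqnorm2.
      by move=> p; rewrite /= in_itv/= => /andP[].
transitivity (\int[nu]_(x in `[0%R, +oo[) g x).
  rewrite ge0_integral_pushforward//; first last.
  - exact: measurable_funS mg.
  - exact: measurable_sqnorm2.
  rewrite (_ : _ @^-1` _ = setT)//.
  by apply/seteqP; split => p //= _; rewrite in_itv/= andbT addr_ge0// sqr_ge0.
transitivity (\int[mscale (NngNum disc_area_ge0) mu]_(x in `[0%R, +oo[) g x).
  apply: eq_measure_integral => A mA AD.
  refine (etrans (nuE _ mA) _).
  transitivity (disc_area%:E * mu (A `&` `[0%R, +oo[)) => //.
  by rewrite (setIidl AD).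
by apply: (@ge0_integral_mscale _ _ _ mu) => //; exact: measurable_funS mg.
Qed.

End radial.

(** * Cylindrical coordinates in momentum space *)
Section leb2.
Local Open Scope ereal_scope.
Context {R : realType}.
Notation mu := (@lebesgue_measure R).

(** The area measure under a name of its own, so that it can carry the
    sigma-finiteness that Tonelli's theorem asks of the inner factor of [leb3]. *)
Definition leb2 := (mu \x mu).
HB.instance Definition _ := Measure.on leb2.

Let leb2_sigma_finite : sigma_finite setT leb2.
Proof.
exists (fun n => `](- n%:R)%R, n%:R]%classic `*` `](- n%:R)%R, n%:R]%classic).
  apply/esym; rewrite -subTset => -[x y] _.
  pose n := (Num.truncn (`|x| + `|y|)).+1.
  have hn : (`|x| + `|y| < n%:R)%R by exact: Num.Theory.truncnS_gt.
  have hx := normr_ge0 x; have hy := normr_ge0 y.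
  exists n => //; split; rewrite /= in_itv/=; apply/andP.
    have /andP[] : (- n%:R < x < n%:R)%R by rewrite -ltr_norml; lra.
    by move=> ? /ltW.
  have /andP[] : (- n%:R < y < n%:R)%R by rewrite -ltr_norml; lra.
  by move=> ? /ltW.
move=> n; split; first exact: measurableX.
have h : mu `](- n%:R)%R, n%:R]%classic < +oo.
  by rewrite lebesgue_measure_itv/=; case: ifP => _; rewrite -?EFinD ?ltry.
rewrite /leb2 product_measure1E//; apply: lte_mul_pinfty => //.
by rewrite ge0_fin_numE//; exact: h.
Qed.

HB.instance Definition _ := Measure_isSigmaFinite.Build _ _ _ leb2 leb2_sigma_finite.
End leb2.

Section spherical.
Local Open Scope ereal_scope.
Context {R : realType}.
Notation mu := (@lebesgue_measure R).

Let N (p : R * R * R) : R := (p.1.1 ^+ 2 + p.1.2 ^+ 2 + p.2 ^+ 2)%R.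
Let L (a b c : R) (p : R * R * R) : R := (a * p.1.1 + b * p.1.2 + c * p.2)%R.

Let m11 : measurable_fun [set: R * R * R] (fun p => p.1.1).
Proof. exact: (measurableT_comp measurable_fst measurable_fst). Qed.

Let m12 : measurable_fun [set: R * R * R] (fun p => p.1.2).
Proof. exact: (measurableT_comp measurable_snd measurable_fst). Qed.

Lemma measurable_sqnorm3 : measurable_fun [set: R * R * R] N.
Proof.
by apply: measurable_funD => //; first apply: measurable_funD; apply: measurable_funX.
Qed.

Lemma measurable_linear3 a b c : measurable_fun [set: R * R * R] (L a b c).
Proof.
by apply: measurable_funD => //; first apply: measurable_funD; apply: measurable_funM.
Qed.

Lemma tonelli1 (f : R * R -> \bar R) :
  measurable_fun setT f -> (forall p, 0 <= f p) ->
  \int[mu \x mu]_p f p = \int[mu]_x \int[mu]_y f (x, y).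
Proof. by move=> mf f0; exact: (@fubini_tonelli1 _ _ _ _ _ mu mu f). Qed.

Lemma tonelli2 (f : R * R -> \bar R) :
  measurable_fun setT f -> (forall p, 0 <= f p) ->
  \int[mu \x mu]_p f p = \int[mu]_y \int[mu]_x f (x, y).
Proof. by move=> mf f0; exact: (@fubini_tonelli2 _ _ _ _ _ mu mu f). Qed.

Lemma measurable_tonelli1 (f : R * R -> \bar R) :
  measurable_fun setT f -> (forall p, 0 <= f p) ->
  measurable_fun setT (fun x => \int[mu]_y f (x, y)).
Proof. by move=> mf f0; exact: (@measurable_fun_fubini_tonelli_F _ _ _ _ _ mu f). Qed.

Lemma measurable_tonelli2 (f : R * R -> \bar R) :
  measurable_fun setT f -> (forall p, 0 <= f p) ->
  measurable_fun setT (fun y => \int[mu]_x f (x, y)).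
Proof. by move=> mf f0; exact: (@measurable_fun_fubini_tonelli_G _ _ _ _ _ mu f). Qed.

Let leb3_z (f : R * R * R -> \bar R) :
  measurable_fun setT f -> (forall p, 0 <= f p) ->
  \int[@leb3 R]_p f p = \int[mu]_z \int[mu \x mu]_q f (q, z).
Proof. by move=> mf f0; exact: (@fubini_tonelli2 _ _ _ _ _ (@leb2 R) mu f). Qed.

Let leb3_x (f : R * R * R -> \bar R) :
  measurable_fun setT f -> (forall p, 0 <= f p) ->
  \int[@leb3 R]_p f p = \int[mu]_x \int[mu \x mu]_q f (x, q.1, q.2).
Proof.
move=> mf f0; have -> : \int[@leb3 R]_p f p = \int[mu \x mu]_q \int[mu]_z f (q, z).
  exact: (@fubini_tonelli1 _ _ _ _ _ (@leb2 R) mu f).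
rewrite (tonelli1 (f := fun q => \int[mu]_z f (q, z))); last 2 first.
- exact: (@measurable_fun_fubini_tonelli_F _ _ _ _ _ mu f).
- by move=> p; exact: integral_ge0.
apply: eq_integral => x _.
rewrite (tonelli1 (f := fun q => f (x, q.1, q.2)))//.
by apply: (measurableT_comp mf); do 2 apply: measurable_fun_pair => //.
Qed.

Section slices.
Variable F : R * R -> \bar R.
Hypotheses (mF : measurable_fun setT F) (F0 : forall p, 0 <= F p).

Let mFL a b c : measurable_fun [set: R * R * R] (fun p => F (L a b c p, N p)).
Proof.
apply: (measurableT_comp mF); apply: measurable_fun_pair.
- exact: measurable_linear3.
- exact: measurable_sqnorm3.
Qed.

(** Two rotations of coordinate planes turn a unit vector onto the third axis. *)
Let rot12 a b c :
  \int[@leb3 R]_p F (L a b c p, N p) =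
  \int[@leb3 R]_p F (L 0 (Num.sqrt (a ^+ 2 + b ^+ 2)) c p, N p).
Proof.
set r := Num.sqrt _.
have r2 : (r ^+ 2 = a ^+ 2 + b ^+ 2)%R by rewrite sqr_sqrtr// addr_ge0// sqr_ge0.
have [r0|r0] := eqVneq r 0%R.
  have : (a ^+ 2 + b ^+ 2 == 0)%R by rewrite -r2 r0 expr0n.
  rewrite paddr_eq0 ?sqr_ge0// !sqrf_eq0 => /andP[/eqP -> /eqP ->].
  by rewrite r0.
rewrite [LHS](leb3_z (mFL a b c) (fun=> F0 _)) [RHS](leb3_z (mFL 0 r c) (fun=> F0 _)); apply: eq_integral => z _.
have cs : ((b / r) ^+ 2 + (- (a / r)) ^+ 2 = 1)%R.
  by rewrite sqrrN !expr_div_n -mulrDl addrC -r2 mulfV// expf_neq0.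
rewrite -(@ge0_integral_rot R (fun q => F (L a b c (q, z), N (q, z))) _ _ cs)//.
  apply: eq_integral => -[x y] _; congr (F (_, _)); rewrite /L /N/=.
    rewrite mul0r add0r; congr (_ + _)%R.
    apply: (mulIf r0); rewrite -[(r * y * r)%R]mulrAC -expr2 r2; by field.
  congr (_ + _)%R; apply: (mulIf (expf_neq0 2 r0)); rewrite {2}r2; by field.
exact: measurable_fun_pair1 (mFL a b c).
Qed.

Let rot23 b c : (b ^+ 2 + c ^+ 2 = 1)%R ->
  \int[@leb3 R]_p F (L 0 b c p, N p) = \int[@leb3 R]_p F (L 0 0 1 p, N p).
Proof.
move=> bc.
rewrite [LHS](leb3_x (mFL 0 b c) (fun=> F0 _)) [RHS](leb3_x (mFL 0 0 1) (fun=> F0 _)); apply: eq_integral => x _.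
have EL (x' y z : R) : (0 * x' + b * (c * y - - b * z) + c * (- b * y + c * z)
    = 0 * x' + 0 * y + 1 * z)%R.
  by rewrite -bc; ring.
have EN (x' y z : R) : (x' ^+ 2 + (c * y - - b * z) ^+ 2 + (- b * y + c * z) ^+ 2
    = x' ^+ 2 + y ^+ 2 + z ^+ 2)%R.
  rewrite (_ : _ + (- b * y + c * z) ^+ 2 = x' ^+ 2 + (b ^+ 2 + c ^+ 2) * (y ^+ 2 + z ^+ 2))%R.
    by rewrite bc mul1r addrA.
  ring.
have cs : (c ^+ 2 + (- b) ^+ 2 = 1)%R by rewrite sqrrN addrC.
rewrite -(@ge0_integral_rot R (fun q => F (L 0 b c (x, q.1, q.2), N (x, q.1, q.2))) _ _ cs)//.
  apply: eq_integral => -[y z] _; congr (F (_, _)); rewrite /L /N/=.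
    by rewrite EL.
  by rewrite EN.
apply: (measurableT_comp (mFL 0 b c)); do 2 apply: measurable_fun_pair => //.
Qed.

Lemma measurable_below_parabola :
  measurable_fun [set: R * R] (fun p => p.1 ^+ 2 <= p.2)%R.
Proof. by apply: measurable_fun_ler => //; apply: measurable_funX. Qed.

Let mG : measurable_fun setT (fun p : R * R => if (p.1 ^+ 2 <= p.2)%R then F p else 0).
Proof. by apply: measurable_fun_ifT => //; exact: measurable_below_parabola. Qed.

Let G0 (p : R * R) : 0 <= (if (p.1 ^+ 2 <= p.2)%R then F p else 0).
Proof. by case: ifP. Qed.

(** Polar coordinates in the plane orthogonal to the axis: with y = |v|^2 and z the
    component along the axis, the plane contributes the half-line y >= z^2. *)
Let slice (z : R) :
  \int[mu \x mu]_q F (L 0 0 1 (q, z), N (q, z)) =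
  (@disc_area R)%:E * \int[mu]_y (if (z ^+ 2 <= y)%R then F (z, y) else 0).
Proof.
have mFz : measurable_fun setT (fun x : R => F (z, x + z ^+ 2)%R).
  by apply: (measurableT_comp mF); apply: measurable_fun_pair => //; apply: measurable_funD.
have := @ge0_integral_radial R (fun x => F (z, x + z ^+ 2)%R) mFz (fun x => F0 _).
rewrite (_ : integral _ _ _ = \int[mu \x mu]_x F (L 0 0 1 (x, z), N (x, z))); last first.
  by apply: eq_integral => -[x y] _; rewrite /L /N/= !mul0r !add0r mul1r.
move=> ->; congr (_ * _).
have := @ge0_integral_affine R (fun y => if (z ^+ 2 <= y)%R then F (z, y) else 0)
  1 (z ^+ 2)%R (oner_neq0 _).
rewrite normr1 invr1 mul1e => <-//; first last.
- by move=> x; case: ifP.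
- exact: measurable_fun_pair2 mG.
rewrite integral_mkcond; apply: eq_integral => x _; rewrite patchE mul1r.
rewrite lerDr; have [x0|x0] := boolP (0 <= x)%R.
  by rewrite mem_set//= in_itv/= x0.
by rewrite memNset//= in_itv/= andbT; exact/negP.
Qed.

Let axis :
  \int[@leb3 R]_p F (L 0 0 1 p, N p) =
  (@disc_area R)%:E * \int[mu \x mu]_p (if (p.1 ^+ 2 <= p.2)%R then F p else 0).
Proof.
rewrite [LHS](leb3_z (mFL 0 0 1) (fun=> F0 _)) (tonelli1 mG G0).
rewrite -ge0_integralZl//; first last.
- by rewrite lee_fin disc_area_ge0.
- by move=> x _; exact: integral_ge0.
- exact: (measurable_tonelli1 mG G0).
apply: eq_integral => z _; exact: slice.
Qed.

Lemma ge0_integral_slices (a b c : R) : (a ^+ 2 + b ^+ 2 + c ^+ 2 = 1)%R ->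
  \int[@leb3 R]_p F (L a b c p, N p) =
  (@disc_area R)%:E * \int[mu \x mu]_p (if (p.1 ^+ 2 <= p.2)%R then F p else 0).
Proof.
move=> abc; rewrite rot12 rot23 ?axis//.
by rewrite sqr_sqrtr// addr_ge0// sqr_ge0.
Qed.

End slices.

(** The coordinates that matter: [p.1] is the component u along a unit vector of
    the velocity of momentum v, and [p.2] is t = 1 + |v|^2.  Their range is the
    set where |u| is at most the speed, that is u^2 <= 1 - 1/t. *)
Definition sph_dom (p : R * R) : bool := ((0 < p.2) && (1 <= (1 - p.1 ^+ 2) * p.2))%R.

Lemma measurable_sph_dom : measurable_fun setT sph_dom.
Proof.
apply: measurable_and; first exact: measurable_fun_ltr.
apply: measurable_fun_ler => //; apply: measurable_funM => //.
by apply: measurable_funB => //; exact: measurable_funX.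
Qed.

(** The substitution z = u (sqrt t) in the slice of fixed t = 1 + y is the origin of
    the Jacobian sqrt t. *)
Lemma ge0_integral_spherical (F : R * R -> \bar R) (a b c : R) :
  (a ^+ 2 + b ^+ 2 + c ^+ 2 = 1)%R ->
  measurable_fun setT F -> (forall p, 0 <= F p) ->
  \int[@leb3 R]_p F (L a b c p / Num.sqrt (1 + N p), 1 + N p)%R =
  (@disc_area R)%:E *
    \int[mu \x mu]_p (if sph_dom p then (Num.sqrt p.2)%:E * F p else 0).
Proof.
move=> abc mF F0.
pose F' (p : R * R) := F (p.1 / Num.sqrt (1 + p.2), 1 + p.2)%R.
have msq := @measurable_sqrt R.
have mF' : measurable_fun setT F'.
  apply: (measurableT_comp mF); apply: measurable_fun_pair.
    apply: measurable_funM => //; apply: (measurableT_comp (@measurable_inv R)).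
    by apply: (measurableT_comp msq); exact: measurable_funD.
  exact: measurable_funD.
have := @ge0_integral_slices F' mF' (fun p => F0 _) _ _ _ abc; rewrite /F'/= => ->.
congr (_ * _).
have mRHS : measurable_fun setT (fun p : R * R =>
    if sph_dom p then (Num.sqrt p.2)%:E * F p else 0).
  apply: measurable_fun_ifT => //; first exact: measurable_sph_dom.
  by apply: emeasurable_funM => //; apply/measurable_EFinP; exact: measurableT_comp.
have RHS0 (p : R * R) : 0 <= (if sph_dom p then (Num.sqrt p.2)%:E * F p else 0).
  by case: ifP => // _; rewrite mule_ge0// lee_fin sqrtr_ge0.
have mLHS : measurable_fun setT (fun p : R * R => if (p.1 ^+ 2 <= p.2)%R then F' p else 0).
  by apply: measurable_fun_ifT => //; exact: measurable_below_parabola.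
have LHS0 (p : R * R) : 0 <= (if (p.1 ^+ 2 <= p.2)%R then F' p else 0).
  by case: ifP => // _; exact: F0.
rewrite (tonelli2 mLHS LHS0) (tonelli2 mRHS RHS0).
have mH := measurable_tonelli2 mRHS RHS0.
have H0 (y : R) : 0 <= \int[mu]_x (if sph_dom (x, y) then
    (Num.sqrt y)%:E * F (x, y) else 0).
  by apply: integral_ge0 => x _; exact: (RHS0 (x, y)).
have := @ge0_integral_affine R _ 1 1 (oner_neq0 _) mH H0.
rewrite normr1 invr1 mul1e => H1; rewrite -[RHS]H1 {H1}.
apply: eq_integral => P _; rewrite mul1r/=.
have [P0|P0] := ltP P 0%R.
  rewrite [LHS]integral0_eq; last first.
    by move=> z _; rewrite ifF//; apply/negbTE; rewrite -ltNge (lt_le_trans P0)// sqr_ge0.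
  rewrite [RHS]integral0_eq// => u _; rewrite ifF//; apply/negbTE/negP.
  move=> /andP[/= h1 h2]; have := mulr_ge0 (sqr_ge0 u) (ltW h1); lra.
have t0 : (0 < Num.sqrt (P + 1))%R by rewrite sqrtr_gt0; lra.
have t2 : (Num.sqrt (P + 1) ^+ 2 = P + 1)%R by rewrite sqr_sqrtr//; lra.
have mS : measurable_fun setT (fun z : R => if (z ^+ 2 <= P)%R then F' (z, P) else 0).
  exact: measurable_fun_pair1 mLHS.
have := @ge0_integral_affine R _ (Num.sqrt (P + 1)) 0 (lt0r_neq0 t0) mS (fun z => LHS0 (z, P)).
rewrite gtr0_norm// => H.
transitivity ((Num.sqrt (P + 1))%:E * ((Num.sqrt (P + 1))^-1%:E *
    \int[mu]_z (if (z ^+ 2 <= P)%R then F' (z, P) else 0))).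
  by rewrite muleA -EFinM mulfV ?lt0r_neq0// mul1e.
rewrite -H -ge0_integralZl//; first last.
- by move=> u _; exact: (LHS0 (_, P)).
- by apply: (measurableT_comp mS); exact: measurable_affine.
apply: eq_integral => u _; rewrite addr0 /sph_dom/=.
have -> : (0 < P + 1)%R by lra.
rewrite exprMn t2/= (_ : ((P + 1) * u ^+ 2 <= P)%R = (1 <= (1 - u ^+ 2) * (P + 1))%R); last first.
  by apply/idP/idP; lra.
case: ifP => _; rewrite ?mule0//; congr (_ * F (_, _)).
  by rewrite /= (addrC 1%R) mulrAC mulfV ?mul1r// lt0r_neq0.
by rewrite addrC.
Qed.

End spherical.

(** * Vectors and the velocity integral *)
Section vectors.
Context {R : realType}.

Lemma dotE (u v : 'cV[R]_3) :
  dot u v = u 0 0 * v 0 0 + u 1 0 * v 1 0 + u 2%:R 0 * v 2%:R 0.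
Proof.
rewrite /dot !big_ord_recr big_ord0/= add0r.
by congr (_ * _ + _ * _ + _ * _); congr (_ _ _); apply/val_inj.
Qed.

Lemma vec3E (p : R * R * R) :
  ((vec3 p 0 0 = p.1.1) * (vec3 p 1 0 = p.1.2) * (vec3 p 2%:R 0 = p.2))%type.
Proof. by rewrite /vec3; do !split; rewrite mxE. Qed.

Lemma dot_ge0 (v : 'cV[R]_3) : 0 <= dot v v.
Proof. by rewrite dotE; do 2 (apply: addr_ge0; last exact: sqr_ge0); exact: sqr_ge0. Qed.

Lemma enorm_sq (v : 'cV[R]_3) : enorm v ^+ 2 = dot v v.
Proof. by rewrite sqr_sqrtr// dot_ge0. Qed.

Lemma jap_sq (v : 'cV[R]_3) : jap v ^+ 2 = 1 + enorm v ^+ 2.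
Proof. by rewrite sqr_sqrtr// addr_ge0// sqr_ge0. Qed.

Lemma jap_ge1 (v : 'cV[R]_3) : 1 <= jap v.
Proof. by rewrite -[leLHS]sqrtr1 ler_wsqrtr// lerDl sqr_ge0. Qed.

Lemma dotZr (u v : 'cV[R]_3) (a : R) : dot u (a *: v) = a * dot u v.
Proof. by rewrite !dotE !mxE; ring. Qed.

Lemma dotZl (u v : 'cV[R]_3) (a : R) : dot (a *: u) v = a * dot u v.
Proof. by rewrite !dotE !mxE; ring. Qed.

Lemma enorm_gt0 (v : 'cV[R]_3) : v != 0 -> 0 < enorm v.
Proof.
move=> v0; rewrite lt_def sqrtr_ge0 andbT; apply: contra v0.
rewrite -sqrf_eq0 enorm_sq dotE !paddr_eq0 ?addr_ge0// -?expr2 ?sqr_ge0//.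
rewrite !sqrf_eq0 => /andP[/andP[/eqP h0 /eqP h1] /eqP h2].
apply/eqP/matrixP => i j; rewrite ord1 mxE.
case: i => [[|[|[|//]]]] Hi.
- by rewrite -[RHS]h0; congr (v _ _); exact/val_inj.
- by rewrite -[RHS]h1; congr (v _ _); exact/val_inj.
- by rewrite -[RHS]h2; congr (v _ _); exact/val_inj.
Qed.

End vectors.

Section rint3.
Local Open Scope ereal_scope.
Context {R : realType}.
Notation mu := (@lebesgue_measure R).

Let H (F : R * R -> R) (p : R * R) : R :=
  if sph_dom p then (Num.sqrt p.2 * F p)%R else 0%R.

Let X (w : 'cV[R]_3) (p : R * R * R) : R * R :=
  (dot w (vhat (vec3 p)), jap (vec3 p) ^+ 2)%R.

Let XE w p : X w p =
  ((w 0 0 * p.1.1 + w 1 0 * p.1.2 + w 2%:R 0 * p.2)%R /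
    Num.sqrt (1 + (p.1.1 ^+ 2 + p.1.2 ^+ 2 + p.2 ^+ 2)),
   1 + (p.1.1 ^+ 2 + p.1.2 ^+ 2 + p.2 ^+ 2))%R.
Proof.
by rewrite /X /vhat dotZr jap_sq /jap enorm_sq !dotE !vec3E -!expr2 mulrC.
Qed.

Lemma ge0_integral_leb3 (F : R * R -> \bar R) (w : 'cV[R]_3) : enorm w = 1%R ->
  measurable_fun setT F -> (forall p, 0 <= F p) ->
  \int[@leb3 R]_p F (dot w (vhat (vec3 p)), jap (vec3 p) ^+ 2)%R =
  (@disc_area R)%:E *
    \int[mu \x mu]_p (if sph_dom p then (Num.sqrt p.2)%:E * F p else 0).
Proof.
move=> w1 mF F0.
have h : (w 0 0 ^+ 2 + w 1 0 ^+ 2 + w 2%:R 0 ^+ 2 = 1)%R.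
  by rewrite !expr2 -dotE -enorm_sq w1 expr1n.
rewrite -(ge0_integral_spherical h mF F0).
by apply: eq_integral => p _; rewrite -/(X w p) XE.
Qed.

Lemma rint3_spherical (F : R * R -> R) (w : 'cV[R]_3) : enorm w = 1%R ->
  measurable_fun setT F -> (mu \x mu).-integrable setT (EFin \o H F) ->
  rint3 (fun v => F (dot w (vhat v), jap v ^+ 2)%R) =
  (@disc_area R * \int[mu \x mu]_p H F p)%R.
Proof.
move=> w1 mF iH; rewrite /rint3 /Rintegral -[RHS]/(fine _%:E).
have mF' : measurable_fun setT (EFin \o F) by exact/measurable_EFinP.
have -> : \int[@leb3 R]_p (F (dot w (vhat (vec3 p)), jap (vec3 p) ^+ 2)%R)%:E =
    (@disc_area R)%:E * \int[mu \x mu]_p (if sph_dom p then (Num.sqrt p.2)%:E * (EFin \o F)^\+ p else 0)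
    - (@disc_area R)%:E * \int[mu \x mu]_p (if sph_dom p then (Num.sqrt p.2)%:E * (EFin \o F)^\- p else 0).
  rewrite -[LHS]/(\int[@leb3 R]_p ((EFin \o F) \o X w) p) integralE.
  rewrite funepos_comp funeneg_comp.
  by rewrite -(ge0_integral_leb3 w1 (measurable_funepos mF'))//
    -(ge0_integral_leb3 w1 (measurable_funeneg mF')).
have Ep : \int[mu \x mu]_p (if sph_dom p then (Num.sqrt p.2)%:E * (EFin \o F)^\+ p else 0)
   = \int[mu \x mu]_p (EFin \o H F)^\+ p.
  apply: eq_integral => p _; rewrite /H !funeposE/=; case: ifP => _.
    by rewrite -!EFin_max -EFinM maxr_pMr ?mulr0// sqrtr_ge0.
  by rewrite maxxx.
have En : \int[mu \x mu]_p (if sph_dom p then (Num.sqrt p.2)%:E * (EFin \o F)^\- p else 0)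
   = \int[mu \x mu]_p (EFin \o H F)^\- p.
  apply: eq_integral => p _; rewrite /H !funenegE/=; case: ifP => _.
    by rewrite -!EFin_max -EFinM maxr_pMr ?mulr0 ?mulrN// sqrtr_ge0.
  by rewrite oppr0 maxxx.
rewrite Ep En.
have Hp : \int[mu \x mu]_p (EFin \o H F)^\+ p \is a fin_num.
  by apply: integrable_fin_num => //; exact: integrable_funepos.
have Hn : \int[mu \x mu]_p (EFin \o H F)^\- p \is a fin_num.
  by apply: integrable_fin_num => //; exact: integrable_funeneg.
rewrite [in RHS]integralE -(fineK Hp) -(fineK Hn) -!EFinM -!EFinB/=.
by rewrite mulrBr.
Qed.

End rint3.

(** * Integrals over half-lines *)
Section tail.
Context {R : realType}.
Notation mu := (@lebesgue_measure R).

Lemma integral_inv_sq (a : R) : 0 < a ->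
  (\int[mu]_(t in `[a, +oo[) (t ^- 2)%:E = (a^-1)%:E)%E.
Proof.
move=> a0.
have pos x : a <= x -> 0 < x by exact: lt_le_trans.
rewrite (@ge0_continuous_FTC2y R (fun t => t ^- 2) (fun t => - t^-1) a 0).
- by rewrite sub0e -EFinN opprK.
- by move=> x ax; rewrite invr_ge0 sqr_ge0.
- apply: continuous_in_subspaceT => x /set_mem /=; rewrite in_itv/= andbT => /pos x0.
  apply: (@continuous_comp _ _ _ (fun t : R => t ^+ 2) GRing.inv).
    exact: exprn_continuous.
  by apply: inv_continuous; rewrite expf_neq0// gt_eqF.
- rewrite -oppr0; apply: cvgN; apply/gtr0_cvgV0; last exact: cvg_id.
  exact: nbhs_pinfty_gt.
- move=> x ax; apply: derivableN; apply: derivableV => //.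
  by rewrite gt_eqF// (lt_trans a0).
- apply: cvgN; apply: cvgV; first by rewrite gt_eqF.
  exact: cvg_at_right_filter.
- move=> x; rewrite in_itv/= andbT => ax.
  have x0 : x != 0 by rewrite gt_eqF// (lt_trans a0).
  rewrite derive1E deriveN; last exact: derivableV.
  by rewrite deriveV// derive_id /GRing.scale/= mulr1 opprK.
Qed.

(** The indicator of the dilated half-line [1/s, +oo[, for which s <= 0 stands
    for the empty one. *)
Definition halfline (s : R) (t : R) : bool := (0 < t) && (1 <= s * t).

Lemma measurable_halfline s : measurable_fun setT (halfline s).
Proof.
apply: measurable_and; first exact: measurable_fun_ltr.
by apply: measurable_fun_ler => //; exact: measurable_funM.
Qed.

Lemma halfline_le0 s t : s <= 0 -> halfline s t = false.
Proof.
move=> s0; apply/negbTE/negP => /andP[t0 st].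
by have := mulr_le0_ge0 s0 (ltW t0); lra.
Qed.

Lemma halfline_gt0 s t : 0 < s -> halfline s t = (s^-1 <= t).
Proof.
move=> s0; rewrite /halfline -ler_pdivrMl// mulr1.
by case: (leP s^-1 t) => st; rewrite ?andbF// (lt_le_trans _ st)// invr_gt0.
Qed.

Lemma halfline_ge1 s t : s <= 1 -> halfline s t -> 1 <= t.
Proof.
move=> s1; have [s0|s0] := ltP 0 s; last by rewrite halfline_le0.
by rewrite halfline_gt0//; apply: le_trans; rewrite invf_ge1.
Qed.

Lemma halflineW s s' t : s <= s' -> halfline s t -> halfline s' t.
Proof.
move=> ss' /andP[t0 st]; rewrite /halfline t0/= (le_trans st)//.
by rewrite ler_pM2r.
Qed.

Lemma integral_tail (s : R) : s <= 1 ->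
  (\int[mu]_t (if halfline s t then t ^- 2 else 0)%:E = (Num.max s 0)%:E)%E.
Proof.
move=> s1; have [s0|s0] := ltP 0 s; last first.
  by rewrite integral0_eq// => t _; rewrite halfline_le0.
rewrite -[in RHS](invrK s) -integral_inv_sq ?invr_gt0//.
rewrite [RHS]integral_mkcond; apply: eq_integral => t _; rewrite halfline_gt0// patchE.
case: ifPn => h; first by rewrite mem_set//= in_itv/= h.
by rewrite memNset//= in_itv/= andbT; exact/negP.
Qed.

Lemma measurable_tail (f : R -> R) s : measurable_fun setT f ->
  measurable_fun setT (fun t => if halfline s t then f t else 0).
Proof. by move=> mf; apply: measurable_fun_ifT => //; exact: measurable_halfline. Qed.

Lemma measurable_invsq : measurable_fun [set: R] (fun t : R => t ^- 2).
Proof.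
by apply: (measurableT_comp (@measurable_inv R)); exact: measurable_funX.
Qed.

Lemma integrable_tail (s : R) : s <= 1 ->
  mu.-integrable setT (fun t => (if halfline s t then t ^- 2 else 0)%:E).
Proof.
move=> s1; apply/integrableP; split.
  by apply/measurable_EFinP; apply: measurable_tail; exact: measurable_invsq.
rewrite [ltLHS](_ : _ = (Num.max s 0)%:E) ?ltry// -integral_tail//.
apply: eq_integral => t _; rewrite gee0_abs// lee_fin.
by case: ifP => // _; rewrite invr_ge0 sqr_ge0.
Qed.

End tail.

(** * The profile of the equilibrium and integration by parts *)
Section real_dominated_convergence.
Context d (T : measurableType d) (R : realType) (mu : {measure set T -> \bar R}).
Variables (f_ : nat -> T -> R) (f g : T -> R).
Hypotheses (mf_ : forall n, measurable_fun setT (f_ n))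
  (mf : measurable_fun setT f)
  (f_f : {ae mu, forall x, f_ n x @[n --> \oo] --> f x})
  (ig : mu.-integrable setT (EFin \o g))
  (f_g : forall n x, `|f_ n x| <= g x).

Lemma Rintegral_dominated_cvg :
  mu.-integrable setT (EFin \o f) /\
  \int[mu]_x f_ n x @[n --> \oo] --> \int[mu]_x f x.
Proof.
have [] := @dominated_convergence _ _ _ mu setT measurableT
  (fun n x => (f_ n x)%:E) (EFin \o f) (EFin \o g).
- by move=> n; exact/measurable_EFinP.
- exact/measurable_EFinP.
- by apply: filterS f_f => x h _; apply: cvg_EFin => //; exact: nearW.
- exact: ig.
- by apply: aeW => x n _; rewrite /= lee_fin.
move=> If _ h; split => //; apply: fine_cvg.
by rewrite fineK//; exact: integrable_fin_num.
Qed.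

End real_dominated_convergence.

Section profile.
Context {R : realType}.
Notation mu := (@lebesgue_measure R).

(** The equilibrium as a function of t = 1 + |v|^2, with its derivative.  With these
    decay rates, t Phi and t Phi' are dominated by multiples of t^-2. *)
Record profile (Phi dPhi : R -> R) (A : R) : Prop := Profile {
  profile_measurable : measurable_fun setT Phi;
  profile_dmeasurable : measurable_fun setT dPhi;
  profile_derive : forall t : R, 1 <= t -> is_derive t 1 Phi (dPhi t);
  profile_ge0 : forall t : R, 1 <= t -> 0 <= Phi t;
  profile_le : forall t : R, 1 <= t -> Phi t <= A * t ^- 3;
  profile_dle : forall t : R, 1 <= t -> `|dPhi t| <= A * t ^- 4
}.

Variables (Phi dPhi : R -> R) (A : R).
Hypothesis PhiP : profile Phi dPhi A.

Let A0 : 0 <= A.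
Proof.
have := profile_le PhiP (lexx 1); rewrite expr1n invr1 mulr1.
exact: le_trans (profile_ge0 PhiP (lexx 1)).
Qed.

Let invX_le (t : R) (n : nat) : 1 <= t -> t ^- n.+1 <= t ^- n.
Proof.
move=> t1; have t0 : 0 < t by lra.
by rewrite lef_pV2 ?posrE ?exprn_gt0// exprS ler_peMl// exprn_ge0// ltW.
Qed.

Lemma profile_le2 t : 1 <= t -> Phi t <= A * t ^- 2.
Proof.
move=> t1; apply: le_trans (profile_le PhiP t1) _.
by rewrite ler_wpM2l// invX_le.
Qed.

Let sub_tail (f : R -> R) (s C : R) : s <= 1 -> 0 <= C -> measurable_fun setT f ->
  (forall t, halfline s t -> `|f t| <= C * t ^- 2) ->
  mu.-integrable setT (fun t => (if halfline s t then f t else 0)%:E).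
Proof.
move=> s1 C0 mf fC.
have h := integrableZl measurableT C (integrable_tail s1).
apply: le_integrable h => //.
  by apply/measurable_EFinP; exact: measurable_tail.
move=> t _; rewrite -EFinM !abse_EFin lee_fin.
case: ifP => h; last by rewrite normr0.
by apply: le_trans (fC _ h) _; exact: ler_norm.
Qed.

Lemma integrable_profile s : s <= 1 ->
  mu.-integrable setT (fun t => (if halfline s t then Phi t else 0)%:E).
Proof.
move=> s1; apply: (@sub_tail _ _ A) => //; first exact: (profile_measurable PhiP).
move=> t /(halfline_ge1 s1) t1; rewrite ger0_norm ?(profile_ge0 PhiP)//.
exact: profile_le2.
Qed.

Definition tail_mass (s : R) : R := \int[mu]_t (if halfline s t then Phi t else 0).

Lemma tail_mass_le0 s : s <= 0 -> tail_mass s = 0.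
Proof.
move=> s0; rewrite /tail_mass /Rintegral integral0_eq// => t _.
by rewrite halfline_le0.
Qed.

Lemma tail_mass_mono s s' : s <= s' -> s' <= 1 -> tail_mass s <= tail_mass s'.
Proof.
move=> ss' s'1; apply: le_Rintegral => //.
- exact: integrable_profile (le_trans ss' s'1).
- exact: integrable_profile.
move=> t _; case: ifP => h.
  by rewrite (halflineW ss' h).
by case: ifP => // /(halfline_ge1 s'1); exact: (profile_ge0 PhiP).
Qed.

Lemma tail_mass_ge0 s : s <= 1 -> 0 <= tail_mass s.
Proof.
move=> s1; have [s0|/ltW s0] := leP s 0; first by rewrite tail_mass_le0.
by rewrite -(tail_mass_le0 (lexx 0)) tail_mass_mono.
Qed.

(** The mass added between s and s' is at most A times the integral of t^-2 over
    [1/s', 1/s], which is s' - s. *)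
Lemma tail_mass_lip s s' : 0 <= s -> s <= s' -> s' <= 1 ->
  tail_mass s' - tail_mass s <= A * (s' - s).
Proof.
move=> s0 ss' s'1; have s1 := le_trans ss' s'1.
have E r : r <= 1 -> 0 <= r -> \int[mu]_t (if halfline r t then t ^- 2 else 0) = r.
  by move=> r1 r0; rewrite /Rintegral integral_tail//= max_l.
pose p r (t : R) : R := if halfline r t then Phi t else 0.
pose q r (t : R) : R := if halfline r t then t ^- 2 else 0.
have ip r : r <= 1 -> mu.-integrable setT (EFin \o p r) by exact: integrable_profile.
have iq r : r <= 1 -> mu.-integrable setT (EFin \o q r) by exact: integrable_tail.
have ipB : mu.-integrable setT (EFin \o (fun t => p s' t - p s t)).
  by apply: (integrableB measurableT (ip _ s'1) (ip _ s1)).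
have iqB : mu.-integrable setT (EFin \o (fun t => q s' t - q s t)).
  by apply: (integrableB measurableT (iq _ s'1) (iq _ s1)).
have iqA : mu.-integrable setT (EFin \o (fun t => A * (q s' t - q s t))).
  exact: integrableZl iqB.
have -> : tail_mass s' - tail_mass s = \int[mu]_t (p s' t - p s t).
  by rewrite (RintegralB measurableT (ip _ s'1) (ip _ s1)).
have -> : A * (s' - s) = \int[mu]_t (A * (q s' t - q s t)).
  rewrite (RintegralZl A measurableT iqB) (RintegralB measurableT (iq _ s'1) (iq _ s1)).
  by rewrite !E// (le_trans s0).
apply: (le_Rintegral measurableT ipB iqA) => t _; rewrite /p /q.
have [h|h] := boolP (halfline s t).
  by rewrite (halflineW ss' h) !subrr mulr0.
rewrite !subr0; case: ifP => [/(halfline_ge1 s'1)|_]; last by rewrite mulr0.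
exact: profile_le2.
Qed.

Section by_parts.
Variable s : R.
Hypotheses (s_gt0 : 0 < s) (s_le1 : s <= 1).

Let w (t : R) : R := Num.max (s * t - 1) 0.

Let w_halfline t : ~~ halfline s t -> w t = 0.
Proof.
rewrite halfline_gt0// -ltNge => h; rewrite /w max_r// subr_le0 ltW//.
by rewrite -ltr_pdivlMl ?mulr1.
Qed.

Let w_ge0 t : 0 <= w t. Proof. by rewrite /w le_max lexx orbT. Qed.

Let w_le t : halfline s t -> w t <= t.
Proof.
move=> h; have t1 := halfline_ge1 s_le1 h.
rewrite /w ge_max; apply/andP; split; last lra.
have : s * t <= 1 * t by rewrite ler_wpM2r//; lra.
lra.
Qed.

Let w_lip t d : 0 <= d -> 0 <= w t - w (t - d) <= s * d.
Proof.
move=> d0; have sd : 0 <= s * d by rewrite mulr_ge0// ltW.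
rewrite /w mulrBr; case: (leP (s * t - 1) 0) => h1; case: (leP (s * t - s * d - 1) 0) => h2;
  lra.
Qed.

Let measurable_w : measurable_fun setT w.
Proof.
by apply: measurable_maxr => //; apply: measurable_funB.
Qed.

Let delta (n : nat) : R := n.+1%:R^-1.
Let delta_gt0 n : 0 < delta n. Proof. by rewrite invr_gt0. Qed.

Let delta_cvg : delta n @[n --> \oo] --> 0.
Proof. exact: cvg_harmonic. Qed.

Let f_ n t := w t * ((Phi (t + delta n) - Phi t) / delta n).
Let g_ n t := (w (t - delta n) - w t) / delta n * Phi t.

Let mPhi : measurable_fun setT Phi. Proof. exact: (profile_measurable PhiP). Qed.
Let mdPhi : measurable_fun setT dPhi. Proof. exact: (profile_dmeasurable PhiP). Qed.

Let mshift (f : R -> R) (a : R) :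
  measurable_fun setT f -> measurable_fun setT (fun t : R => f (t + a)).
Proof. by move=> mf; apply: (measurableT_comp mf); apply: measurable_funD. Qed.

Let iwPhi n : mu.-integrable setT (EFin \o (fun t => w (t - delta n) * Phi t)).
Proof.
have -> : (fun t => w (t - delta n) * Phi t) =
    (fun t => if halfline s t then w (t - delta n) * Phi t else 0).
  apply/funext => t; case: ifPn => // h.
  have /w_halfline -> : ~~ halfline s (t - delta n); last by rewrite mul0r.
  move: h; rewrite !halfline_gt0// -!ltNge => h; apply: le_lt_trans h.
  by rewrite gerBl ltW.
apply: (@sub_tail _ _ A) => //.
  by apply: measurable_funM => //; exact: mshift.
move=> t h; have t1 := halfline_ge1 s_le1 h.
have Phi0 := profile_ge0 PhiP t1.
rewrite ger0_norm ?mulr_ge0//.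
have /andP[wl _] := w_lip t (ltW (delta_gt0 n)).
apply: (@le_trans _ _ (t * (A * t ^- 3))).
  apply: ler_pM => //; last exact: (profile_le PhiP t1).
  by have := w_le h; lra.
by rewrite mulrCA exprS invfM mulVKf// gt_eqF//; lra.
Qed.

Let iwPhi0 : mu.-integrable setT (EFin \o (fun t => w t * Phi t)).
Proof.
have -> : (fun t => w t * Phi t) = (fun t => if halfline s t then w t * Phi t else 0).
  by apply/funext => t; case: ifPn => // /w_halfline ->; rewrite mul0r.
apply: (@sub_tail _ _ A) => //; first exact: measurable_funM.
move=> t h; have t1 := halfline_ge1 s_le1 h.
have Phi0 := profile_ge0 PhiP t1.
rewrite ger0_norm ?mulr_ge0//.
apply: (@le_trans _ _ (t * (A * t ^- 3))).
  by apply: ler_pM => //; [exact: w_le|exact: (profile_le PhiP t1)].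
by rewrite mulrCA exprS invfM mulVKf// gt_eqF//; lra.
Qed.

Let shiftE n : \int[mu]_t (w t * Phi (t + delta n)) = \int[mu]_t (w (t - delta n) * Phi t).
Proof.
have := @Rintegral_affine R (fun t => w (t - delta n) * Phi t) 1 (delta n) (oner_neq0 _).
rewrite normr1 invr1 mul1r => <-; last first.
  by apply: measurable_funM => //; exact: mshift.
by apply: eq_Rintegral => t _; rewrite mul1r addrK.
Qed.

Let iwPhi' n : mu.-integrable setT (EFin \o (fun t => w t * Phi (t + delta n))).
Proof.
have -> : (fun t => w t * Phi (t + delta n)) =
    (fun t => if halfline s t then w t * Phi (t + delta n) else 0).
  by apply/funext => t; case: ifPn => // /w_halfline ->; rewrite mul0r.
apply: (@sub_tail _ _ A) => //; first by apply: measurable_funM => //; exact: mshift.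
move=> t h; have t1 := halfline_ge1 s_le1 h.
have d0 := delta_gt0 n.
have t1' : 1 <= t + delta n by lra.
have Phi0 := profile_ge0 PhiP t1'.
rewrite ger0_norm ?mulr_ge0//.
apply: (@le_trans _ _ (t * (A * t ^- 3))).
  apply: ler_pM => //; first exact: w_le.
  apply: le_trans (profile_le PhiP t1') _; rewrite ler_wpM2l// lef_pV2 ?posrE ?exprn_gt0//; try lra.
  by rewrite ler_pXn2r// ?nnegrE; lra.
by rewrite mulrCA exprS invfM mulVKf// gt_eqF//; lra.
Qed.

Let fgE n : \int[mu]_t f_ n t = \int[mu]_t g_ n t.
Proof.
transitivity ((\int[mu]_t (w t * Phi (t + delta n)) - \int[mu]_t (w t * Phi t)) / delta n).
  rewrite -RintegralB// -RintegralZr//.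
    by apply: eq_Rintegral => t _; rewrite /f_; ring.
  exact: (integrableB measurableT (iwPhi' n) iwPhi0).
rewrite shiftE -RintegralB// -RintegralZr//.
  by apply: eq_Rintegral => t _; rewrite /g_; ring.
exact: (integrableB measurableT (iwPhi n) iwPhi0).
Qed.

Let bound : mu.-integrable setT (EFin \o (fun t => A * (if halfline s t then t ^- 2 else 0))).
Proof. exact: integrableZl (integrable_tail s_le1). Qed.

Let increment_le (t d : R) : 1 <= t -> 0 < d ->
  `|Phi (t + d) - Phi t| <= A * t ^- 4 * d.
Proof.
move=> t1 d0.
have [c] : exists2 c, c \in `]t, (t + d)[%R & Phi (t + d) - Phi t = dPhi c * (t + d - t).
  apply: (@MVT R Phi dPhi); first by rewrite ltrDl.
    by move=> x; rewrite in_itv/= => /andP[tx _]; apply: (profile_derive PhiP); lra.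
  apply: derivable_within_continuous => x; rewrite in_itv/= => /andP[tx _].
  by have [] := @profile_derive _ _ _ PhiP x (le_trans t1 tx).
rewrite in_itv/= => /andP[tc _] ->; rewrite addrAC subrr add0r.
have c1 : 1 <= c by lra.
rewrite normrM (gtr0_norm d0) ler_wpM2r//; first exact: ltW.
apply: le_trans (profile_dle PhiP c1) _.
rewrite ler_wpM2l// lef_pV2 ?posrE ?exprn_gt0//; try lra.
by rewrite ler_pXn2r// ?nnegrE; lra.
Qed.

Let f_cvg : \int[mu]_t f_ n t @[n --> \oo] --> \int[mu]_t (w t * dPhi t).
Proof.
apply: (Rintegral_dominated_cvg _ _ _ bound _).2.
- move=> n; apply: measurable_funM => //; apply: measurable_funM => //.
  by apply: measurable_funB => //; exact: mshift.
- exact: measurable_funM.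
- apply: aeW => t; have [h|/w_halfline w0] := boolP (halfline s t); last first.
    by rewrite /f_ w0 mul0r; under eq_fun do rewrite mul0r; exact: cvg_cst.
  have t1 := halfline_ge1 s_le1 h.
  apply: cvgMr.
  have [dt dE] := profile_derive PhiP t1.
  move: dt => /cvg_ex[l]; move=> hl.
  have -> : dPhi t = l by rewrite -dE; apply/cvg_lim.
  move/cvgr_dnbhsP : hl => /(_ delta) h'.
  have {}h' := h' (conj (fun n => lt0r_neq0 (delta_gt0 n)) delta_cvg).
  apply: cvg_trans h'; apply: near_eq_cvg; apply: nearW => n /=.
  by rewrite /GRing.scale/= mulr1 (addrC _ t) mulrC.
move=> n t; rewrite /f_; have [h|/w_halfline ->] := boolP (halfline s t); last first.
  by rewrite mul0r normr0 mulr0.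
have t1 := halfline_ge1 s_le1 h.
have d0 := delta_gt0 n.
have q := increment_le t1 d0.
rewrite normrM ger0_norm// normrM normfV (gtr0_norm d0).
apply: (@le_trans _ _ (t * (A * t ^- 4))).
  apply: ler_pM => //; [by rewrite divr_ge0// ltW|exact: w_le|by rewrite ler_pdivrMr].
rewrite mulrCA (exprS _ 3) invfM mulVKf ?gt_eqF//; last lra.
by rewrite ler_wpM2l// invX_le.
Qed.

Let g_cvg : \int[mu]_t g_ n t @[n --> \oo] --> - s * tail_mass s.
Proof.
rewrite /tail_mass -RintegralZl ?integrable_profile//.
apply: (Rintegral_dominated_cvg _ _ _ bound _).2.
- move=> n; apply: measurable_funM => //; apply: measurable_funM => //.
  by apply: measurable_funB => //; exact: mshift.
- by apply: measurable_funM => //; exact: measurable_tail.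
(* at the corner t = 1/s of the ramp the quotients tend to 0 instead of - s *)
- exists [set s^-1]; split => //; first exact: lebesgue_measure_set1.
  move=> t /= h; apply/eqP/negPn/negP => ts; apply: h.
  have [h|h] := boolP (halfline s t); last first.
    rewrite mulr0 /g_ (w_halfline h); under eq_fun => n.
      have /andP[] := w_lip t (ltW (delta_gt0 n)); rewrite (w_halfline h) sub0r oppr_ge0 => w0 _.
      have -> : w (t - delta n) = 0 by apply/eqP; rewrite eq_le w0 w_ge0.
      rewrite subrr !mul0r.
    over.
    exact: cvg_cst.
  apply: cvgMl; apply: cvg_near_cst.
  have st : s * t - 1 > 0.
    rewrite subr_gt0 -ltr_pdivrMl// mulr1 lt_neqAle eq_sym ts/=.
    by rewrite halfline_gt0 in h.
  have : \forall n \near \oo, s * delta n < s * t - 1.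
    have : s * delta n @[n --> \oo] --> s * 0 by exact: cvgMr.
    by rewrite mulr0 => /cvgr_lt; apply.
  apply: filterS => n sn; rewrite /w !max_l ?mulrBr; try lra.
  by apply: (mulIf (lt0r_neq0 (delta_gt0 n))); rewrite mulfVK ?lt0r_neq0//; ring.
move=> n t; rewrite /g_.
have d0 := delta_gt0 n; have /andP[wl wu] := w_lip t (ltW d0).
case: ifPn => h; last first.
  have -> : w (t - delta n) = w t.
    rewrite (w_halfline h); apply/eqP; rewrite eq_le w_ge0 andbT.
    by move: wl; rewrite (w_halfline h); lra.
  by rewrite subrr !mul0r normr0 mulr0.
have t1 := halfline_ge1 s_le1 h.
rewrite normrM (ger0_norm (profile_ge0 PhiP t1)) -[leRHS]mul1r.
apply: ler_pM => //; [exact: (profile_ge0 PhiP t1)| |exact: profile_le2].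
rewrite normrM normfV (gtr0_norm d0) ler_pdivrMr// mul1r distrC ger0_norm//.
apply: le_trans wu _; by rewrite ler_piMl// ltW.
Qed.

(** Integration by parts against the ramp (st - 1)^+, which vanishes at the end
    point of the half-line.  As [dPhi] is merely a bounded derivative, it is
    approximated by difference quotients, for which the formula is a translation of
    the variable; the mean value theorem provides the domination. *)
Lemma tail_by_parts :
  \int[mu]_t (if halfline s t then (s * t - 1) * dPhi t else 0) = - s * tail_mass s.
Proof.
have -> : (fun t => if halfline s t then (s * t - 1) * dPhi t else 0) =
    (fun t => w t * dPhi t).
  apply/funext => t; case: ifPn => [|/w_halfline ->]; last by rewrite mul0r.
  by move=> /andP[_ h]; rewrite /w max_l// subr_ge0.
apply: (@cvg_unique _ _ (\int[mu]_t f_ n t @[n --> \oo])) => //.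
apply: cvg_trans g_cvg; apply: near_eq_cvg; apply: nearW => n.
exact: esym (fgE n).
Qed.

End by_parts.

End profile.

(** * Reduction to a density on the interval *)
Section domain.
Context {R : realType}.
Notation mu := (@lebesgue_measure R).

Lemma sph_domE (u t : R) : sph_dom (u, t) = halfline (1 - u ^+ 2) t.
Proof. by []. Qed.

Variables (G : R * R -> R) (C : R).
Hypotheses (mG : measurable_fun setT G) (C0 : 0 <= C)
  (GC : forall u t, `|G (u, t)| <= C * (if halfline (1 - u ^+ 2) t then t ^- 2 else 0)).

Let one_sub_sq (u : R) : 1 - u ^+ 2 <= 1.
Proof. by rewrite gerBl sqr_ge0. Qed.

Let Gu_le (u : R) :
  (\int[mu]_t `|(G (u, t))%:E| <= (C * Num.max (1 - u ^+ 2) 0)%:E)%E.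
Proof.
rewrite EFinM -integral_tail// -ge0_integralZl//; last 2 first.
- by apply/measurable_EFinP; apply: measurable_tail;
    exact: measurable_invsq.
- by move=> t _; case: ifP; rewrite lee_fin// invr_ge0 sqr_ge0.
apply: ge0_le_integral => //.
- by apply: measurableT_comp => //; apply/measurable_EFinP; exact: measurable_fun_pair2 mG.
- by apply/measurable_EFinP; apply: measurable_funM => //; apply: measurable_tail;
    exact: measurable_invsq.
- by move=> t _; rewrite -EFinM lee_fin.
Qed.

Lemma integrable_sph : (mu \x mu)%E.-integrable setT (EFin \o G).
Proof.
have mG' : measurable_fun setT (EFin \o G) by exact/measurable_EFinP.
apply/integrable12ltyP => //.
have mN : measurable_fun setT (fun p => `|(G p)%:E|%E) by exact: measurableT_comp.
apply: (@le_lt_trans _ _ (\int[mu]_(u in `[(-1)%R, 1%R]) C%:E)%E); last first.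
  by rewrite integral_cst//= lebesgue_measure_itv/= lte_fin ifT ?gtrN//
    -EFinD -EFinM ltry.
rewrite [leRHS]integral_mkcond; apply: ge0_le_integral => //.
- by move=> u _; apply: integral_ge0.
- exact: (measurable_tonelli1 mN (fun=> abse_ge0 _)).
- by apply/(measurable_restrictT _ _).1 => //; exact: measurable_cst.
move=> u _; apply: le_trans (Gu_le u) _; rewrite patchE.
case: ifPn => [_|h].
  by rewrite lee_fin ler_piMr// ge_max one_sub_sq ler01.
rewrite (_ : Num.max _ _ = 0) ?mulr0//; apply: max_r; rewrite subr_le0.
rewrite leNgt; apply: contra h => h; apply/mem_set; rewrite /= in_itv/= -ler_norml.
by rewrite -(@expr_le1 _ 2)// real_normK ?num_real// ltW.
Qed.

Let iGu u : mu.-integrable setT (fun t => (G (u, t))%:E).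
Proof.
apply/integrableP; split; first by apply/measurable_EFinP; exact: measurable_fun_pair2 mG.
by apply: le_lt_trans (Gu_le u) _; rewrite ltry.
Qed.

Let FE : fubini_F mu (EFin \o G) = EFin \o (fun u => \int[mu]_t G (u, t)).
Proof.
apply/funext => u; rewrite /fubini_F /Rintegral /= fineK//.
exact: integrable_fin_num (iGu u).
Qed.

Lemma integrable_fubini_sph : mu.-integrable setT (EFin \o (fun u => \int[mu]_t G (u, t))).
Proof. by rewrite -FE; exact: integrable_fubini_F integrable_sph. Qed.

Lemma fubini_sph1 : \int[(mu \x mu)%E]_p G p = \int[mu]_u \int[mu]_t G (u, t).
Proof.
rewrite {1}/Rintegral -[X in fine X](integral12_prod_meas1 integrable_sph).
by congr fine; apply: eq_integral => u _; exact: (congr1 (fun f => f u) FE).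
Qed.

Lemma fubini_sph2 : (forall t, mu.-integrable setT (fun u => (G (u, t))%:E)) ->
  \int[(mu \x mu)%E]_p G p = \int[mu]_t \int[mu]_u G (u, t).
Proof.
move=> iGt; rewrite {1}/Rintegral -[X in fine X](integral21_prod_meas1 integrable_sph).
congr fine; apply: eq_integral => t _; rewrite /fubini_G /Rintegral fineK//.
exact: integrable_fin_num (iGt t).
Qed.

End domain.

Section reduction.
Context {R : realType}.
Notation mu := (@lebesgue_measure R).
Variables (Phi dPhi : R -> R) (A : R).
Hypothesis PhiP : profile Phi dPhi A.

Let A0 : 0 <= A.
Proof.
have := profile_le PhiP (lexx 1); rewrite expr1n invr1 mulr1.
exact: le_trans (profile_ge0 PhiP (lexx 1)).
Qed.

Let one_sub_sq (u : R) : 1 - u ^+ 2 <= 1.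
Proof. by rewrite gerBl sqr_ge0. Qed.

(** Up to the area of the unit disc, the density q against which M is a Cauchy
    integral. *)
Definition mass_density (u : R) : R := (1 - u ^+ 2) * tail_mass Phi (1 - u ^+ 2).

(** The Jacobian sqrt t, the squared projection 1 - 1/t - u^2 and the derivative
    2 (sqrt t) Phi'(t) of phi multiply to 2 ((1 - u^2) t - 1) Phi'(t): for fixed u
    this is the ramp of [tail_by_parts] with s = 1 - u^2. *)
Lemma dispersion_reduction (h : R -> R) (M : R) : measurable_fun setT h ->
  (forall u : R, u ^+ 2 <= 1 -> `|h u| <= M) ->
  [/\ (mu \x mu)%E.-integrable setT (EFin \o (fun p : R * R => if sph_dom p then
    Num.sqrt p.2 * (h p.1 * (1 - p.2^-1 - p.1 ^+ 2) * (2 * Num.sqrt p.2 * dPhi p.2))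
    else 0)),
    mu.-integrable setT (EFin \o (fun u => h u * mass_density u)) &
  \int[(mu \x mu)%E]_p (if sph_dom p then
    Num.sqrt p.2 * (h p.1 * (1 - p.2^-1 - p.1 ^+ 2) * (2 * Num.sqrt p.2 * dPhi p.2))
    else 0) = - 2 * \int[mu]_u (h u * mass_density u)].
Proof.
move=> mh hM.
pose G (p : R * R) := 2 * h p.1 *
  (if sph_dom p then ((1 - p.1 ^+ 2) * p.2 - 1) * dPhi p.2 else 0).
have -> : (fun p : R * R => if sph_dom p then
    Num.sqrt p.2 * (h p.1 * (1 - p.2^-1 - p.1 ^+ 2) * (2 * Num.sqrt p.2 * dPhi p.2))
    else 0) = G.
  apply/funext => -[u t]; rewrite /G/=; case: ifPn; last by rewrite mulr0.
  rewrite sph_domE => hl; have t1 := halfline_ge1 (one_sub_sq u) hl.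
  have t0 : t != 0 by rewrite gt_eqF//; lra.
  rewrite (_ : _ * _ = Num.sqrt t ^+ 2 * (h u * (1 - t^-1 - u ^+ 2) * (2 * dPhi t))); last by ring.
  rewrite sqr_sqrtr; last lra.
  by field.
have M0 : 0 <= M by apply: le_trans (hM 0 _) => //; rewrite expr0n.
have mG : measurable_fun setT G.
  apply: measurable_funM.
    by apply: measurable_funM => //; exact: (measurableT_comp mh).
  apply: measurable_fun_ifT => //; first exact: measurable_sph_dom.
  apply: measurable_funM; last exact: (measurableT_comp (profile_dmeasurable PhiP)).
  apply: measurable_funB => //; apply: measurable_funM => //.
  by apply: measurable_funB => //; exact: measurable_funX.
have GC u t : `|G (u, t)| <= 2 * M * A * (if halfline (1 - u ^+ 2) t then t ^- 2 else 0).
  rewrite /G sph_domE/=; case: ifPn => hl; last by rewrite !mulr0 normr0.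
  have t1 := halfline_ge1 (one_sub_sq u) hl.
  have t0 : t != 0 by rewrite gt_eqF//; lra.
  have u2 := sqr_ge0 u.
  have /andP[_ h1] := hl.
  have u1 : u ^+ 2 <= 1.
    rewrite leNgt; apply/negP => h2.
    have : (1 - u ^+ 2) * t <= 0 by apply: mulr_le0_ge0; lra.
    lra.
  have ut : 0 <= u ^+ 2 * t by apply: mulr_ge0; lra.
  have /le_trans : `|2 * h u * (((1 - u ^+ 2) * t - 1) * dPhi t)| <=
      2 * M * (t * (A * t ^- 4)).
    rewrite normrM (normrM 2) (ger0_norm (_ : 0 <= 2))//.
    apply: ler_pM => //; first by rewrite ler_wpM2l// hM.
    rewrite normrM; apply: ler_pM => //; last exact: (profile_dle PhiP t1).
    by rewrite ger0_norm; lra.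
  apply; rewrite -!mulrA; do 2 (rewrite ler_wpM2l//); rewrite mulrCA ler_wpM2l//.
  rewrite (exprS _ 3) invfM mulVKf// lef_pV2 ?posrE ?exprn_gt0//; try lra.
  by rewrite ler_weXn2l.
have C0 : 0 <= 2 * M * A by rewrite !mulr_ge0.
have E u : \int[mu]_t G (u, t) = - 2 * (h u * mass_density u).
  have [s0|s0] := ltP 0 (1 - u ^+ 2); last first.
    rewrite /mass_density tail_mass_le0// !mulr0 /Rintegral integral0_eq// => t _.
    by rewrite /G sph_domE/= halfline_le0// mulr0.
  rewrite /G/=.
  have I : mu.-integrable setT (EFin \o (fun t => if sph_dom (u, t) then
      ((1 - u ^+ 2) * t - 1) * dPhi t else 0)).
    have : measurable_fun setT (fun t => if sph_dom (u, t) then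
      ((1 - u ^+ 2) * t - 1) * dPhi t else 0).
      apply: (@measurable_tail _ (fun t : R => ((1 - u ^+ 2) * t - 1) * dPhi t) (1 - u ^+ 2)).
      apply: measurable_funM; last exact: (profile_dmeasurable PhiP).
      by apply: measurable_funB => //; exact: measurable_funM.
    move=> mm.
    have := integrableZl measurableT A (integrable_tail (one_sub_sq u)).
    apply: le_integrable => //; first exact/measurable_EFinP.
    move=> t _; rewrite -EFinM !abse_EFin lee_fin sph_domE.
    case: ifPn => hl; last by rewrite normr0.
    have t1 := halfline_ge1 (one_sub_sq u) hl.
    have t0 : t != 0 by rewrite gt_eqF//; lra.
    have u2 := sqr_ge0 u; have /andP[_ h1] := hl.
    have ut : 0 <= u ^+ 2 * t by apply: mulr_ge0; lra.
    apply: le_trans (ler_norm _).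
    apply: (@le_trans _ _ (t * (A * t ^- 4))).
      rewrite normrM; apply: ler_pM => //; last exact: (profile_dle PhiP t1).
      by rewrite ger0_norm; lra.
    rewrite mulrCA ler_wpM2l//.
    rewrite (exprS _ 3) invfM mulVKf// lef_pV2 ?posrE ?exprn_gt0//; try lra.
    by rewrite ler_weXn2l.
  rewrite RintegralZl// [X in _ * X](tail_by_parts PhiP s0 (one_sub_sq u)).
  by rewrite /mass_density; ring.
have Ih : mu.-integrable setT (EFin \o (fun u => h u * mass_density u)).
  have := integrable_fubini_sph mG C0 GC.
  have -> : (fun u => \int[mu]_t G (u, t)) = (fun u => - 2 * (h u * mass_density u)).
    exact/funext.
  move=> /(integrableZl measurableT (- 2^-1)); apply: eq_integrable => // u _ /=.
  by rewrite -EFinM; congr (_%:E); field.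
split => //; first exact: (integrable_sph mG C0 GC).
rewrite (fubini_sph1 mG C0 GC); under eq_Rintegral do rewrite E.
by rewrite RintegralZl.
Qed.

End reduction.

Section density.
Context {R : realType}.
Notation mu := (@lebesgue_measure R).

(** The even density on [-1, 1] against which the dispersion function is a
    Cauchy integral.  The Lipschitz bound makes the integral continuous up to the
    axis, the quadratic decay at the end points controls the behaviour of the zeros
    for large wave numbers, and the persistence of zeros towards the end points
    fixes the sign of the dispersion function where its imaginary part vanishes. *)
Record density (q : R -> R) (B L : R) : Prop := Density {
  density_measurable : measurable_fun setT q;
  density_ge0 : forall u, 0 <= q u;
  density_le : forall u, q u <= B * (Num.max (1 - u ^+ 2) 0) ^+ 2;
  density_even : forall u, q (- u) = q u;
  density_lip : forall u v, `|q u - q v| <= L * `|u - v|;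
  density_vanish : forall u v, 0 <= u -> u < 1 -> q u = 0 -> u <= `|v| -> q v = 0;
  density_mass : 0 < \int[mu]_u q u
}.

Lemma dist_continuous (f : R -> R) (L : R) :
  (forall u v, `|f u - f v| <= L * `|u - v|) -> continuous f.
Proof.
move=> fL u; apply/cvgrPdist_le => e e0.
have B0 : 0 < `|L| + 1 by have := normr_ge0 L; lra.
have d0 : 0 < (`|L| + 1)^-1 * e by rewrite mulr_gt0// invr_gt0.
have /cvgrPdist_le/(_ _ d0) : id x @[x --> u] --> u by exact: cvg_id.
apply: filterS => v /=; rewrite ler_pdivlMl// => h; apply: le_trans (fL u v) _.
apply: le_trans h; rewrite ler_wpM2r//.
by have := ler_norm L; lra.
Qed.

End density.

Section mass_density.
Context {R : realType}.
Notation mu := (@lebesgue_measure R).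
Variables (Phi dPhi : R -> R) (A : R).
Hypothesis PhiP : profile Phi dPhi A.

Let A0 : 0 <= A.
Proof.
have := profile_le PhiP (lexx 1); rewrite expr1n invr1 mulr1.
exact: le_trans (profile_ge0 PhiP (lexx 1)).
Qed.

Let one_sub_sq (u : R) : 1 - u ^+ 2 <= 1.
Proof. by rewrite gerBl sqr_ge0. Qed.

Let cut (u : R) : R := Num.max (1 - u ^+ 2) 0.

Let cut_ge0 u : 0 <= cut u. Proof. by rewrite le_max lexx orbT. Qed.
Let cut_le1 u : cut u <= 1. Proof. by rewrite ge_max one_sub_sq ler01. Qed.

Let mass_densityE u : mass_density Phi u = cut u * tail_mass Phi (cut u).
Proof.
rewrite /mass_density /cut; case: (leP (1 - u ^+ 2) 0) => // h.
by rewrite !tail_mass_le0// !mulr0.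
Qed.

Let cut_lip u v : `|cut u - cut v| <= 2 * `|u - v|.
Proof.
have wlg a b : `|a| <= `|b| -> `|cut a - cut b| <= 2 * `|a - b|.
  move=> ab; have := ler_dist_dist a b; rewrite ler0_norm ?subr_le0// opprB => h.
  have a0 := normr_ge0 a; have b0 := normr_ge0 b.
  have E c : cut c = Num.max (1 - `|c| ^+ 2) 0 by rewrite /cut real_normK ?num_real.
  rewrite !E; move: `|a| `|b| ab h a0 b0 => x y xy h x0 y0.
  apply: (@le_trans _ _ (2 * (y - x))); last lra.
  case: (leP (1 - x ^+ 2) 0) => hx; case: (leP (1 - y ^+ 2) 0) => hy.
  - by rewrite subrr normr0; lra.
  - have : x ^+ 2 <= y ^+ 2 by rewrite ler_pXn2r.
    lra.
  - rewrite subr0 gtr0_norm//.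
    have x1 : x < 1 by rewrite -(@expr_lt1 _ 2)// -subr_gt0.
    have y1 : 1 <= y by rewrite -(@expr_ge1 _ 2)// -subr_le0.
    nra.
  - have x1 : x < 1 by rewrite -(@expr_lt1 _ 2)// -subr_gt0.
    have y1 : y < 1 by rewrite -(@expr_lt1 _ 2)// -subr_gt0.
    rewrite ger0_norm; nra.
have [/wlg//|/ltW/wlg] := leP `|u| `|v|.
by rewrite distrC (distrC v).
Qed.

Let T_le (s : R) : 0 <= s -> s <= 1 -> tail_mass Phi s <= A * s.
Proof.
move=> s0 s1; have := tail_mass_lip PhiP (lexx 0) s0 s1.
by rewrite (@tail_mass_le0 _ _ 0)// !subr0.
Qed.

Let sT_lip (s s' : R) : 0 <= s -> s <= s' -> s' <= 1 ->
  `|s * tail_mass Phi s - s' * tail_mass Phi s'| <= 2 * A * (s' - s).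
Proof.
move=> s0 ss' s'1; have s'0 := le_trans s0 ss'.
have h1 := tail_mass_lip PhiP s0 ss' s'1.
have h2 := tail_mass_mono PhiP ss' s'1.
have h3 := T_le s'0 s'1.
have h4 := tail_mass_ge0 PhiP (le_trans ss' s'1).
have h5 : tail_mass Phi s' <= A by apply: le_trans h3 _; rewrite ler_piMr.
rewrite distrC ger0_norm; last first.
  by rewrite subr_ge0; apply: ler_pM.
move: (tail_mass Phi s) (tail_mass Phi s') h1 h2 h3 h4 h5 => x y h1 h2 h3 h4 h5.
have : s * (y - x) <= 1 * (A * (s' - s)) by apply: ler_pM; lra.
have : (s' - s) * y <= (s' - s) * A by apply: ler_wpM2l; lra.
lra.
Qed.

Lemma mass_density_ge0 u : 0 <= mass_density Phi u.
Proof. by rewrite mass_densityE mulr_ge0// (tail_mass_ge0 PhiP). Qed.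

Lemma mass_density_lip u v :
  `|mass_density Phi u - mass_density Phi v| <= 4 * A * `|u - v|.
Proof.
rewrite !mass_densityE; have h := cut_lip u v.
apply: (@le_trans _ _ (2 * A * `|cut u - cut v|)); last first.
  apply: (@le_trans _ _ (2 * A * (2 * `|u - v|))); last lra.
  by rewrite ler_wpM2l// mulr_ge0.
have [ss|/ltW ss] := leP (cut u) (cut v).
  by rewrite [in leRHS]distrC [in leRHS]ger0_norm ?subr_ge0//; exact: sT_lip.
by rewrite distrC [in leRHS]ger0_norm ?subr_ge0//; exact: sT_lip.
Qed.

Lemma measurable_mass_density : measurable_fun setT (mass_density Phi).
Proof.
exact: continuous_measurable_fun (dist_continuous mass_density_lip).
Qed.

Let mPhi : measurable_fun setT Phi. Proof. exact: (profile_measurable PhiP). Qed.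

(** Both sides integrate the profile over the same domain of (u, t): integrating
    over t first leaves the density, integrating over u first leaves the length,
    respectively the integral of 1 - u^2, of the interval |u| <= b with
    b^2 = 1 - 1/t, and these are proportional. *)
Let G1 (p : R * R) : R :=
  if sph_dom p then (1 + 2 / 3 * (p.2 - 1)) / p.2 * Phi p.2 else 0.
Let G2 (p : R * R) : R := if sph_dom p then (1 - p.1 ^+ 2) * Phi p.2 else 0.

Let mG1 : measurable_fun setT G1.
Proof.
apply: measurable_fun_ifT => //; first exact: measurable_sph_dom.
apply: measurable_funM; last exact: (measurableT_comp mPhi).
apply: measurable_funM; last exact: (measurableT_comp (@measurable_inv R)).
apply: measurable_funD => //; apply: measurable_funM => //.
exact: measurable_funB.
Qed.

Let mG2 : measurable_fun setT G2.
Proof.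
apply: measurable_fun_ifT => //; first exact: measurable_sph_dom.
apply: measurable_funM; last exact: (measurableT_comp mPhi).
by apply: measurable_funB => //; exact: measurable_funX.
Qed.

Let dom_facts (u t : R) : halfline (1 - u ^+ 2) t ->
  [/\ 1 <= t, 0 <= 1 - u ^+ 2, 0 <= Phi t & Phi t <= A * t ^- 2].
Proof.
move=> hl; have t1 := halfline_ge1 (one_sub_sq u) hl.
split => //; [|exact: (profile_ge0 PhiP)|exact: (profile_le2 PhiP)].
by rewrite leNgt; apply/negP => /ltW s0; rewrite halfline_le0 in hl.
Qed.

Let weight_le (t : R) : 1 <= t -> 0 <= (1 + 2 / 3 * (t - 1)) / t <= 1.
Proof.
move=> t1; have t0 : 0 < t by lra.
rewrite divr_ge0 ?ler_pdivrMr//=; lra.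
Qed.

Let G1C u t : `|G1 (u, t)| <= A * (if halfline (1 - u ^+ 2) t then t ^- 2 else 0).
Proof.
rewrite /G1 sph_domE/=; case: ifPn => hl; last by rewrite normr0 mulr0.
have [t1 s0 P0 PA] := dom_facts hl; have /andP[w0 w1] := weight_le t1.
rewrite ger0_norm; last exact: mulr_ge0.
by apply: le_trans PA; rewrite ler_piMl.
Qed.

Let G2C u t : `|G2 (u, t)| <= A * (if halfline (1 - u ^+ 2) t then t ^- 2 else 0).
Proof.
rewrite /G2 sph_domE/=; case: ifPn => hl; last by rewrite normr0 mulr0.
have [t1 s0 P0 PA] := dom_facts hl.
rewrite ger0_norm; last exact: mulr_ge0.
by apply: le_trans PA; rewrite ler_piMl.
Qed.

Let G2E u : \int[mu]_t G2 (u, t) = mass_density Phi u.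
Proof.
rewrite /mass_density /tail_mass -RintegralZl//; last exact: (integrable_profile PhiP).
apply: eq_Rintegral => t _; rewrite /G2 sph_domE/=.
by case: ifP => // _; rewrite mulr0.
Qed.

Lemma integrable_mass_density : mu.-integrable setT (EFin \o mass_density Phi).
Proof.
have := integrable_fubini_sph mG2 A0 G2C.
by rewrite (_ : (fun u => \int[mu]_t G2 (u, t)) = mass_density Phi)//; apply/funext.
Qed.

Let slice_dom (u t : R) : 1 <= t ->
  halfline (1 - u ^+ 2) t = (`|u| <= Num.sqrt (1 - t^-1)).
Proof.
move=> t1; have t0 : 0 < t by lra.
have it : t^-1 <= 1 by rewrite invf_le1.
rewrite /halfline t0/= -[RHS](@ler_pXn2r _ 2)// ?nnegrE ?sqrtr_ge0//.
rewrite real_normK ?num_real// sqr_sqrtr ?subr_ge0//.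
rewrite -ler_pdivrMr// mul1r; apply/idP/idP; lra.
Qed.

Let slice_int (g : R -> R) (c t : R) : measurable_fun setT g ->
  (forall u : R, 0 <= 1 - u ^+ 2 -> `|g u| <= c) ->
  mu.-integrable setT (fun u => (if halfline (1 - u ^+ 2) t then g u else 0)%:E).
Proof.
move=> mg gc; have c0 : 0 <= c by apply: le_trans (gc 0 _); rewrite // expr0n subr0.
have I0 := @integrable_indic_itv R (- 1) 1 true false.
have I := integrableZl measurableT c I0.
apply: le_integrable I => //.
  apply/measurable_EFinP; apply: measurable_fun_ifT => //.
  by apply: (measurable_fun_pair1 (f := @sph_dom R)); exact: measurable_sph_dom.
move=> u _; pose J : set R := `[(-1)%R, 1%R]%classic.
rewrite -[X in (_ <= `|X|)%E]/((c * \1_J u)%:E) !abse_EFin lee_fin.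
case: ifPn => hl; last by rewrite normr0.
have s0 : 0 <= 1 - u ^+ 2.
  by rewrite leNgt; apply/negP => /ltW s0; rewrite halfline_le0 in hl.
rewrite indicE mem_set/= ?mulr1; last first.
  rewrite /J /= in_itv/= -ler_norml -(@expr_le1 _ 2)// real_normK ?num_real//.
  by rewrite -subr_ge0.
by apply: le_trans (gc _ s0) (ler_norm _).
Qed.

Let slice_integral (g : R -> R) (t : R) : 1 <= t ->
  \int[mu]_u (if halfline (1 - u ^+ 2) t then g u else 0) =
  \int[mu]_(u in `[(- Num.sqrt (1 - t^-1))%R, Num.sqrt (1 - t^-1)]) g u.
Proof.
move=> t1; rewrite [RHS]Rintegral_mkcond; apply: eq_Rintegral => u _.
rewrite slice_dom// patchE ler_norml; case: ifPn => h.
  by rewrite mem_set//= in_itv/= h.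
by rewrite memNset//= in_itv/=; exact/negP.
Qed.

Let slice_poly (b : R) : 0 <= b ->
  \int[mu]_(u in `[(- b)%R, b]) (1 - u ^+ 2) = 2 * b - 2 / 3 * b ^+ 3.
Proof.
rewrite le_eqVlt => /predU1P[<-|b0].
  by rewrite oppr0 set_itv1 Rintegral_set1 expr0n/= !mulr0 subr0.
pose P (u : R) := u - 3^-1 *: u ^+ 3.
have dP (u : R) : is_derive u 1 P (1 - u ^+ 2).
  apply: is_deriveB; apply: is_derive_eq; rewrite /GRing.scale/=; by field.
have cP : continuous P.
  by move=> u; apply: differentiable_continuous; apply/derivable1_diffP; have [] := dP u.
rewrite /Rintegral (@continuous_FTC2 _ _ P)//.
- by rewrite -EFinB/= /P /GRing.scale/=; field.
- by rewrite gtrN.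
- apply: continuous_subspaceT => u; apply: cvgB; first exact: cvg_cst.
  exact: exprn_continuous.
- split; first by move=> u _; have [] := dP u.
    by apply: cvg_at_right_filter; exact: cP.
  by apply: cvg_at_left_filter; exact: cP.
- by move=> u _; rewrite derive1E; have [_ ->] := dP u.
Qed.

Lemma mass_identity :
  (mu \x mu)%E.-integrable setT (EFin \o G1) /\
  \int[(mu \x mu)%E]_p G1 p = \int[mu]_u mass_density Phi u.
Proof.
split; first exact: (integrable_sph mG1 A0 G1C).
transitivity (\int[(mu \x mu)%E]_p G2 p); last first.
  rewrite (fubini_sph1 mG2 A0 G2C); apply: eq_Rintegral => u _; exact: G2E.
have s1 t : mu.-integrable setT (fun u => (G1 (u, t))%:E).
  apply: (@slice_int (fun=> (1 + 2 / 3 * (t - 1)) / t * Phi t)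
    (`|(1 + 2 / 3 * (t - 1)) / t * Phi t|)) => //.
have s2 t : mu.-integrable setT (fun u => (G2 (u, t))%:E).
  apply: (@slice_int (fun u => (1 - u ^+ 2) * Phi t) (`|Phi t|)) => //.
    by apply: measurable_funM => //; apply: measurable_funB => //; exact: measurable_funX.
  by move=> u u0; rewrite normrM ger0_norm// ler_piMl.
rewrite (fubini_sph2 mG1 A0 G1C s1) (fubini_sph2 mG2 A0 G2C s2).
apply: eq_Rintegral => t _.
have [t1|t1] := leP 1 t; last first.
  have hl u : halfline (1 - u ^+ 2) t = false.
    by apply/negbTE; apply: contraTN t1 => /(halfline_ge1 (one_sub_sq u)); rewrite -leNgt.
  by apply: eq_Rintegral => u _; rewrite /G1 /G2 !sph_domE hl.
rewrite /G1 /G2/= (slice_integral (fun=> (1 + 2 / 3 * (t - 1)) / t * Phi t) t1).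
rewrite (slice_integral (fun u => (1 - u ^+ 2) * Phi t) t1).
have b0 := sqrtr_ge0 (1 - t^-1).
have it : t^-1 <= 1 by rewrite invf_le1//; lra.
have b2 : Num.sqrt (1 - t^-1) ^+ 2 = 1 - t^-1 by rewrite sqr_sqrtr// subr_ge0.
rewrite [RHS]RintegralZr//; last first.
  apply: continuous_compact_integrable; first exact: segment_compact.
  apply: continuous_subspaceT => u; apply: cvgB; first exact: cvg_cst.
  exact: exprn_continuous.
rewrite slice_poly// Rintegral_cst//= lebesgue_measure_itv/= lte_fin.
move: b0 b2; move: (Num.sqrt _) => b b0 b2.
rewrite exprSr b2.
have t0 : t != 0 by rewrite gt_eqF//; lra.
case: ltP => [h|h].
  by rewrite -EFinD/=; field.
have -> : b = 0 by lra.
by rewrite mulr0; ring.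
Qed.

Lemma density_mass_density (K : R) : 0 <= K -> 0 < K * \int[mu]_u mass_density Phi u ->
  density (fun u => K * mass_density Phi u) (K * A) (K * (4 * A)).
Proof.
move=> K0 KI; split.
- by apply: measurable_funM => //; exact: measurable_mass_density.
- by move=> u; rewrite mulr_ge0// mass_density_ge0.
- move=> u; rewrite -mulrA ler_wpM2l// mass_densityE expr2 mulrCA.
  by rewrite ler_wpM2l// T_le.
- by move=> u; rewrite /mass_density sqrrN.
- by move=> u v; rewrite -mulrBr normrM ger0_norm// -mulrA ler_wpM2l// mass_density_lip.
- move=> u v u0 u1 /eqP; rewrite mulf_eq0 => /orP[/eqP ->|]; first by rewrite mul0r.
  have u2 : 0 < 1 - u ^+ 2 by rewrite subr_gt0 expr_lt1.
  rewrite /mass_density mulf_eq0 gt_eqF//= => /eqP T0 uv.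
  have vu : 1 - v ^+ 2 <= 1 - u ^+ 2.
    rewrite lerD2l lerN2 -(real_normK (num_real v)).
    by rewrite ler_pXn2r// nnegrE.
  have -> : tail_mass Phi (1 - v ^+ 2) = 0.
    apply/eqP; rewrite eq_le (tail_mass_ge0 PhiP)// andbT -T0.
    exact: (tail_mass_mono PhiP).
  by rewrite !mulr0.
- by rewrite RintegralZl// integrable_mass_density.
Qed.

End mass_density.

(** * Real and imaginary parts *)
Section complex_topology.
Context {R : realType}.
Implicit Types (z : Cpx R).

Lemma normc_le (a b e : R) : `|a| <= e / 2 -> `|b| <= e / 2 ->
  `|(a +i* b : Cpx R)| <= e%:C.
Proof.
move=> ae be; have e0 : 0 <= e by have := normr_ge0 a; lra.
have h c : `|c| <= e / 2 -> c ^+ 2 <= (e / 2) ^+ 2.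
  by move=> ce; rewrite -(real_normK (num_real c)) ler_pXn2r// ?nnegrE//; lra.
rewrite [`|_|]normc_def lecR/= -(ger0_norm e0) -sqrtr_sqr; apply: ler_wsqrtr.
have := h _ ae; have := h _ be; have := sqr_ge0 e; rewrite expr_div_n; lra.
Qed.

Lemma normc_ge_Im z : (`|complex.Im z|)%:C <= `|z|.
Proof.
rewrite [leRHS]normc_def lecR -sqrtr_sqr; apply: ler_wsqrtr.
by rewrite lerDr sqr_ge0.
Qed.

Lemma continuous_Re : continuous (fun z : Cpx R => complex.Re z).
Proof.
move=> z; have FF : Filter (nbhs (z : Cpx R)) by exact: nbhs_filter.
apply/cvgrPdist_lt => e e0.
have e0' : (0 : Cpx R) < e%:C by rewrite ltcR.
have /cvgrPdist_lt/(_ _ e0') : id x @[x --> z] --> z by exact: cvg_id.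
apply: filterS => w /= h.
have := le_lt_trans (normc_ge_Re (z - w)) h.
by rewrite ltcR; case: (z) (w) => [? ?] [? ?].
Qed.

Lemma continuous_Im : continuous (fun z : Cpx R => complex.Im z).
Proof.
move=> z; have FF : Filter (nbhs (z : Cpx R)) by exact: nbhs_filter.
apply/cvgrPdist_lt => e e0.
have e0' : (0 : Cpx R) < e%:C by rewrite ltcR.
have /cvgrPdist_lt/(_ _ e0') : id x @[x --> z] --> z by exact: cvg_id.
apply: filterS => w /= h.
have := le_lt_trans (normc_ge_Im (z - w)) h.
by rewrite ltcR; case: (z) (w) => [? ?] [? ?].
Qed.

Lemma cvg_complex (T : Type) (F : set_system T) (f g : T -> R) (a b : R) :
  Filter F -> f @ F --> a -> g @ F --> b ->
  (fun x => (f x +i* g x : Cpx R)) @ F --> (a +i* b : Cpx R).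
Proof.
move=> FF fa gb; apply/cvgrPdist_le => e e0.
have [eE e0'] : e = (complex.Re e)%:C /\ 0 < complex.Re e.
  move: e0; rewrite ltcE => /andP[/eqP i0 r0]; split => //.
  by case: e i0 {r0} => [? ?] /= ->.
rewrite eE; set d := complex.Re e in e0' *.
have d2 : 0 < d / 2 by rewrite divr_gt0.
move/cvgrPdist_le : fa => /(_ _ d2); move/cvgrPdist_le : gb => /(_ _ d2).
apply: filterS2 => x hb ha.
exact: (@normc_le (a - f x) (b - g x)).
Qed.

Lemma cvg_real_complex_dnbhs0 :
  (fun h : R => h%:C : Cpx R) @ 0^' --> (0 : Cpx R)^'.
Proof.
have c0 : (fun h : R => h%:C : Cpx R) @ 0 --> (0 : Cpx R).
  exact: (@cvg_complex _ _ id (fun=> 0) 0 0 _ cvg_id (cvg_cst _)).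
have FF : Filter (nbhs (0 : R)) by exact: nbhs_filter.
move=> P; rewrite /dnbhs /within/= => /c0 H.
apply: (@filterS _ _ FF _ _ _ H) => x h x0; apply: h.
by apply: contra x0 => /eqP[] ->.
Qed.

(** The difference quotients with real increments are among the complex ones, and
    taking real parts is continuous. *)
Lemma is_derive_Re (F : Cpx R -> Cpx R) (t : R) : derivable F (t%:C : Cpx R) 1 ->
  is_derive t (1 : R) (fun x : R => complex.Re (F (x%:C))) (complex.Re (derive1 F t%:C)).
Proof.
move=> dF; pose l := derive1 F t%:C.
have h : (fun h : Cpx R => h^-1 *: (F (h + t%:C) - F t%:C)) @ 0^' --> l.
  move/cvg_ex : dF => [l' hl].
  have h' : (fun h : Cpx R => h^-1 *: (F (h + t%:C) - F t%:C)) @ 0^' --> l'.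
    apply: cvg_trans hl; apply: near_eq_cvg; apply: nearW => z /=.
    by rewrite [z *: 1]mulr1.
  by rewrite (_ : l = l')//; apply/cvg_lim.
have h' : (fun h : R => h^-1 *: (complex.Re (F (h *: 1 + t)%:C) - complex.Re (F t%:C))) @ 0^' -->
    complex.Re l.
  have := cvg_comp _ _ (cvg_comp _ _ cvg_real_complex_dnbhs0 h) (@continuous_Re _).
  apply: cvg_trans; apply: near_eq_cvg; apply: nearW => x /=.
  rewrite /GRing.scale/= mulr1 (_ : (x%:C : Cpx R) + t%:C = (x + t)%:C); last first.
    by rewrite rmorphD.
  rewrite (_ : (x%:C : Cpx R)^-1 = (x^-1)%:C); last by rewrite fmorphV.
  case: (F (x + t)%:C) (F t%:C) => [a b] [c d] /=.
  by rewrite mul0r subr0.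
apply: DeriveDef; first by apply/cvg_ex; exists (complex.Re l).
by apply/cvg_lim.
Qed.

End complex_topology.

(** * The profile of an equilibrium *)
Section equilibrium_profile.
Context {R : realType}.
Variables (N0 : nat) (F : Cpx R -> Cpx R) (phi : R -> R) (n0 : R).
Hypotheses (N0_ge6 : (6 <= N0)%N) (E : equilibrium N0 F phi n0).

Let f (t : R) : R := complex.Re (F (t%:C : Cpx R)).
Let df (t : R) : R := complex.Re (derive1 F (t%:C : Cpx R)).

Let is_derive_f (t : R) : 0 < t -> is_derive t 1 f (df t).
Proof. by move=> t0; apply: is_derive_Re; apply: (equilibrium_holomorphic E). Qed.

Let continuous_f (t : R) : 0 < t -> {for t, continuous f}.
Proof.
move=> t0; apply: differentiable_continuous; apply/derivable1_diffP.
by have [] := is_derive_f t0.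
Qed.

Let Phi (t : R) : R := if 0 < t then f t else 0.
Let dPhi (t : R) : R := if 0 < t then df t else 0.

Let pos_set : setT `&` (fun t : R => 0 < t) @^-1` [set true] = `]0, +oo[.
Proof. by apply/seteqP; split => t /=; rewrite in_itv/= andbT => // -[]. Qed.

Let measurable_Phi : measurable_fun setT Phi.
Proof.
apply: measurable_fun_if => //; first exact: measurable_fun_ltr.
rewrite pos_set; apply: open_continuous_measurable_fun; first exact: interval_open.
by move=> t /set_mem /=; rewrite in_itv/= andbT; exact: continuous_f.
Qed.

Let is_derive_Phi (t : R) : 0 < t -> is_derive t 1 Phi (dPhi t).
Proof.
move=> t0; rewrite /dPhi t0; apply: (near_eq_is_derive _ (is_derive_f t0)).
near=> x; rewrite /Phi ifT//; near: x; exact: lt_nbhsr.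
Unshelve. all: by end_near. Qed.

(** A derivative is a pointwise limit of measurable difference quotients. *)
Let measurable_dPhi : measurable_fun setT dPhi.
Proof.
pose d (n : nat) : R := n.+1%:R^-1.
have d0 n : 0 < d n by rewrite invr_gt0.
pose h n t := if 0 < t then (Phi (t + d n) - Phi t) / d n else 0.
apply: (@measurable_fun_cvg _ _ _ _ h).
  move=> n; apply: measurable_fun_ifT => //; first exact: measurable_fun_ltr.
  apply: measurable_funM => //; apply: measurable_funB => //.
  by apply: (measurableT_comp measurable_Phi); exact: measurable_funD.
move=> t _; rewrite /h; case: (ltP 0 t) => t0; last first.
  by rewrite /dPhi ltNge t0; exact: cvg_cst.
have [dt dE] := is_derive_Phi t0.
move: dt => /cvg_ex[l hl].
have -> : dPhi t = l by rewrite -dE; apply/cvg_lim.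
move/cvgr_dnbhsP : hl => /(_ d).
move/(_ (conj (fun n => lt0r_neq0 (d0 n)) (@cvg_harmonic R))) => h'.
apply: cvg_trans h'; apply: near_eq_cvg; apply: nearW => n /=.
by rewrite /GRing.scale/= mulr1 (addrC _ t) mulrC.
Qed.

Let power_le (n : nat) (C s : R) : 1 <= s -> `|C| * s `^ (- (N0%:R / 2) - n%:R) <= `|C| * s ^- (3 + n).
Proof.
move=> s1; rewrite ler_wpM2l//.
have s0 : 0 < s by lra.
rewrite -powR_mulrn ?(ltW s0)// -powRN; apply: ler_powR => //.
have : 6%:R <= N0%:R :> R by rewrite ler_nat.
by rewrite natrD; lra.
Qed.

(** The decay hypothesis at z = 1, where N0 / 2 >= 3. *)
Let decay (n : nat) : exists A : R, 0 <= A /\ forall s : R, 1 <= s ->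
  `|complex.Re (derive1n n F (s%:C : Cpx R))| <= A * s ^- (3 + n).
Proof.
have [C hC] := equilibrium_decay E n ltr01.
exists `|C|; split => // s s1.
have := hC s 1 s1; rewrite /= mulr1.
have h1 : (0 < complex.Re (1 : Cpx R)) by exact: ltr01.
have h2 : (`|1 : Cpx R| <= (1 : R)%:C) by rewrite normr1.
move=> /(_ h1 h2); rewrite mulr1 => h.
have := le_trans (normc_ge_Re _) h.
rewrite lecR => /le_trans; apply; apply: le_trans (power_le n C s1).
by rewrite ler_wpM2r// ?powR_ge0// ler_norm.
Qed.

Lemma equilibrium_profile : exists Phi dPhi A, [/\ profile Phi dPhi A,
  forall s, 1 <= s -> phi s = Phi (s ^+ 2) &
  forall s, 1 <= s -> derive1 phi s = 2 * s * dPhi (s ^+ 2)].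
Proof.
have [A [A0 hA]] := decay 0; have [B [B0 hB]] := decay 1.
exists Phi, dPhi, (A + B).
have phiE s : 0 < s -> phi s = Phi (s ^+ 2).
  by move=> s0; rewrite /Phi exprn_gt0// /f (equilibrium_phiE E s0).
have s2 (s : R) : 0 < s -> 0 < s ^+ 2 by exact: exprn_gt0.
have inv_ge0 (t : R) k : 1 <= t -> 0 <= t ^- k by move=> t1; rewrite invr_ge0 exprn_ge0//; lra.
split.
- split.
  + exact: measurable_Phi.
  + exact: measurable_dPhi.
  + by move=> t t1; apply: is_derive_Phi; lra.
  + move=> t t1; have t0 : 0 < t by lra.
    have st : 0 < Num.sqrt t by rewrite sqrtr_gt0.
    have tE : t = Num.sqrt t ^+ 2 by rewrite sqr_sqrtr// ltW.
    rewrite tE -phiE//.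
    pose v : 'cV[R]_3 := vec3 (Num.sqrt (t - 1), 0, 0).
    have vE : jap v = Num.sqrt t.
      rewrite /jap /enorm sqr_sqrtr; last first.
        by rewrite /dot; apply: sumr_ge0 => i _; rewrite -expr2 sqr_ge0.
      congr Num.sqrt; rewrite /dot !big_ord_recr big_ord0/= /v /vec3 !mxE/=.
      rewrite -expr2 sqr_sqrtr ?subr_ge0//; ring.
    by have := equilibrium_ge0 E v; rewrite /mu vE.
  + move=> t t1; have t0 : 0 < t by lra.
    apply: le_trans (ler_norm _) _; rewrite /Phi t0.
    apply: le_trans (hA t t1) _; rewrite addn0 ler_wpM2r ?inv_ge0//; lra.
  + move=> t t1; have t0 : 0 < t by lra.
    rewrite /dPhi t0; apply: le_trans (hB t t1) _; rewrite ler_wpM2r ?inv_ge0//; lra.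
- by move=> s s1; apply: phiE; lra.
move=> s s1; have s0 : 0 < s by lra.
have D : is_derive s 1 (fun x => Phi (x ^+ 2)) (2 * s * dPhi (s ^+ 2)).
  have D1 := is_derive_Phi (s2 _ s0).
  have D2 : is_derive s 1 (fun x : R => x ^+ 2) (2 * s).
    by apply: is_derive_eq; rewrite /GRing.scale/=; ring.
  have := @is_derive1_comp _ Phi (fun x : R => x ^+ 2) s _ _ D1 D2.
  by rewrite mulrC.
have : is_derive s 1 phi (2 * s * dPhi (s ^+ 2)).
  apply: (near_eq_is_derive _ D).
  near=> x; rewrite phiE//; near: x; exact: lt_nbhsr.
by move=> [_ <-]; rewrite derive1E.
Unshelve. all: by end_near. Qed.

End equilibrium_profile.

(** * The dispersion function as a Cauchy integral *)
Section projection.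
Context {R : realType}.
Implicit Types k v : 'cV[R]_3.

Lemma proj_perpE k v : proj_perp k *m v = v - ((enorm k ^+ 2)^-1 * dot k v) *: k.
Proof.
rewrite /proj_perp mulmxBl mul1mx -scalemxAl -mulmxA; congr (_ - _).
have -> : k^T *m v = (dot k v)%:M.
  apply/matrixP => i j; rewrite !ord1 !mxE eqxx mulr1n /dot.
  by apply: eq_bigr => l _; rewrite mxE.
by rewrite mul_mx_scalar scalerA.
Qed.

Lemma enorm_proj_perp k v : k != 0 ->
  enorm (proj_perp k *m v) ^+ 2 = enorm v ^+ 2 - (dot k v / enorm k) ^+ 2.
Proof.
move=> /enorm_gt0 k0; rewrite proj_perpE enorm_sq.
set c := _ * dot k v.
have -> : dot (v - c *: k) (v - c *: k) = dot v v - 2 * c * dot k v + c ^+ 2 * dot k k.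
  by rewrite !dotE !mxE; ring.
rewrite -!enorm_sq /c; field; exact: lt0r_neq0.
Qed.

Lemma enorm_vhat v : enorm (vhat v) ^+ 2 = 1 - (jap v ^+ 2)^-1.
Proof.
have j0 : jap v != 0 by rewrite gt_eqF// (lt_le_trans ltr01 (jap_ge1 v)).
rewrite /vhat enorm_sq dotZl dotZr -enorm_sq.
have -> : enorm v ^+ 2 = jap v ^+ 2 - 1 by rewrite jap_sq; ring.
by field.
Qed.

Lemma enorm_unit k : k != 0 -> enorm ((enorm k)^-1 *: k) = 1.
Proof.
move=> /enorm_gt0 k0; apply: (@pexpIrn _ 2); rewrite ?nnegrE ?sqrtr_ge0//.
rewrite enorm_sq dotZl dotZr -enorm_sq; field; exact: lt0r_neq0.
Qed.

End projection.

Section kernels.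
Context {R : realType}.

(** Real and imaginary parts of i d / (lambda + i d), lambda = a + i b. *)
Definition kerR (a b d : R) : R := d * (b + d) / (a ^+ 2 + (b + d) ^+ 2).
Definition kerI (a b d : R) : R := a * d / (a ^+ 2 + (b + d) ^+ 2).

Lemma kernel_complex (a b d p c : R) :
  (0 +i* d : Cpx R) * p%:C / ((a +i* b) + (0 +i* d)) * c%:C =
  (kerR a b d * p * c) +i* (kerI a b d * p * c).
Proof.
rewrite /kerR /kerI; apply/eqP; rewrite eq_complex/=.
by apply/andP; split; apply/eqP; rewrite !(mul0r, mulr0, add0r, addr0, oppr0, subr0, sub0r, mulrN, mulNr, opprK); ring.
Qed.

Lemma kernel_den_gt0 (a b d : R) : 0 < a -> 0 < a ^+ 2 + (b + d) ^+ 2.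
Proof. by move=> a0; rewrite ltr_pwDl ?exprn_gt0// sqr_ge0. Qed.

End kernels.

Section reduction_to_density.
Context {R : realType}.
Notation mu := (@lebesgue_measure R).
Variables (phi : R -> R) (Phi dPhi : R -> R) (A n0 : R).
Hypotheses (PhiP : profile Phi dPhi A)
  (phiE : forall s, 1 <= s -> phi s = Phi (s ^+ 2))
  (dphiE : forall s, 1 <= s -> derive1 phi s = 2 * s * dPhi (s ^+ 2)).

Let K : R := @disc_area R.
Let q (u : R) : R := K * mass_density Phi u.

Let e3 : 'cV[R]_3 := vec3 (0, 0, 1).
Let e3_unit : enorm e3 = 1.
Proof.
apply: (@pexpIrn _ 2); rewrite ?nnegrE ?sqrtr_ge0//.
by rewrite enorm_sq dotE !vec3E/=; ring.
Qed.

Let weight (t : R) : R := (1 + 2 / 3 * (t - 1)) / t `^ (3 / 2).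

Let measurable_weight : measurable_fun setT weight.
Proof.
apply: measurable_funM.
  by apply: measurable_funD => //; apply: measurable_funM => //; exact: measurable_funB.
by apply: (measurableT_comp (@measurable_inv R)); exact: measurable_powR.
Qed.

Let sqrt_weight (t : R) : 0 < t -> Num.sqrt t * weight t = (1 + 2 / 3 * (t - 1)) / t.
Proof.
move=> t0; have st : 0 < Num.sqrt t by rewrite sqrtr_gt0.
have -> : weight t = (1 + 2 / 3 * (t - 1)) / (t * Num.sqrt t).
  rewrite /weight (_ : 3 / 2 = 1 + 2^-1); last by field.
  rewrite powRD ?powRr1 ?powR12_sqrt ?(ltW t0)//.
  by apply/implyP => _; rewrite gt_eqF.
by field; rewrite !gt_eqF.
Qed.

(** The weight of tau_0^2 and the density integrate the profile against different
    functions of (u, t), which [mass_identity] shows to be equivalent. *)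
Lemma tau0sqE : tau0sq phi = \int[mu]_u q u.
Proof.
have [I0 IE] := mass_identity PhiP.
pose F (p : R * R) := weight p.2 * Phi p.2.
have mF : measurable_fun setT F.
  apply: measurable_funM; first exact: (measurableT_comp measurable_weight).
  exact: (measurableT_comp (profile_measurable PhiP)).
have HE : (fun p : R * R => if sph_dom p then Num.sqrt p.2 * F p else 0) =
    (fun p : R * R => if sph_dom p then (1 + 2 / 3 * (p.2 - 1)) / p.2 * Phi p.2 else 0).
  apply/funext => -[u t]; rewrite /F/=; case: ifP => // /andP[/= t0 _].
  by rewrite mulrA sqrt_weight.
rewrite RintegralZl//; last exact: (integrable_mass_density PhiP).
rewrite -IE -HE -(rint3_spherical e3_unit mF); last by rewrite HE.
congr rint3; apply/funext => v; rewrite /F/= /Defs.mu phiE ?jap_ge1// jap_sq /weight.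
by congr (_ / _ * _); congr (1 + _ * _); rewrite addrAC subrr add0r.
Qed.

(** If the density had no mass, the profile would vanish almost everywhere on the
    range of (u, t), and so would the total mass n0 of the equilibrium. *)
Lemma mass_gt0 : (forall v, 0 <= Defs.mu phi v) ->
  (\int[@leb3 R]_p (Defs.mu phi (vec3 p))%:E = n0%:E)%E -> n0 != 0 ->
  0 < K * \int[mu]_u mass_density Phi u.
Proof.
move=> phi_ge0 phi_mass n0_neq0.
have md_ge0 := mass_density_ge0 PhiP.
have : 0 <= K * \int[mu]_u mass_density Phi u.
  by rewrite mulr_ge0 ?disc_area_ge0// Rintegral_ge0.
rewrite le_eqVlt => /predU1P[/esym/eqP|//]; rewrite mulf_eq0 => KI.
pose F (p : R * R) := Num.max (Phi p.2) 0.
have mF : measurable_fun setT F.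
  by apply: measurable_maxr => //; exact: (measurableT_comp (profile_measurable PhiP)).
have F0 p : (0 <= (F p)%:E)%E by rewrite lee_fin le_max lexx orbT.
have mFE : measurable_fun setT (EFin \o F) by exact/measurable_EFinP.
have := ge0_integral_leb3 e3_unit mFE F0.
have -> : (\int[@leb3 R]_p (EFin \o F) (dot e3 (vhat (vec3 p)), jap (vec3 p) ^+ 2)%R = n0%:E)%E.
  rewrite -phi_mass; apply: eq_integral => p _; congr (_%:E); rewrite /F/=.
  by rewrite -phiE ?jap_ge1// max_l//; exact: phi_ge0.
have [I0 IE] := mass_identity PhiP.
rewrite -/K; move: KI => /orP[/eqP -> |/eqP I].
  by rewrite mul0e => -[] n00; rewrite n00 eqxx in n0_neq0.
set g := (X in ((mu \x mu)%E.-integrable _ (EFin \o X))) in I0.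
have g0 p : 0 <= g p.
  rewrite /g; case: ifP => // /(halfline_ge1 _) h.
  have t1 : 1 <= p.2 by apply: h; rewrite gerBl sqr_ge0.
  by rewrite !mulr_ge0// ?invr_ge0 ?(profile_ge0 PhiP)//; lra.
have gae : ae_eq (mu \x mu)%E setT (EFin \o g) (cst 0).
  apply/ae_eq_integral_abs => //; first exact: measurable_int I0.
  have -> : (\int[(mu \x mu)%E]_p `|(EFin \o g) p| = \int[(mu \x mu)%E]_p (g p)%:E)%E.
    by apply: eq_integral => p _; rewrite gee0_abs// lee_fin.
  rewrite -[LHS]fineK; last exact: (integrable_fin_num measurableT I0).
  by rewrite -[fine _]/(\int[(mu \x mu)%E]_p g p) /g IE I.
have -> : (\int[(mu \x mu)%E]_p (if sph_dom p then (Num.sqrt p.2)%:E * (EFin \o F) p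
    else 0) = 0)%E.
  rewrite -[RHS](integral0 (mu \x mu)%E setT); apply: ae_eq_integral => //.
    apply: measurable_fun_ifT => //; first exact: measurable_sph_dom.
    apply: emeasurable_funM => //; apply/measurable_EFinP.
    exact: (measurableT_comp (@measurable_sqrt R)).
  apply: filterS gae => p /(_ Logic.I) [] gp _; case: ifP => // dp.
  have t1 : 1 <= p.2 by apply: (halfline_ge1 _ dp); rewrite gerBl sqr_ge0.
  move: gp; rewrite /g dp => /eqP; rewrite mulf_eq0 => /orP[|/eqP P0].
    by rewrite gt_eqF// divr_gt0//; lra.
  by rewrite /= /F P0 maxxx mule0.
rewrite mule0 => -[] n00; by rewrite n00 eqxx in n0_neq0.
Qed.

(** The kernel i k.v^ / (lambda + i k.v^) depends on the velocity v^ only through its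
    component u along k, so that its real and imaginary parts can serve as the
    function h of [dispersion_reduction]. *)
Lemma magM_openE (k : 'cV[R]_3) (a b : R) : k != 0 -> 0 < a ->
  let r := enorm k in
  magM_open phi (a +i* b) k = (a +i* b) ^+ 2 + (r ^+ 2)%:C +
    ((\int[mu]_u q u - \int[mu]_u (kerR a b (r * u) * q u)) -i*
     \int[mu]_u (kerI a b (r * u) * q u)).
Proof.
move=> k0 a0 r; rewrite /magM_open (negbTE k0) tau0sqE.
have r0 : 0 < r := enorm_gt0 k0.
pose w := r^-1 *: k; have w1 : enorm w = 1 := enorm_unit k0.
have kdot v : dot k v = r * dot w v by rewrite dotZl mulrA mulfV ?mul1r// gt_eqF.
have part (ker : R -> R) (M : R) : measurable_fun setT ker ->
    (forall u : R, u ^+ 2 <= 1 -> `|ker (r * u)| <= M) ->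
    2^-1 * rint3 (fun v => ker (dot k (vhat v)) * enorm (proj_perp k *m vhat v) ^+ 2 *
      derive1 phi (jap v)) = - \int[mu]_u (ker (r * u) * q u).
  move=> mker kerM.
  pose h u := ker (r * u).
  have mh : measurable_fun setT h by apply: (measurableT_comp mker); exact: measurable_funM.
  have [I Ih IE] := dispersion_reduction PhiP mh kerM.
  pose F (p : R * R) := h p.1 * (1 - p.2^-1 - p.1 ^+ 2) * (2 * Num.sqrt p.2 * dPhi p.2).
  have mF : measurable_fun setT F.
    apply: measurable_funM.
      apply: measurable_funM; first exact: (measurableT_comp mh).
      apply: measurable_funB; last exact: measurable_funX.
      by apply: measurable_funB => //; exact: (measurableT_comp (@measurable_inv R)).
    apply: measurable_funM; last exact: (measurableT_comp (profile_dmeasurable PhiP)).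
    by apply: measurable_funM => //; exact: (measurableT_comp (@measurable_sqrt R)).
  have -> : rint3 (fun v => ker (dot k (vhat v)) * enorm (proj_perp k *m vhat v) ^+ 2 *
      derive1 phi (jap v)) = rint3 (fun v => F (dot w (vhat v), jap v ^+ 2)).
    congr rint3; apply/funext => v; rewrite /F /h/= -kdot dphiE ?jap_ge1//.
    rewrite enorm_proj_perp// enorm_vhat sqrtr_sqr ger0_norm ?sqrtr_ge0//.
    by rewrite kdot -/r (mulrC r) mulfK// gt_eqF.
  rewrite (rint3_spherical w1 mF I) IE -/K.
  have -> : \int[mu]_u (ker (r * u) * q u) = K * \int[mu]_u (h u * mass_density Phi u).
    by rewrite -RintegralZl//; apply: eq_Rintegral => u _; rewrite /q /h mulrCA.
  by field.
rewrite /cint3 (_ : mag_integrand phi (a +i* b) k = fun v =>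
  (kerR a b (dot k (vhat v)) * enorm (proj_perp k *m vhat v) ^+ 2 * derive1 phi (jap v)) +i*
  (kerI a b (dot k (vhat v)) * enorm (proj_perp k *m vhat v) ^+ 2 * derive1 phi (jap v))); last first.
  by apply/funext => v; rewrite /mag_integrand kernel_complex.
rewrite /=.
have den (d : R) := kernel_den_gt0 b d a0.
have mden : measurable_fun setT (fun d : R => (a ^+ 2 + (b + d) ^+ 2)^-1).
  apply: (measurableT_comp (@measurable_inv R)); apply: measurable_funD => //.
  by apply: measurable_funX; exact: measurable_funD.
have ra (u : R) : u ^+ 2 <= 1 -> `|r * u| <= r.
  move=> u1; rewrite normrM gtr0_norm// ler_piMr ?(ltW r0)//.
  by rewrite -(@expr_le1 _ 2)// real_normK ?num_real.
have ia (d : R) : (a ^+ 2 + (b + d) ^+ 2)^-1 <= a ^- 2.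
  by rewrite lef_pV2 ?posrE ?exprn_gt0// lerDl sqr_ge0.
have MR (u : R) : u ^+ 2 <= 1 -> `|kerR a b (r * u)| <= r * (`|b| + r) * a ^- 2.
  move=> /ra u1; rewrite /kerR !normrM [X in _ * X]ger0_norm ?invr_ge0 ?(ltW (den _))//.
  apply: ler_pM => //; rewrite ?invr_ge0 ?(ltW (den _))//.
  by rewrite -normrM; apply: ler_pM => //; apply: le_trans (ler_normD _ _) _; exact: lerD.
have MI (u : R) : u ^+ 2 <= 1 -> `|kerI a b (r * u)| <= a * r * a ^- 2.
  move=> /ra u1; rewrite /kerI !normrM [X in _ * X]ger0_norm ?invr_ge0 ?(ltW (den _))//.
  apply: ler_pM => //; rewrite ?invr_ge0 ?(ltW (den _))//.
  by rewrite -(normrM r) (gtr0_norm a0) ler_wpM2l// ltW.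
have mR : measurable_fun setT (kerR a b).
  by apply: measurable_funM => //; apply: measurable_funM => //; exact: measurable_funD.
have mI : measurable_fun setT (kerI a b).
  by apply: measurable_funM => //; exact: measurable_funM.
have ER := part _ _ mR MR; have EI := part _ _ mI MI.
rewrite -!addrA; congr (_ + (_ + _)).
set X := rint3 _ in ER *; set Y := rint3 _ in EI *.
have -> : (2^-1 : Cpx R) * (X +i* Y) = (2^-1 * X) +i* (2^-1 * Y).
  have -> : (2^-1 : Cpx R) = (2^-1)%:C by rewrite fmorphV rmorph_nat.
  by apply/eqP; rewrite eq_complex/=; apply/andP; split; apply/eqP; ring.
rewrite ER EI; apply/eqP; rewrite eq_complex/=; apply/andP; split; apply/eqP => //.
by rewrite add0r.
Qed.

End reduction_to_density.

(** * Boundary values of the Cauchy integral *)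
Section sequential.
Context {R : realType}.

(** Sequential continuity, in the form in which dominated convergence provides it:
    the second coordinates may be kept in a bounded set. *)
Lemma continuous_complex_seq (g : R -> R -> R) :
  (forall (a b : R) (a_ b_ : nat -> R), (forall n, `|b_ n - b| <= 1) ->
    a_ n @[n --> \oo] --> a -> b_ n @[n --> \oo] --> b ->
    g (a_ n) (b_ n) @[n --> \oo] --> g a b) ->
  continuous (fun z : Cpx R => g (complex.Re z) (complex.Im z)).
Proof.
move=> H z; have FF : Filter (nbhs (z : Cpx R)) by exact: nbhs_filter.
apply/cvgrPdist_lt => e e0; apply: contrapT => nz.
pose d (n : nat) : R := n.+1%:R^-1.
have d0 n : 0 < d n by rewrite invr_gt0.
have ex n : exists w : Cpx R, [/\ `|complex.Re z - complex.Re w| < d n,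
    `|complex.Im z - complex.Im w| < d n &
    e <= `|g (complex.Re z) (complex.Im z) - g (complex.Re w) (complex.Im w)|].
  apply: contrapT => h; apply: nz.
  have /cvgrPdist_lt/(_ _ (d0 n)) h1 := @continuous_Re R z.
  have /cvgrPdist_lt/(_ _ (d0 n)) h2 := @continuous_Im R z.
  near=> w; rewrite ltNge; apply/negP => h3; apply: h; exists w; split => //.
    by near: w.
  by near: w.
have [w hw] := choice ex.
have dcvg : d n @[n --> \oo] --> (0 : R) by exact: cvg_harmonic.
have Rcvg : complex.Re (w n) @[n --> \oo] --> complex.Re z.
  apply/cvgrPdist_lt => e' e'0; have /cvgrPdist_lt/(_ _ e'0) := dcvg.
  apply: filterS => n; rewrite sub0r normrN gtr0_norm//; apply: lt_trans.
  by have [] := hw n.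
have Icvg : complex.Im (w n) @[n --> \oo] --> complex.Im z.
  apply/cvgrPdist_lt => e' e'0; have /cvgrPdist_lt/(_ _ e'0) := dcvg.
  apply: filterS => n; rewrite sub0r normrN gtr0_norm//; apply: lt_trans.
  by have [] := hw n.
have I1 n : `|complex.Im (w n) - complex.Im z| <= 1.
  rewrite distrC ltW//; have [_ h _] := hw n; apply: lt_le_trans h _.
  by rewrite invf_le1// ler1n.
have /cvgrPdist_lt/(_ _ e0)[N _] := H _ _ _ _ I1 Rcvg Icvg.
move=> /(_ N (leqnn N)) /=; have [_ _] := hw N.
by move=> h1 h2; have := le_lt_trans h1 h2; rewrite ltxx.
Unshelve. all: by end_near. Qed.

End sequential.

Section lorentz.
Context {R : realType}.
Notation mu := (@lebesgue_measure R).

Lemma measurable_lorentz : measurable_fun [set: R] (fun x : R => (1 + x ^+ 2)^-1).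
Proof.
by apply: (measurableT_comp (@measurable_inv R)); apply: measurable_funD.
Qed.

Lemma lorentz_gt0 (x : R) : 0 < (1 + x ^+ 2)^-1.
Proof. by rewrite invr_gt0 ltr_pwDl// sqr_ge0. Qed.

Lemma integral_lorentz : (\int[mu]_x ((1 + x ^+ 2)^-1)%:E = (@pi R)%:E)%E.
Proof.
rewrite (@ge0_symfun_integralT R (fun x => (1 + x ^+ 2)^-1)).
- have -> : (\int[mu]_(x in [set x | (0 <= x)%R]) ((1 + x ^+ 2)^-1)%:E = (pi / 2)%:E)%E.
    rewrite -integral0y_oneDsqr; congr integral.
    by apply/seteqP; split => x /=; rewrite in_itv/= andbT.
  by rewrite -EFinM; congr (_%:E); field.
- by move=> x; rewrite ltW// lorentz_gt0.
- exact: continuous_oneDsqrV.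
- by move=> x /=; rewrite sqrrN.
Qed.

Lemma integrable_lorentz : mu.-integrable setT (EFin \o (fun x : R => (1 + x ^+ 2)^-1)).
Proof.
apply/integrableP; split; first by apply/measurable_EFinP; exact: measurable_lorentz.
rewrite (_ : integral _ _ _ = (@pi R)%:E) ?ltry//.
rewrite -integral_lorentz; apply: eq_integral => x _.
by rewrite gee0_abs// lee_fin ltW// lorentz_gt0.
Qed.

Lemma Rintegral_lorentz : \int[mu]_x (1 + x ^+ 2)^-1 = pi.
Proof. by rewrite /Rintegral integral_lorentz. Qed.

End lorentz.

Section cauchy_transform.
Context {R : realType}.
Notation mu := (@lebesgue_measure R).

Lemma integrable_bounded_support (h : R -> R) (c M : R) : measurable_fun setT h ->
  (forall u : R, `|u| <= c -> `|h u| <= M) -> (forall u : R, c < `|u| -> h u = 0) ->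
  mu.-integrable setT (EFin \o h).
Proof.
move=> mh hM h0; have I0 := @integrable_indic_itv R (- c) c true false.
have I := integrableZl measurableT M I0.
apply: le_integrable I => //; first exact/measurable_EFinP.
move=> u _; pose J : set R := `[(- c)%R, c]%classic.
rewrite -[X in (_ <= `|X|)%E]/((M * \1_J u)%:E) !abse_EFin lee_fin.
have [uc|uc] := leP `|u| c; last by rewrite h0// normr0.
rewrite indicE mem_set/= ?mulr1; last by rewrite /J /= in_itv/= -ler_norml.
by apply: le_trans (hM _ uc) (ler_norm _).
Qed.

Variables (q : R -> R) (B L : R).
Hypothesis qP : density q B L.

Lemma density_bound_ge0 : 0 <= B.
Proof.
have := le_trans (density_ge0 qP 0) (density_le qP 0).
by rewrite expr0n subr0 max_l// expr1n mulr1.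
Qed.

Lemma density_lip_ge0 : 0 <= L.
Proof.
by have := le_trans (normr_ge0 _) (density_lip qP 1 0); rewrite subr0 normr1 mulr1.
Qed.

Lemma density_out u : 1 <= `|u| -> q u = 0.
Proof.
move=> u1; apply/eqP; rewrite eq_le (density_ge0 qP) andbT.
apply: le_trans (density_le qP u) _; rewrite max_r ?expr0n ?mulr0//.
by rewrite subr_le0 -(real_normK (num_real u)) expr_ge1.
Qed.

Lemma density_le_bound u : q u <= B.
Proof.
apply: le_trans (density_le qP u) _; rewrite ler_piMr ?density_bound_ge0//.
by rewrite expr_le1 ?le_max ?lexx ?orbT// ge_max ler01 gerBl sqr_ge0.
Qed.

Lemma density_norm_le u : `|q u| <= B.
Proof. by rewrite ger0_norm ?(density_ge0 qP)// density_le_bound. Qed.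

Lemma density_continuous : continuous q.
Proof. exact: dist_continuous (density_lip qP). Qed.

Lemma integrable_density_mul (k : R -> R) (M : R) : measurable_fun setT k ->
  (forall u : R, `|u| < 1 -> `|k u| <= M) ->
  mu.-integrable setT (EFin \o (fun u => k u * q u)).
Proof.
move=> mk kM; apply: (@integrable_bounded_support _ 1 (`|M| * B)).
- by apply: measurable_funM => //; exact: (density_measurable qP).
- move=> u; rewrite le_eqVlt => /predU1P[u1|u1].
    by rewrite density_out ?u1// mulr0 normr0 mulr_ge0// density_bound_ge0.
  rewrite normrM; apply: ler_pM => //; last exact: density_norm_le.
  exact: le_trans (kM _ u1) (ler_norm _).
- by move=> u u1; rewrite density_out ?mulr0// ltW.
Qed.

Lemma integrable_density : mu.-integrable setT (EFin \o q).
Proof.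
have := @integrable_density_mul (fun=> 1) 1 (measurable_cst _).
rewrite (_ : (fun u => 1 * q u) = q); last by apply/funext => u; rewrite mul1r.
by apply => u _; rewrite normr1.
Qed.

Variable r : R.
Hypothesis r_gt0 : 0 < r.

(** For a > 0, the real and imaginary parts of the integral of q(u) / (lambda + i r u)
    at lambda = a + i b, in the variables x = (b + r u) / a and y = b + r u; the
    second is symmetrized in y.  Unlike the original integral, these expressions
    remain meaningful for a = 0. *)
Definition cauchyR (a b : R) : R :=
  r^-1 * \int[mu]_x (q ((a * x - b) / r) * (1 + x ^+ 2)^-1).

Definition cauchyI (a b : R) : R :=
  - (2 * r)^-1 * \int[mu]_y ((q ((y - b) / r) - q ((- y - b) / r)) * (y / (a ^+ 2 + y ^+ 2))).

Let m_affine (c d : R) : measurable_fun setT (fun x : R => q ((c * x - d) / r)).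
Proof.
apply: (measurableT_comp (density_measurable qP)); apply: measurable_funM => //.
by apply: measurable_funB => //; exact: measurable_funM.
Qed.

Let m_ker (a : R) : measurable_fun setT (fun y : R => y / (a ^+ 2 + y ^+ 2)).
Proof.
apply: measurable_funM => //; apply: (measurableT_comp (@measurable_inv R)).
by apply: measurable_funD => //; exact: measurable_funX.
Qed.

Let m_shift (d : R) : measurable_fun setT (fun x : R => q ((x - d) / r)).
Proof.
by have := m_affine 1 d; under eq_fun => x do rewrite mul1r.
Qed.

Let m_flip (d : R) : measurable_fun setT (fun x : R => q ((- x - d) / r)).
Proof.
by have := m_affine (- 1) d; under eq_fun => x do rewrite mulN1r.
Qed.

Let m_integrand (a b : R) : measurable_fun setT
  (fun y : R => (q ((y - b) / r) - q ((- y - b) / r)) * (y / (a ^+ 2 + y ^+ 2))).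
Proof. by apply: measurable_funM => //; exact: measurable_funB. Qed.

Let cvg_q (u_ : nat -> R) (u : R) : u_ n @[n --> \oo] --> u ->
  q (u_ n) @[n --> \oo] --> q u.
Proof. by move=> h; apply: continuous_cvg => //; exact: density_continuous. Qed.

(** The substitution has turned the Poisson kernel into a fixed integrable function,
    so that boundedness and continuity of the density suffice. *)
Lemma continuous_cauchyR :
  continuous (fun z : Cpx R => cauchyR (complex.Re z) (complex.Im z)).
Proof.
apply: continuous_complex_seq => a b a_ b_ _ ha hb.
apply: cvgM; first exact: cvg_cst.
have [] := @Rintegral_dominated_cvg _ _ R mu
  (fun n x => q ((a_ n * x - b_ n) / r) * (1 + x ^+ 2)^-1)
  (fun x => q ((a * x - b) / r) * (1 + x ^+ 2)^-1) (fun x => B * (1 + x ^+ 2)^-1).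
- by move=> n; exact: (measurable_funM (m_affine _ _) measurable_lorentz).
- exact: (measurable_funM (m_affine _ _) measurable_lorentz).
- apply: aeW => x; apply: cvgM; last exact: cvg_cst.
  apply: cvg_q; apply: cvgM; last exact: cvg_cst.
  by apply: cvgB => //; apply: cvgM => //; exact: cvg_cst.
- exact: (integrableZl measurableT B integrable_lorentz).
- move=> n x; rewrite normrM [X in _ * X]gtr0_norm ?lorentz_gt0//.
  by rewrite ler_wpM2r ?(ltW (lorentz_gt0 _))// density_norm_le.
by [].
Qed.

Let ker_bound (a b y : R) :
  `|(q ((y - b) / r) - q ((- y - b) / r)) * (y / (a ^+ 2 + y ^+ 2))| <= 2 * L / r.
Proof.
have L0 := density_lip_ge0; have [->|y0] := eqVneq y 0.
  by rewrite mul0r mulr0 normr0 divr_ge0 ?mulr_ge0// ltW.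
have h := density_lip qP ((y - b) / r) ((- y - b) / r).
have E : (y - b) / r - (- y - b) / r = 2 * y / r by field; rewrite gt_eqF.
rewrite E in h; rewrite normrM; apply: (@le_trans _ _ (L * `|2 * y / r| * `|y|^-1)).
  apply: ler_pM => //; rewrite normrM -ler_pdivlMl ?normr_gt0// -invfM.
  rewrite normfV lef_pV2 ?posrE ?mulr_gt0 ?normr_gt0//.
    by rewrite -expr2 real_normK ?num_real// ger0_norm ?lerDr ?addr_ge0 ?sqr_ge0.
  by rewrite gt_eqF// ltr_wpDl ?sqr_ge0// exprn_even_gt0.
rewrite !normrM normfV (gtr0_norm r_gt0) (gtr0_norm (@ltr0n R 2))//.
rewrite le_eqVlt; apply/orP; left; apply/eqP; field.
by rewrite normr_eq0 y0 gt_eqF.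
Qed.

Let ker_support (b y c : R) : r + `|b| <= c -> c < `|y| ->
  q ((y - b) / r) = 0 /\ q ((- y - b) / r) = 0.
Proof.
move=> bc cy; have h (x : R) : `|x| = `|y| -> q ((x - b) / r) = 0.
  move=> xy; apply: density_out; rewrite normrM normfV (gtr0_norm r_gt0).
  rewrite ler_pdivlMr// mul1r; have := ler_dist_dist x b.
  rewrite xy; have := ler_norm (`|y| - `|b|); lra.
by split; apply: h; rewrite ?normrN.
Qed.

(** The kernel y / (a^2 + y^2) is at most 1 / |y| in absolute value, and the
    Lipschitz bound on the difference of densities cancels this singularity. *)
Lemma continuous_cauchyI :
  continuous (fun z : Cpx R => cauchyI (complex.Re z) (complex.Im z)).
Proof.
apply: continuous_complex_seq => a b a_ b_ b1 ha hb.
apply: cvgM; first exact: cvg_cst.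
pose c := r + (`|b| + 1); pose J : set R := `[(- c)%R, c]%classic.
have [] := @Rintegral_dominated_cvg _ _ R mu
  (fun n y => (q ((y - b_ n) / r) - q ((- y - b_ n) / r)) * (y / (a_ n ^+ 2 + y ^+ 2)))
  (fun y => (q ((y - b) / r) - q ((- y - b) / r)) * (y / (a ^+ 2 + y ^+ 2)))
  (fun y => 2 * L / r * \1_J y).
- by move=> n; exact: m_integrand.
- exact: m_integrand.
- exists [set 0]; split => //; first exact: lebesgue_measure_set1.
  move=> y /= h; apply: contrapT => /eqP y0; apply: h; apply: cvgM.
    by apply: cvgB; apply: cvg_q; apply: cvgM; try exact: cvg_cst; apply: cvgB => //; exact: cvg_cst.
  apply: cvgM; first exact: cvg_cst.
  apply: cvgV; first by rewrite gt_eqF// ltr_wpDl ?sqr_ge0// exprn_even_gt0.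
  by apply: cvgD; last exact: cvg_cst; rewrite expr2; exact: cvgM.
- exact: (integrableZl measurableT (2 * L / r) (@integrable_indic_itv R (- c) c true false)).
- move=> n y; have [yc|yc] := leP `|y| c; last first.
    have [|-> ->] := @ker_support (b_ n) y c _ yc.
      rewrite /c lerD2l; have := ler_normD b (b_ n - b).
      by rewrite addrC subrK; have := b1 n; lra.
    rewrite subrr mul0r normr0 mulr_ge0 ?divr_ge0 ?mulr_ge0 ?density_lip_ge0 ?(ltW r_gt0)//.
  by rewrite indicE mem_set ?mulr1 ?ker_bound// /J/= in_itv/= -ler_norml.
by [].
Qed.

Lemma integrable_cauchyI (a b : R) : mu.-integrable setT (EFin \o
  (fun y : R => (q ((y - b) / r) - q ((- y - b) / r)) * (y / (a ^+ 2 + y ^+ 2)))).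
Proof.
apply: (@integrable_bounded_support _ (r + `|b|) (2 * L / r)) => //.
by move=> y yc; have [-> ->] := ker_support (lexx _) yc; rewrite subrr mul0r.
Qed.

Lemma cauchyR_axis (b : R) : cauchyR 0 b = pi / r * q (b / r).
Proof.
rewrite /cauchyR; under eq_Rintegral => x _ do rewrite mul0r sub0r.
rewrite RintegralZl ?integrable_lorentz// Rintegral_lorentz mulNr (density_even qP).
by ring.
Qed.

Lemma cauchyI_odd (a b : R) : cauchyI a (- b) = - cauchyI a b.
Proof.
rewrite /cauchyI -mulrN; congr (_ * _).
rewrite -[in RHS]mulN1r -RintegralZl ?integrable_cauchyI//.
apply: eq_Rintegral => y _; rewrite opprK.
rewrite -[q ((y + b) / r)](density_even qP) -[q ((- y + b) / r)](density_even qP).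
have -> : - (((y : R) + b) / r) = (- y - b) / r by field; rewrite gt_eqF.
have -> : - ((- (y : R) + b) / r) = (y - b) / r by field; rewrite gt_eqF.
by ring.
Qed.

(** Substituting x = (b + r u) / a. *)
Lemma cauchyRE (a b : R) : 0 < a ->
  cauchyR a b = \int[mu]_u (a / (a ^+ 2 + (b + r * u) ^+ 2) * q u).
Proof.
move=> a0; have ar : a / r != 0 by rewrite mulf_neq0 ?invr_eq0 ?gt_eqF.
have md : measurable_fun setT (fun u : R => (1 + ((r * u + b) / a) ^+ 2)^-1).
  apply: (measurableT_comp measurable_lorentz); apply: measurable_funM => //.
  by apply: measurable_funD => //; exact: measurable_funM.
pose f u := (1 + ((r * u + b) / a) ^+ 2)^-1 * q u.
have E := @Rintegral_affine R f (a / r) (- b / r) ar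
  (measurable_funM md (density_measurable qP)).
have -> : cauchyR a b = r^-1 * \int[mu]_x f (a / r * x + - b / r).
  congr (_ * _); apply: eq_Rintegral => x _; rewrite /f mulrC.
  congr (_^-1 * _); last by congr q; field; rewrite gt_eqF.
  by congr (1 + _ ^+ 2); field; rewrite !gt_eqF.
rewrite E gtr0_norm ?divr_gt0// mulrA.
have -> : r^-1 * (a / r)^-1 = a^-1 by field; rewrite !gt_eqF.
rewrite -RintegralZl//; last first.
  apply: (integrable_density_mul (M := 1) md) => u _.
  have h : 1 <= 1 + ((r * u + b) / a) ^+ 2 by rewrite lerDl sqr_ge0.
  by rewrite ger0_norm ?invr_ge0 ?invf_le1 ?(le_trans ler01 h) ?(lt_le_trans ltr01 h).
apply: eq_Rintegral => u _; rewrite /f mulrA; congr (_ * _).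
have h : a ^+ 2 + (b + r * (u : R)) ^+ 2 != 0.
  by rewrite gt_eqF// ltr_pwDl ?exprn_gt0// sqr_ge0.
have h' : 1 + ((r * (u : R) + b) / a) ^+ 2 != 0.
  by rewrite gt_eqF// ltr_pwDl// sqr_ge0.
by field; rewrite h (gt_eqF a0).
Qed.

(** Both halves of the difference of densities contribute the same amount, since
    the kernel y / (a^2 + y^2) is odd. *)
Lemma cauchyIE (a b M : R) :
  (forall u : R, `|u| < 1 -> `|(b + r * u) / (a ^+ 2 + (b + r * u) ^+ 2)| <= M) ->
  cauchyI a b = - \int[mu]_u ((b + r * u) / (a ^+ 2 + (b + r * u) ^+ 2) * q u).
Proof.
move=> kM; pose k (y : R) := y / (a ^+ 2 + y ^+ 2).
have kN y : k (- y) = - k y by rewrite /k sqrrN mulNr.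
pose f u := k (b + r * u) * q u.
have mf : measurable_fun setT f.
  apply: measurable_funM; last exact: (density_measurable qP).
  apply: (measurableT_comp (m_ker a)); exact: measurable_funD.
have ri : r^-1 != 0 by rewrite invr_eq0 gt_eqF.
have ri' : - r^-1 != 0 by rewrite oppr_eq0.
have E1 := @Rintegral_affine R f _ (- b / r) ri mf.
have E2 := @Rintegral_affine R f _ (- b / r) ri' mf.
have F1 y : q ((y - b) / r) * k y = f (r^-1 * y + - b / r).
  rewrite /f mulrC; congr (_ * _); last by congr q; field; rewrite gt_eqF.
  by congr k; field; rewrite gt_eqF.
have F2 y : q ((- y - b) / r) * k y = - f (- r^-1 * y + - b / r).
  rewrite /f mulrC -mulNr -kN; congr (_ * _); last by congr q; field; rewrite gt_eqF.
  by congr k; field; rewrite gt_eqF.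
have int (s : R) : `|s| = 1 -> mu.-integrable setT
    (EFin \o (fun y : R => q ((s * y - b) / r) * k y)).
  move=> s1; apply: (@integrable_bounded_support _ (r + `|b|) (B * `|M|)).
  - exact: (measurable_funM (m_affine _ _) (m_ker _)).
  - move=> y _; have [h|h] := leP 1 `|(s * y - b) / r|.
      by rewrite density_out// mul0r normr0 mulr_ge0// density_bound_ge0.
    rewrite normrM; apply: ler_pM => //; first exact: density_norm_le.
    have -> : `|k y| = `|k (b + r * ((s * y - b) / r))|.
      have -> : b + r * ((s * y - b) / r) = s * y by field; rewrite gt_eqF.
      rewrite /k !normrM s1 mul1r !normfV; congr (_ * `|_|^-1).
      by rewrite exprMn -(real_normK (num_real s)) s1 expr1n mul1r.
    exact: le_trans (kM _ h) (ler_norm _).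
  - move=> y yc; rewrite density_out ?mul0r//.
    rewrite normrM normfV (gtr0_norm r_gt0) ler_pdivlMr// mul1r.
    have := ler_dist_dist (s * y) b; rewrite normrM s1 mul1r.
    have := ler_norm (`|y| - `|b|); lra.
have I1 : mu.-integrable setT (EFin \o (fun y : R => q ((y - b) / r) * k y)).
  by have := int 1 (normr1 _); under eq_fun => y do rewrite mul1r.
have I2 : mu.-integrable setT (EFin \o (fun y : R => q ((- y - b) / r) * k y)).
  by have := int (- 1); rewrite normrN1 => /(_ erefl); under eq_fun => y do rewrite mulN1r.
have -> : cauchyI a b = - (2 * r)^-1 * (\int[mu]_y (q ((y - b) / r) * k y) -
    \int[mu]_y (q ((- y - b) / r) * k y)).
  congr (_ * _); rewrite -RintegralB//; apply: eq_Rintegral => y _.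
  by rewrite mulrBl.
under eq_Rintegral => y _ do rewrite F1.
under [X in _ - X]eq_Rintegral => y _ do rewrite F2 -mulN1r.
rewrite RintegralZl//; last first.
  move: I2; rewrite (_ : (fun y : R => q ((- y - b) / r) * k y) =
    (fun y => - 1 * f (- r^-1 * y + - b / r))); last first.
    by apply/funext => y; rewrite F2 mulN1r.
  move=> /(integrableZl measurableT (- 1)) /=.
  congr (_.-integrable _ _); apply/funext => y /=; congr EFin; ring.
rewrite E1 E2 normrN normfV invrK gtr0_norm//.
rewrite -[X in _ = - X]/(\int[mu]_u f u).
by field; rewrite gt_eqF.
Qed.

End cauchy_transform.

(** * The dispersion function on the imaginary axis *)
Section dispersion.
Context {R : realType}.
Notation mu := (@lebesgue_measure R).
Variables (q : R -> R) (B L : R).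
Hypothesis qP : density q B L.

Definition moment (n : nat) (w : R) : R :=
  \int[mu]_u (u ^+ n.*2 / (1 - w * u ^+ 2) ^+ n.+1 * q u).

Variable r : R.
Hypothesis r_gt0 : 0 < r.

(** A continuous function on the plane that coincides with M on the open right
    half-plane, for wave vectors of length r. *)
Definition dispersion (z : Cpx R) : Cpx R := z ^+ 2 + (r ^+ 2)%:C +
  z * (cauchyR q r (complex.Re z) (complex.Im z) +i* cauchyI q r (complex.Re z) (complex.Im z)).

Lemma continuous_dispersion : continuous dispersion.
Proof.
move=> z; have FF : Filter (nbhs (z : Cpx R)) by exact: nbhs_filter.
have c1 : (fun w : Cpx R => w * w) @ nbhs z --> z * z by apply: cvgM; exact: cvg_id.
have c2 : (fun w : Cpx R => (cauchyR q r (complex.Re w) (complex.Im w) +i*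
    cauchyI q r (complex.Re w) (complex.Im w) : Cpx R)) @ nbhs z -->
    (cauchyR q r (complex.Re z) (complex.Im z) +i*
    cauchyI q r (complex.Re z) (complex.Im z) : Cpx R).
  exact: (cvg_complex FF (@continuous_cauchyR _ _ _ _ qP r z)
    (@continuous_cauchyI _ _ _ _ qP _ r_gt0 z)).
have c3 : (fun w : Cpx R => (r ^+ 2)%:C : Cpx R) @ nbhs z --> ((r ^+ 2)%:C : Cpx R).
  exact: cvg_cst.
have c4 := @cvgD (Cpx R) (Cpx R) _ _ FF _ _ _ _ c1 c3.
have c5 := @cvgM (Cpx R) _ _ FF _ _ _ _ (@cvg_id _ (nbhs z)) c2.
have c6 := @cvgD (Cpx R) (Cpx R) _ _ FF _ _ _ _ c4 c5.
rewrite /continuous_at (_ : dispersion = fun w : Cpx R => w * w + (r ^+ 2)%:C + w *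
  (cauchyR q r (complex.Re w) (complex.Im w) +i* cauchyI q r (complex.Re w) (complex.Im w) : Cpx R)).
  exact: c6.
by apply/funext => w; rewrite /dispersion expr2.
Qed.

Let m_affine (b : R) : measurable_fun setT (fun u : R => b + r * u).
Proof. by apply: measurable_funD => //; exact: measurable_funM. Qed.

Let m_den (a b : R) : measurable_fun setT (fun u : R => (a ^+ 2 + (b + r * u) ^+ 2)^-1).
Proof.
apply: (measurableT_comp (@measurable_inv R)); apply: measurable_funD => //.
exact: measurable_funX.
Qed.

(** 1 - i r u / (lambda + i r u) = lambda / (lambda + i r u). *)
Lemma dispersionE (a b : R) : 0 < a -> dispersion (a +i* b) =
  (a +i* b) ^+ 2 + (r ^+ 2)%:C +
    ((\int[mu]_u q u - \int[mu]_u (kerR a b (r * u) * q u)) -i*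
     \int[mu]_u (kerI a b (r * u) * q u)).
Proof.
move=> a0; pose ka (u : R) := a / (a ^+ 2 + (b + r * u) ^+ 2).
pose kb (u : R) := (b + r * u) / (a ^+ 2 + (b + r * u) ^+ 2).
have den (u : R) := kernel_den_gt0 b (r * u) a0.
have kaM (u : R) : `|u| < 1 -> `|ka u| <= a^-1.
  move=> _; rewrite /ka normrM normfV (gtr0_norm a0) (gtr0_norm (den u)) ler_pdivrMr//.
  by rewrite ler_pdivlMl// -expr2 lerDl sqr_ge0.
have kbM (u : R) : `|u| < 1 -> `|kb u| <= a^-1.
  move=> _; rewrite normrM normfV (gtr0_norm (den u)) ler_pdivrMr// ler_pdivlMl//.
  rewrite -[in leRHS](real_normK (num_real (b + r * u))).
  have := normr_ge0 (b + r * u); move: `|_| => y y0; nra.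
have ia : mu.-integrable setT (EFin \o (fun u => ka u * q u)) := integrable_density_mul qP (measurable_funM (measurable_cst a) (m_den a b)) kaM.
have ib : mu.-integrable setT (EFin \o (fun u => kb u * q u)) := integrable_density_mul qP (measurable_funM (m_affine b) (m_den a b)) kbM.
have iq := integrable_density qP.
rewrite /dispersion/= (cauchyRE qP r_gt0 b a0) (cauchyIE qP r_gt0 kbM).
rewrite -/(\int[mu]_u (ka u * q u)) -/(\int[mu]_u (kb u * q u)).
have iaa := integrableZl measurableT a ia.
have ibb := integrableZl measurableT b ib.
have iab := integrableZl measurableT b ia.
have iba := integrableZl measurableT a ib.
have ER : \int[mu]_u (kerR a b (r * u) * q u) =
    \int[mu]_u q u - (a * \int[mu]_u (ka u * q u) + b * \int[mu]_u (kb u * q u)).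
  rewrite -RintegralZl// -RintegralZl// -RintegralD//.
  rewrite -RintegralB//; last exact: (integrableD measurableT iaa ibb).
  apply: eq_Rintegral => u _; rewrite /kerR /ka /kb; field.
  by have := den u; rewrite gt_eqF.
have EI : \int[mu]_u (kerI a b (r * u) * q u) =
    a * \int[mu]_u (kb u * q u) - b * \int[mu]_u (ka u * q u).
  rewrite -RintegralZl// -RintegralZl// -RintegralB//.
  apply: eq_Rintegral => u _; rewrite /kerI /ka /kb; field.
  by have := den u; rewrite gt_eqF.
congr (_ + _); rewrite ER EI; apply/eqP; rewrite eq_complex/=.
by apply/andP; split; apply/eqP; ring.
Qed.

Lemma dispersion_axisE (b : R) : dispersion (0 +i* b) =
  (r ^+ 2 - b ^+ 2 - b * cauchyI q r 0 b) +i* (b * (pi / r * q (b / r))).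
Proof.
rewrite /dispersion/= (cauchyR_axis qP); apply/eqP; rewrite eq_complex/=.
by apply/andP; split; apply/eqP; ring.
Qed.

(** When the density vanishes beyond b / r, the two translated densities live on
    either side of the origin, where the kernel 1 / y is at least 1 / (2 b) in
    absolute value. *)
Lemma cauchyI_axis_lt0 (b : R) : 0 < b -> (forall u : R, b / r <= `|u| -> q u = 0) ->
  cauchyI q r 0 b < 0.
Proof.
move=> b0 qb; rewrite /cauchyI mulNr oppr_lt0 mulr_gt0 ?invr_gt0 ?mulr_gt0//.
have q0 (y : R) : b <= `|y| -> q (y / r) = 0.
  by move=> h; apply: qb; rewrite normrM normfV (gtr0_norm r_gt0) ler_pM2r ?invr_gt0.
pose f (s y : R) := q (s * r^-1 * y + - b / r).
have ri (s : R) : `|s| = 1 -> s * r^-1 != 0.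
  by move=> s1; rewrite mulf_neq0 ?invr_eq0 ?(gt_eqF r_gt0)// -normr_eq0 s1.
have E (s : R) : `|s| = 1 -> \int[mu]_y f s y = r * \int[mu]_u q u.
  move=> s1; rewrite (Rintegral_affine (- b / r) (ri _ s1) (density_measurable qP)).
  by rewrite normrM s1 mul1r normfV invrK gtr0_norm.
have I (s : R) : `|s| = 1 -> mu.-integrable setT (EFin \o f s).
  move=> s1; apply: (@integrable_bounded_support _ _ (r + `|b|) B).
  - apply: (measurableT_comp (density_measurable qP)); apply: measurable_funD => //.
  - by move=> u _; exact: (density_norm_le qP).
  - move=> u uc; rewrite /f -mulrAC -mulrDl; apply: (density_out qP).
    rewrite normrM normfV (gtr0_norm r_gt0) ler_pdivlMr// mul1r.
    have := ler_dist_dist (s * u) b; rewrite normrM s1 mul1r.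
    have := ler_norm (`|u| - `|b|); lra.
have I1 := I _ (normr1 R); have I2 := I _ (normrN1 R).
have I12 := integrableZl measurableT (2 * b)^-1 (integrableD measurableT I1 I2).
have I0 := integrable_cauchyI qP r_gt0 0 b.
have le (y : R) : (2 * b)^-1 * (f 1 y + f (- 1) y) <=
    (q ((y - b) / r) - q ((- y - b) / r)) * (y / (0 ^+ 2 + y ^+ 2)).
  have -> : f 1 y = q ((y - b) / r) by congr q; field; rewrite gt_eqF.
  have -> : f (- 1) y = q ((- y - b) / r) by congr q; field; rewrite gt_eqF.
  have h (x : R) : 0 < x -> (2 * b)^-1 * q ((x - b) / r) <= x^-1 * q ((x - b) / r).
    move=> x0; have [xb|xb] := leP x (2 * b).
      by rewrite ler_wpM2r ?(density_ge0 qP)// lef_pV2 ?posrE// mulr_gt0.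
    rewrite q0 ?mulr0//; apply: le_trans (ler_norm _); lra.
  have z (x : R) : 0 <= x -> q ((- x - b) / r) = 0.
    by move=> x0; rewrite q0// -opprD normrN ger0_norm ?addr_ge0 ?(ltW b0)// lerDr.
  rewrite expr0n add0r; have [y0|y0|->] := ltgtP y 0.
  - have -> : q ((y - b) / r) = 0 by rewrite -[y]opprK z// oppr_ge0 ltW.
    rewrite add0r sub0r.
    have -> : - q ((- y - b) / r) * (y / y ^+ 2) = (- y)^-1 * q ((- y - b) / r).
      by field; rewrite lt_eqF.
    by apply: h; rewrite oppr_gt0.
  - rewrite z ?(ltW y0)// addr0 subr0.
    have -> : q ((y - b) / r) * (y / y ^+ 2) = y^-1 * q ((y - b) / r).
      by field; rewrite gt_eqF.
    exact: h.
  - have q00 := z 0 (lexx 0); rewrite oppr0 in q00 *.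
    by rewrite q00 mul0r !mulr0 addr0 mulr0.
have {}le := @le_Rintegral _ _ R mu setT _ _ measurableT I12 I0 (fun y _ => le y).
apply: lt_le_trans le.
rewrite RintegralZl//; last exact: (integrableD measurableT I1 I2).
rewrite RintegralD// !E ?normr1 ?normrN1// mulr_gt0 ?invr_gt0 ?mulr_gt0//.
by rewrite addr_gt0 ?mulr_gt0 ?(density_mass qP).
Qed.

(** The imaginary part b (pi / r) q(b / r) can only vanish where q does; then q lives
    on |u| < |b| / r and the real part r^2 - b^2 - b [cauchyI] is positive. *)
Lemma dispersion_neq0 (b : R) : `|b| <= r -> dispersion (0 +i* b) != 0.
Proof.
wlog b0 : b / 0 <= b => [wlg|].
  have [/wlg//|/ltW b0 br] := leP 0 b.
  have := wlg (- b); rewrite oppr_ge0 normrN => /(_ b0 br).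
  rewrite !dispersion_axisE !eq_complex/= (cauchyI_odd qP r_gt0) sqrrN mulrNN.
  by rewrite !mulNr (density_even qP) oppr_eq0.
rewrite ger0_norm// => br; rewrite dispersion_axisE eq_complex/=.
move: b0; rewrite le_eqVlt => /predU1P[<-|b0].
  by rewrite expr0n mul0r !subr0 expf_eq0/= gt_eqF.
apply/negP => /andP[/eqP Re0 Im0]; have qb : q (b / r) = 0.
  have pr : b * (pi / r) != 0 by rewrite gt_eqF// mulr_gt0// divr_gt0// pi_gt0.
  by apply/eqP; move: Im0; rewrite mulrA mulf_eq0 (negbTE pr).
have I0 : cauchyI q r 0 b < 0.
  apply: cauchyI_axis_lt0 => // u.
  move: br qb; rewrite le_eqVlt => /predU1P[-> _|br qb].
    by rewrite mulfV ?gt_eqF//; exact: (density_out qP).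
  apply: (density_vanish qP) => //; first by rewrite divr_ge0// ltW.
  by rewrite ltr_pdivrMr// mul1r.
have : b * cauchyI q r 0 b < 0 by rewrite pmulr_rlt0.
have : b ^+ 2 <= r ^+ 2 by rewrite ler_pXn2r// nnegrE ltW.
move: Re0; lra.
Qed.

(** Beyond |b| = r the denominator has no zero on the support of q; the terms at u
    and - u combine to a function of u^2. *)
Lemma dispersion_outside (b : R) : r < `|b| ->
  dispersion (0 +i* b) = (r ^+ 2 - b ^+ 2 + moment 0 ((r / b) ^+ 2))%:C.
Proof.
move=> rb; have b0 : b != 0 by rewrite -normr_gt0 (lt_trans r_gt0).
rewrite dispersion_axisE (density_out qP); last first.
  by rewrite normrM normfV (gtr0_norm r_gt0) ler_pdivlMr// mul1r ltW.
rewrite !mulr0; suff -> : moment 0 ((r / b) ^+ 2) = - (b * cauchyI q r 0 b) by [].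
rewrite /moment; pose s := r / b; rewrite -/s.
have s1 : `|s| < 1 by rewrite normrM normfV (gtr0_norm r_gt0) ltr_pdivrMr ?normr_gt0// mul1r.
have su (u : R) : `|u| < 1 -> 1 - `|s| <= 1 + s * u.
  move=> u1; have := ler_norm (- (s * u)); rewrite normrN normrM.
  have : `|s| * `|u| <= `|s| by rewrite ler_piMr// ltW.
  lra.
have s0 : 0 < 1 - `|s| by lra.
have sN (u : R) : `|u| < 1 -> 1 + s * u != 0 /\ 1 - s * u != 0.
  move=> u1; have := su u u1; have := su (- u); rewrite normrN mulrN => /(_ u1).
  by split; rewrite gt_eqF//; lra.
have bsE : b * s = r by rewrite /s; field.
have kE (u : R) : `|u| < 1 ->
    (b + r * u) / (0 ^+ 2 + (b + r * u) ^+ 2) = b^-1 * (1 + s * u)^-1.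
  move=> /sN[h _]; rewrite -bsE expr0n add0r; field.
  have -> : b + b * s * u = b * (1 + s * u) by ring.
  by rewrite h b0 mulf_neq0.
have mf : measurable_fun setT (fun u : R => (1 + s * u)^-1).
  by apply: (measurableT_comp (@measurable_inv R)); exact: measurable_funD.
have fM (u : R) : `|u| < 1 -> `|(1 + s * u)^-1| <= (1 - `|s|)^-1.
  move=> u1; have := su u u1 => h.
  rewrite normfV gtr0_norm; last by apply: lt_le_trans h.
  by rewrite lef_pV2 ?posrE ?(lt_le_trans s0 h).
pose f (u : R) := (1 + s * u)^-1 * q u.
have If : mu.-integrable setT (EFin \o f) := integrable_density_mul qP mf fM.
have mfN : measurable_fun setT (fun u : R => (1 - s * u)^-1).
  by apply: (measurableT_comp (@measurable_inv R)); exact: measurable_funB.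
have fNM (u : R) : `|u| < 1 -> `|(1 - s * u)^-1| <= (1 - `|s|)^-1.
  by move=> u1; have := fM (- u); rewrite normrN mulrN; apply.
have IfN := integrable_density_mul qP mfN fNM.
have n1 : - 1 != 0 :> R by rewrite oppr_eq0 oner_eq0.
have := Rintegral_affine 0 n1 (measurable_funM mf (density_measurable qP)).
rewrite normrN1 invr1 mul1r -[X in _ = X]/(\int[mu]_u f u) => flip.
have M0 (u : R) : `|u| < 1 -> `|(b + r * u) / (0 ^+ 2 + (b + r * u) ^+ 2)| <= `|b^-1| * (1 - `|s|)^-1.
  by move=> u1; rewrite kE// normrM ler_wpM2l// fM.
rewrite (cauchyIE qP r_gt0 M0) mulrN -RintegralZl//; last first.
  apply: (integrable_density_mul qP _ M0); apply: measurable_funM; first exact: m_affine.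
  exact: m_den.
have split_q (g h : R -> R) : (forall u : R, `|u| < 1 -> g u * q u = h u) ->
    (forall u : R, 1 <= `|u| -> h u = 0) -> \int[mu]_u (g u * q u) = \int[mu]_u h u.
  move=> gh h0; apply: eq_Rintegral => u _; have [u1|u1] := leP 1 `|u|.
    by rewrite (density_out qP)// h0// mulr0.
  exact: gh.
have -> : \int[mu]_u (b * ((b + r * u) / (0 ^+ 2 + (b + r * u) ^+ 2) * q u)) = \int[mu]_u f u.
  under eq_Rintegral => u _ do rewrite mulrA.
  apply: split_q => u u1; last by rewrite /f (density_out qP)// mulr0.
  by rewrite kE// mulrA mulfV// mul1r.
have -> : \int[mu]_u f u = 2^-1 * (\int[mu]_u f u + \int[mu]_u ((1 - s * u)^-1 * q u)).
  have <- : \int[mu]_u f u = \int[mu]_u ((1 - s * u)^-1 * q u).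
    rewrite -flip; apply: eq_Rintegral => u _.
    by rewrite /= mulN1r addr0 (density_even qP) mulrN.
  by field.
rewrite opprK -RintegralD// -RintegralZl//; last exact: (integrableD measurableT If IfN).
apply: split_q => u u1; last by rewrite /f (density_out qP)// !mulr0 addr0 mulr0.
have [h1 h2] := sN u u1; rewrite /f expr1 /= expr0; field.
rewrite h1 h2 /=.
have -> : 1 - (s * u) ^+ 2 = (1 + s * u) * (1 - s * u) by ring.
by rewrite mulf_neq0.
Qed.

End dispersion.

(** * Moments of the density *)

(** The properties of the integrals of u^(2n) q / (1 - w u^2)^(n+1) that determine
    the shape of the zeros. *)
Record moments (R : realType) (G : nat -> R -> R) (m M : R) : Prop := Moments {
  moments_derive : forall n (w : R), w < 1 -> is_derive w 1 (G n) (n.+1%:R * G n.+1 w);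
  moments_ge0 : forall n (w : R), w < 1 -> 0 <= G n w;
  moments_mono : forall w w' : R, w <= w' -> w' < 1 -> G 0%N w <= G 0%N w';
  moments_mass : 0 < m;
  moments_ge : forall w : R, 0 <= w -> w < 1 -> m <= G 0%N w;
  moments_le0 : forall w : R, 0 <= w -> w < 1 -> G 0%N w <= M;
  moments_le1 : forall w : R, 0 <= w -> w < 1 -> G 1%N w <= M;
  moments_le2 : forall w : R, 0 <= w -> w < 1 -> (1 - w) * G 2%N w <= M;
  moments_CS : forall w : R, 0 <= w -> w < 1 -> G 1%N w ^+ 2 <= G 0%N w * G 2%N w
}.

Section moments.
Context {R : realType}.
Notation mu := (@lebesgue_measure R).
Variables (q : R -> R) (B L : R).
Hypothesis qP : density q B L.

Let ker (n : nat) (w u : R) : R := u ^+ n.*2 / (1 - w * u ^+ 2) ^+ n.+1.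

Let low (w : R) : R := Num.min 1 (1 - w).

Let low_gt0 (w : R) : w < 1 -> 0 < low w.
Proof. by move=> w1; rewrite lt_min ltr01 subr_gt0. Qed.

Let sq1 (u : R) : `|u| < 1 -> u ^+ 2 < 1.
Proof. by move=> u1; rewrite -(real_normK (num_real u)) expr_lt1. Qed.

Let den_ge (w u : R) : `|u| < 1 -> low w <= 1 - w * u ^+ 2.
Proof.
move=> /sq1 u1; have u0 := sqr_ge0 u; rewrite /low ge_min.
have [w0|w0] := leP w 0; apply/orP; [left|right]; nra.
Qed.

Let den_gt0 (w u : R) : w < 1 -> `|u| < 1 -> 0 < 1 - w * u ^+ 2.
Proof. by move=> w1 u1; apply: lt_le_trans (den_ge w u1); exact: low_gt0. Qed.

Let m_ker n w : measurable_fun setT (ker n w).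
Proof.
apply: measurable_funM; first exact: measurable_funX.
apply: (measurableT_comp (@measurable_inv R)); apply: measurable_funX.
by apply: measurable_funB => //; apply: measurable_funM => //; exact: measurable_funX.
Qed.

Let ker_ge0 n (w u : R) : w < 1 -> `|u| < 1 -> 0 <= ker n w u.
Proof.
move=> w1 u1; rewrite divr_ge0//; last by rewrite exprn_ge0// ltW// den_gt0.
by rewrite -mul2n exprM exprn_ge0// sqr_ge0.
Qed.

Let ker_le n (w w1 u : R) : w <= w1 -> w1 < 1 -> `|u| < 1 ->
  `|ker n w u| <= (low w1) ^- n.+1.
Proof.
move=> ww1 w11 u1; have w1' := le_lt_trans ww1 w11.
rewrite ger0_norm ?ker_ge0// /ker ler_pdivrMr ?exprn_gt0 ?den_gt0//.
rewrite mulrC ler_pdivlMr ?exprn_gt0 ?low_gt0//.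
rewrite -mul2n exprM; apply: (@le_trans _ _ (1 * low w1 ^+ n.+1)).
  rewrite ler_wpM2r ?exprn_ge0 ?(ltW (low_gt0 w11))//.
  by rewrite exprn_ile1 ?sqr_ge0// ltW// sq1.
rewrite mul1r ler_pXn2r// ?nnegrE ?(ltW (low_gt0 w11)) ?(ltW (den_gt0 w1' u1))//.
apply: le_trans (den_ge w u1); rewrite /low le_min !ge_min lexx/=.
by rewrite lerD2l lerN2 ww1 orbT.
Qed.

Lemma integrable_moment n (w : R) : w < 1 ->
  mu.-integrable setT (EFin \o (fun u : R => u ^+ n.*2 / (1 - w * u ^+ 2) ^+ n.+1 * q u)).
Proof.
move=> w1; apply: (integrable_density_mul qP (m_ker n w) (M := (low w) ^- n.+1)) => u u1.
exact: ker_le.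
Qed.

Lemma moment_ge0 n (w : R) : w < 1 -> 0 <= moment q n w.
Proof.
move=> w1; apply: Rintegral_ge0 => // u _; have [u1|u1] := leP 1 `|u|.
  by rewrite (density_out qP)// mulr0.
by apply: mulr_ge0; [exact: ker_ge0|exact: (density_ge0 qP)].
Qed.

Let ker_derive n (w u : R) : 1 - w * u ^+ 2 != 0 ->
  is_derive w 1 (fun w => ker n w u * q u) (n.+1%:R * ker n.+1 w u * q u).
Proof.
move=> d0; pose g (w : R) := 1 - w * u ^+ 2.
have dg : is_derive w 1 g (- u ^+ 2).
  apply: is_derive_eq; by rewrite /GRing.scale/=; ring.
have dgV : is_derive w 1 (fun w => (g w)^-1) (- (g w) ^- 2 *: (- u ^+ 2)).
  exact: is_deriveV.
have dX := is_deriveX n dgV.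
have -> : (fun w => ker n w u * q u) =
    (fun w => (u ^+ n.*2 * q u) *: ((fun w => (g w)^-1) ^+ n.+1) w).
  by apply/funext => w'; rewrite /ker /GRing.scale/= fctE exprVn; ring.
apply: is_derive_eq.
rewrite /GRing.scale/= exprVn /ker -/(g w) doubleS !exprS.
by field; rewrite expf_neq0// d0.
Qed.

Lemma is_derive_moment n (w : R) : w < 1 ->
  is_derive w 1 (moment q n) (n.+1%:R * moment q n.+1 w).
Proof.
move=> w1; pose d := (1 - w) / 2; have d0 : 0 < d by rewrite divr_gt0// subr_gt0.
pose f (w u : R) := ker n w u * q u; pose w2 := w + d.
have w21 : w2 < 1 by rewrite /w2 /d; lra.
pose G (u : R) := n.+1%:R * (low w2) ^- n.+2 * q u.
have df (x u : R) : x < 1 -> is_derive x 1 (f ^~ u) (n.+1%:R * ker n.+1 x u * q u).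
  move=> x1; have [u1|u1] := leP 1 `|u|.
    have q0 := density_out qP u1; rewrite q0 mulr0.
    have -> : f ^~ u = cst 0 by apply/funext => x'; rewrite /f q0 mulr0.
    exact: is_derive_cst.
  by apply: ker_derive; rewrite gt_eqF// den_gt0.
have inI (x : R) : `](w - d), (w + d)[%classic x -> x <= w2 /\ x < 1.
  by rewrite /= in_itv/= => /andP[_ h]; split; [exact: ltW|exact: lt_trans w21].
have Iw : `](w - d), (w + d)[%classic w by rewrite /= in_itv/=; apply/andP; split; lra.
have If (x : R) : `](w - d), (w + d)[%classic x -> mu.-integrable setT (EFin \o f x).
  by move=> /inI[_ x1]; exact: integrable_moment.
have derf (x u : R) : `](w - d), (w + d)[%classic x -> setT u -> derivable (f ^~ u) x 1.
  by move=> /inI[_ x1] _; have [] := df x u x1.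
have G0 (u : R) : 0 <= G u.
  by rewrite !mulr_ge0 ?(density_ge0 qP)// invr_ge0 exprn_ge0// ltW// low_gt0.
have iG : mu.-integrable setT (EFin \o G).
  exact: (integrableZl measurableT _ (integrable_density qP)).
have Gub (x u : R) : `](w - d), (w + d)[%classic x -> setT u ->
    `|partial1of2 f x u| <= G u.
  move=> /inI[x2 x1] _; have [_ ] := df x u x1; rewrite partial1of2E => ->.
  have [u1|u1] := leP 1 `|u|; first by rewrite (density_out qP)// mulr0 normr0.
  rewrite normrM (ger0_norm (density_ge0 qP u)) ler_wpM2r ?(density_ge0 qP)//.
  by rewrite normrM (ger0_norm (ler0n _ _)) ler_wpM2l//; exact: (ker_le _ x2).
have h1 := @derivable_under_integral _ _ _ mu f setT measurableT w _ _ Iw If derf G G0 iG Gub.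
have h2 := @differentiation_under_integral _ _ _ mu f setT measurableT w _ _ Iw If derf G G0 iG Gub.
apply: DeriveDef => //; rewrite -derive1E [LHS]h2.
rewrite -RintegralZl//; last exact: integrable_moment.
apply: eq_Rintegral => u _; rewrite partial1of2E.
by have [_ ->] := df w u w1; rewrite mulrA.
Qed.

Lemma moment0_mono (w w' : R) : w <= w' -> w' < 1 -> moment q 0 w <= moment q 0 w'.
Proof.
move=> ww' w'1; have w1 := le_lt_trans ww' w'1.
apply: le_Rintegral => //; [exact: integrable_moment..|].
move=> u _; have [u1|u1] := leP 1 `|u|; first by rewrite (density_out qP)// !mulr0.
rewrite ler_wpM2r ?(density_ge0 qP)// !expr1 !expr0 !mul1r lef_pV2 ?posrE ?den_gt0//.
by rewrite lerD2l lerN2 ler_wpM2r// sqr_ge0.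
Qed.

Lemma moment0_ge (w : R) : 0 <= w -> w < 1 -> \int[mu]_u q u <= moment q 0 w.
Proof.
move=> w0 w1; have -> : \int[mu]_u q u = moment q 0 0; last exact: moment0_mono.
by apply: eq_Rintegral => u _; rewrite mul0r subr0 expr0 expr1 invr1 !mul1r.
Qed.

(** The bound q <= B (1 - u^2)^2 absorbs two of the powers of 1 - w u^2 in the
    denominators, uniformly up to w = 1. *)
Lemma moment_bound (c : R) n (w : R) : w < 1 ->
  (forall u : R, `|u| < 1 -> 0 < 1 - w * u ^+ 2 -> u ^+ 2 < 1 ->
     q u <= B * (1 - w * u ^+ 2) ^+ 2 -> c * (ker n w u * q u) <= B) ->
  c * moment q n w <= \int[mu]_u (B * \1_(`[(- 1)%R, 1%R]%classic) u).
Proof.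
move=> w1 H; rewrite -RintegralZl//; last exact: integrable_moment.
apply: le_Rintegral => //.
- exact: (integrableZl measurableT c (integrable_moment n w1)).
- exact: (integrableZl measurableT B (@integrable_indic_itv R (- 1) 1 true false)).
move=> u _; have [u1|u1] := leP 1 `|u|.
  by rewrite (density_out qP)// !mulr0 mulr_ge0// (density_bound_ge0 qP).
rewrite indicE mem_set ?mulr1; last by rewrite /= in_itv/= -ler_norml ltW.
apply: H => //; [exact: den_gt0|exact: sq1|].
have u2 := sq1 u1; apply: le_trans (density_le qP u) _.
rewrite max_l ?subr_ge0 ?(ltW u2)// ler_wpM2l ?(density_bound_ge0 qP)//.
rewrite ler_pXn2r// ?nnegrE ?(ltW (den_gt0 w1 u1)) ?subr_ge0 ?(ltW u2)//.
by rewrite lerD2l lerN2 ler_piMl// ?sqr_ge0// ltW.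
Qed.

(** Cauchy-Schwarz, read off the square of t - u^2 / (1 - w u^2) integrated
    against q / (1 - w u^2), at the best t. *)
Lemma moment_cauchy_schwarz (w : R) : w < 1 -> 0 < moment q 0 w ->
  moment q 1 w ^+ 2 <= moment q 0 w * moment q 2 w.
Proof.
move=> w1 G0; pose t := moment q 1 w / moment q 0 w.
have I n := integrable_moment n w1.
have I0 := integrableZl measurableT (t ^+ 2) (I 0).
have I1 := integrableZl measurableT (2 * t) (I 1%N).
have I01 := integrableB measurableT I0 I1.
have : 0 <= t ^+ 2 * moment q 0 w - 2 * t * moment q 1 w + moment q 2 w.
  rewrite /moment -RintegralZl// -RintegralZl// -RintegralB// -RintegralD//.
  apply: Rintegral_ge0 => // u _; have [u1|u1] := leP 1 `|u|.
    by rewrite (density_out qP)// !mulr0 subrr addr0.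
  have d0 := den_gt0 w1 u1.
  have -> : forall x : R, t ^+ 2 * (u ^+ 0.*2 / (1 - w * u ^+ 2) ^+ 1 * x) -
    2 * t * (u ^+ 1.*2 / (1 - w * u ^+ 2) ^+ 2 * x) +
    u ^+ 2.*2 / (1 - w * u ^+ 2) ^+ 3 * x =
    (t - u ^+ 2 / (1 - w * u ^+ 2)) ^+ 2 / (1 - w * u ^+ 2) * x.
    by move=> x; rewrite /double; field; rewrite gt_eqF.
  by rewrite mulr_ge0 ?(density_ge0 qP)// divr_ge0 ?sqr_ge0// ltW.
rewrite /t; move: (moment q 0 w) (moment q 1 w) (moment q 2 w) G0 => g0 g1 g2 g00.
have -> : (g1 / g0) ^+ 2 * g0 - 2 * (g1 / g0) * g1 + g2 = (g0 * g2 - g1 ^+ 2) / g0.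
  by field; rewrite gt_eqF.
by rewrite pmulr_lge0 ?invr_gt0// subr_ge0.
Qed.

Lemma moments_density : moments (moment q) (\int[mu]_u q u)
  (\int[mu]_u (B * \1_(`[(- 1)%R, 1%R]%classic) u)).
Proof.
have B0 := density_bound_ge0 qP.
split.
- exact: is_derive_moment.
- exact: moment_ge0.
- exact: moment0_mono.
- exact: (density_mass qP).
- exact: moment0_ge.
- move=> w w0 w1; rewrite -[leLHS]mul1r; apply: moment_bound => // u u1 d0 u2 qd.
  rewrite mul1r /ker expr0 expr1 div1r ler_pdivrMl// mulrC.
  apply: le_trans qd _; rewrite expr2 mulrA ler_wpM2r ?(ltW d0)// ler_piMr//.
  by rewrite gerBl mulr_ge0// sqr_ge0.
- move=> w w0 w1; rewrite -[leLHS]mul1r; apply: moment_bound => // u u1 d0 u2 qd.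
  rewrite mul1r /ker mulrAC ler_pdivrMr ?exprn_gt0//.
  apply: le_trans qd; rewrite ler_piMl ?(density_ge0 qP)//.
  exact: ltW.
- move=> w w0 w1; apply: moment_bound => // u u1 d0 u2 qd.
  rewrite (_ : _ * _ = (1 - w) * u ^+ 4 * q u / (1 - w * u ^+ 2) ^+ 3); last first.
    by rewrite /ker /double; ring.
  rewrite ler_pdivrMr ?exprn_gt0//.
  rewrite [leRHS](_ : _ = (1 - w * u ^+ 2) * (B * (1 - w * u ^+ 2) ^+ 2)); last by ring.
  have u4 : 0 <= u ^+ 4 by rewrite (exprM u 2 2) sqr_ge0.
  have w10 : 0 <= 1 - w by rewrite subr_ge0 ltW.
  apply: ler_pM => //; [exact: mulr_ge0|exact: (density_ge0 qP)|].
  apply: (@le_trans _ _ (1 - w)).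
    by rewrite ler_piMr// (exprM u 2 2) exprn_ile1 ?sqr_ge0// ltW.
  by rewrite lerD2l lerN2 ler_piMr// ltW.
- by move=> w w0 w1; apply: moment_cauchy_schwarz => //; apply: lt_le_trans (moment0_ge w0 w1); exact: (density_mass qP).
Qed.

End moments.

(** * The curve of zeros *)
Section zero_curve.
Context {R : realType}.
Variables (G : nat -> R -> R) (m M : R).
Hypothesis GP : moments G m M.

Let m_gt0 : 0 < m := moments_mass GP.

Let G0_gt0 (w : R) : 0 <= w -> w < 1 -> 0 < G 0 w.
Proof. by move=> w0 w1; exact: lt_le_trans m_gt0 (moments_ge GP w0 w1). Qed.

(** Along the zero curve, nu^2 and r^2 are the values at w = (r / nu)^2 of
    [zero_sq] and of w * [zero_sq] w. *)
Definition zero_sq (w : R) : R := G 0 w / (1 - w).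

Lemma zero_sq_gt0 (w : R) : 0 <= w -> w < 1 -> 0 < zero_sq w.
Proof. by move=> w0 w1; rewrite divr_gt0 ?subr_gt0// G0_gt0. Qed.

Lemma zero_sq_mono (w w' : R) : 0 <= w -> w <= w' -> w' < 1 -> zero_sq w <= zero_sq w'.
Proof.
move=> w0 ww' w'1; have w1 := le_lt_trans ww' w'1.
apply: ler_pM; [exact: ltW (G0_gt0 w0 w1)|by rewrite invr_ge0 subr_ge0 ltW| |].
  exact: (moments_mono GP).
by rewrite lef_pV2 ?posrE ?subr_gt0// lerD2l lerN2.
Qed.

Lemma wave_sq_inj (w w' : R) : 0 <= w -> w < 1 -> 0 <= w' -> w' < 1 ->
  w * zero_sq w = w' * zero_sq w' -> w = w'.
Proof.
wlog: w w' / w <= w' => [wlg w0 w1 w'0 w'1 E|].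
  have [h|/ltW h] := leP w w'; first exact: wlg.
  by apply/esym/wlg.
rewrite le_eqVlt => /predU1P[//|ww'] w0 w1 w'0 w'1 E; exfalso.
have : w * zero_sq w < w' * zero_sq w'.
  apply: (@lt_le_trans _ _ (w' * zero_sq w)); first by rewrite ltr_pM2r// zero_sq_gt0.
  by rewrite ler_wpM2l// zero_sq_mono// ltW.
by rewrite E ltxx.
Qed.

Lemma is_derive_zero_sq (w : R) : w < 1 ->
  is_derive w 1 zero_sq ((G 1 w * (1 - w) + G 0 w) / (1 - w) ^+ 2).
Proof.
move=> w1; have d0 : 1 - w != 0 by rewrite gt_eqF// subr_gt0.
have dG := moments_derive GP 0 w1.
have dg : is_derive w 1 (fun w : R => 1 - w) (- 1).
  have -> : -1 = 0 - 1 :> R by rewrite sub0r.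
  exact: is_deriveB.
have dV : is_derive w 1 (fun w : R => (1 - w)^-1) (- (1 - w) ^- 2 *: - 1).
  exact: is_deriveV.
have -> : zero_sq = (G 0 * (fun w : R => (1 - w)^-1))%R by [].
apply: is_derive_eq; rewrite /GRing.scale/=; by field.
Qed.

Lemma zero_sq_cvg (w : R) : w < 1 -> zero_sq x @[x --> w] --> zero_sq w.
Proof.
move=> /is_derive_zero_sq[d _].
by apply: differentiable_continuous; exact/derivable1_diffP.
Qed.

(** Since G_0(w) >= G_0(0), at w = s / (1 + s) with s = t / G_0(0) the left-hand side
    already exceeds t. *)
Lemma wave_sq_surj (t : R) : 0 <= t ->
  exists2 w : R, 0 <= w < 1 & w * zero_sq w = t.
Proof.
move=> t0; have g0 : 0 < G 0 0 by exact: G0_gt0.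
pose s := t / G 0 0; have s0 : 0 <= s by rewrite divr_ge0// ltW.
pose b := s / (1 + s); have s1 : 0 < 1 + s by rewrite ltr_pwDl.
have b0 : 0 <= b by rewrite divr_ge0// ltW.
have b1 : b < 1 by rewrite ltr_pdivrMr// mul1r ltrDr.
have [||c] := @IVT R (fun w => w * zero_sq w) 0 b t b0.
- apply: continuous_in_subspaceT => x; rewrite inE/= in_itv/= => /andP[_ xb].
  by apply: cvgM; [exact: cvg_id|exact: zero_sq_cvg (le_lt_trans xb b1)].
- have tb : t <= b * zero_sq b.
    apply: (@le_trans _ _ (b * (G 0 0 / (1 - b)))).
      rewrite le_eqVlt; apply/orP; left; apply/eqP; rewrite /b /s; field.
      by rewrite !gt_eqF// ltr_pwDl.
    rewrite ler_wpM2l// ler_pM2r ?invr_gt0 ?subr_gt0//; exact: (moments_mono GP).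
  by rewrite mul0r ge_min t0 le_max tb orbT.
- rewrite in_itv/= => /andP[c0 cb] E; exists c => //.
  by rewrite c0 (le_lt_trans cb b1).
Qed.

(** The wave number as a function of the signed slope y = r / nu(r), in which the
    parametrization is smooth also at r = 0. *)
Definition wave (y : R) : R := y * Num.sqrt (zero_sq (y ^+ 2)).

Let sq_lt1 (y : R) : `|y| < 1 -> 0 <= y ^+ 2 /\ y ^+ 2 < 1.
Proof. by move=> y1; rewrite sqr_ge0 -(real_normK (num_real y)) expr_lt1. Qed.

Lemma wave_surj (r : R) : exists2 y : R, `|y| < 1 & wave y = r.
Proof.
have [w /andP[w0 w1] E] := wave_sq_surj (sqr_ge0 r).
exists (Num.sg r * Num.sqrt w).
  rewrite normrM [X in _ * X]ger0_norm ?sqrtr_ge0//.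
  apply: (@le_lt_trans _ _ (Num.sqrt w)); last by rewrite -sqrtr1 ltr_sqrt.
  by rewrite ler_piMl ?sqrtr_ge0// normr_sg; case: (r != 0).
have [->|r0] := eqVneq r 0; first by rewrite /wave sgr0 !mul0r.
rewrite /wave exprMn sqr_sg r0 mul1r sqr_sqrtr// -mulrA -sqrtrM// E sqrtr_sqr.
by rewrite -numEsg.
Qed.

Lemma wave_inj (y y' : R) : `|y| < 1 -> `|y'| < 1 -> wave y = wave y' -> y = y'.
Proof.
move=> /sq_lt1[y0 y1] /sq_lt1[y'0 y'1] E.
have E2 : y ^+ 2 = y' ^+ 2.
  apply: wave_sq_inj => //; rewrite -[zero_sq (y ^+ 2)]sqr_sqrtr; last first.
    by rewrite ltW// zero_sq_gt0.
  rewrite -exprMn [_ * _]E exprMn sqr_sqrtr// ltW// zero_sq_gt0//.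
move: E; rewrite /wave E2 => /mulIf; apply.
by rewrite gt_eqF// sqrtr_gt0 zero_sq_gt0.
Qed.

Lemma is_derive_wave (y : R) : `|y| < 1 -> let w := y ^+ 2 in
  is_derive y 1 wave ((G 0 w + w * (1 - w) * G 1 w) /
    (1 - w) ^+ 2 / Num.sqrt (zero_sq w)).
Proof.
move=> /sq_lt1[w0 w1] w; have z0 := zero_sq_gt0 w0 w1.
have dS := is_derive1_sqrt z0.
have dZ := is_derive_zero_sq w1.
have d2 : is_derive y 1 (fun y : R => y ^+ 2) (2 * y).
  by apply: is_derive_eq; rewrite /GRing.scale/=; ring.
have dZ2 := @is_derive1_comp R zero_sq (fun y : R => y ^+ 2) y _ _ dZ d2.
have dSZ := @is_derive1_comp R Num.sqrt (zero_sq \o (fun y : R => y ^+ 2)) y _ _ dS dZ2.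
have -> : wave = (id * (Num.sqrt \o (zero_sq \o (fun y : R => y ^+ 2))))%R by [].
apply: is_derive_eq; rewrite /GRing.scale/=.
have s0 : 0 < Num.sqrt (zero_sq w) by rewrite sqrtr_gt0.
have zE : G 0 w = Num.sqrt (zero_sq w) ^+ 2 * (1 - w).
  by rewrite sqr_sqrtr ?ltW// /zero_sq mulfVK// gt_eqF// subr_gt0.
rewrite -/w zE; move: (Num.sqrt _) s0 => s s0; rewrite /w; field.
by rewrite !gt_eqF// subr_gt0.
Qed.

End zero_curve.

(** * The zero as a function of the wave number *)
Section zero_function.
Context {R : realType}.
Variables (G : nat -> R -> R) (m M : R).
Hypothesis GP : moments G m M.
Variable Y : R -> R.
Hypotheses (Y_lt1 : forall r, `|Y r| < 1) (YK : forall r, wave G (Y r) = r).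

Definition zero_fun (r : R) : R := Num.sqrt (zero_sq G (Y r ^+ 2)).

Local Notation nu := zero_fun.

Let Ysq (r : R) : 0 <= Y r ^+ 2 /\ Y r ^+ 2 < 1.
Proof. by rewrite sqr_ge0 -(real_normK (num_real (Y r))) expr_lt1. Qed.

Let z0 r : 0 < zero_sq G (Y r ^+ 2).
Proof. by have [h1 h2] := Ysq r; exact: (zero_sq_gt0 GP). Qed.

Lemma zero_fun_gt0 (r : R) : 0 < nu r. Proof. by rewrite sqrtr_gt0. Qed.

Lemma zero_fun_slope (r : R) : Y r * nu r = r. Proof. exact: YK. Qed.

Lemma zero_fun_sq (r : R) : nu r ^+ 2 = G 0 (Y r ^+ 2) / (1 - Y r ^+ 2).
Proof. by rewrite sqr_sqrtr// ltW. Qed.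

Lemma zero_fun_sqE (r : R) : nu r ^+ 2 = r ^+ 2 + G 0 (Y r ^+ 2).
Proof.
rewrite -[in X in _ = X + _](zero_fun_slope r) exprMn.
have [_ w1] := Ysq r.
have -> : G 0 (Y r ^+ 2) = (1 - Y r ^+ 2) * nu r ^+ 2.
  by rewrite zero_fun_sq mulrC mulfVK// gt_eqF// subr_gt0.
by ring.
Qed.

Lemma zero_fun_gt (r : R) : 0 <= r -> r < nu r.
Proof.
move=> r0; rewrite -(@ltr_pXn2r _ 2)// ?nnegrE ?(ltW (zero_fun_gt0 r))//.
have [w0 w1] := Ysq r.
by rewrite zero_fun_sqE ltrDl (lt_le_trans (moments_mass GP))// (moments_ge GP).
Qed.

(** In terms of w = (r / b)^2, the equation says b^2 = [zero_sq] w, and then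
    r^2 = w [zero_sq] w determines w. *)
Lemma zero_fun_unique (r b : R) : r ^+ 2 < b ^+ 2 ->
  b ^+ 2 = r ^+ 2 + G 0 ((r / b) ^+ 2) <-> b ^+ 2 = nu r ^+ 2.
Proof.
move=> rb; have b2 : 0 < b ^+ 2 by rewrite (le_lt_trans _ rb) ?sqr_ge0.
have b0 : b != 0 by move: b2; rewrite exprn_even_gt0.
have w0 : 0 <= (r / b) ^+ 2 := sqr_ge0 _.
have w1 : (r / b) ^+ 2 < 1 by rewrite expr_div_n ltr_pdivrMr// mul1r.
have rw : (r / b) ^+ 2 * b ^+ 2 = r ^+ 2 by rewrite -exprMn mulfVK.
have [Y0 Y1] := Ysq r.
split=> E.
  have bz : b ^+ 2 = zero_sq G ((r / b) ^+ 2).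
    apply: (mulIf (x := 1 - (r / b) ^+ 2)); first by rewrite gt_eqF// subr_gt0.
    rewrite mulfVK ?gt_eqF ?subr_gt0// mulrBr mulr1 [_ ^+ 2 * (r / b) ^+ 2]mulrC rw.
    by rewrite E addrAC subrr add0r.
  suff wY : (r / b) ^+ 2 = Y r ^+ 2 by rewrite /zero_fun -wY sqr_sqrtr -?bz// ltW.
  apply: (wave_sq_inj GP) => //; rewrite -bz rw.
  by rewrite -[in LHS](zero_fun_slope r) exprMn zero_fun_sq.
have -> : (r / b) ^+ 2 = Y r ^+ 2.
  have h : Y r ^+ 2 * nu r ^+ 2 = r ^+ 2 by rewrite -exprMn zero_fun_slope.
  by rewrite expr_div_n E -h mulfK// gt_eqF// exprn_gt0// zero_fun_gt0.
by rewrite E zero_fun_sqE.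
Qed.

(** Up to the factor nu (1 - w)^2, the derivative of the slope in r. *)
Definition inv_slope (r : R) : R :=
  (G 0 (Y r ^+ 2) + Y r ^+ 2 * (1 - Y r ^+ 2) * G 1 (Y r ^+ 2))^-1.

Local Notation D := inv_slope.

Lemma inv_slope_gt0 (r : R) : 0 < D r.
Proof.
have [w0 w1] := Ysq r; rewrite invr_gt0 ltr_pwDl//.
  exact: lt_le_trans (moments_mass GP) (moments_ge GP w0 w1).
apply: mulr_ge0; last exact: (moments_ge0 GP).
by rewrite mulr_ge0// subr_ge0 ltW.
Qed.

(** The slope is the inverse of [wave], whose derivative is positive. *)
Lemma is_derive_slope (r : R) : is_derive r 1 Y (nu r * (1 - Y r ^+ 2) ^+ 2 * D r).
Proof.
have [w0 w1] := Ysq r.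
have dW := is_derive_wave GP (Y_lt1 r).
have Yball : \forall y \near Y r, `|y| < 1.
  have c : (fun y : R => `|y|) @ Y r --> `|Y r| by exact: norm_continuous.
  exact: (cvgr_lt _ c _ (Y_lt1 r)).
rewrite -{1}(YK r).
have -> : nu r * (1 - Y r ^+ 2) ^+ 2 * D r =
    ((G 0 (Y r ^+ 2) + Y r ^+ 2 * (1 - Y r ^+ 2) * G 1 (Y r ^+ 2)) /
    (1 - Y r ^+ 2) ^+ 2 / Num.sqrt (zero_sq G (Y r ^+ 2)))^-1.
  by rewrite -/(nu r) -[X in X / _ / _]invrK -/(D r) !invfM !invrK; ring.
apply: is_derive_inverse => //.
- apply: filterS Yball => y y1; apply: (wave_inj GP) => //; exact: YK.
- apply: filterS Yball => y y1; have [d _] := is_derive_wave GP y1.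
  by apply: differentiable_continuous; exact/derivable1_diffP.
- rewrite !mulf_neq0 ?invr_eq0//.
  + by rewrite -invr_eq0 gt_eqF// inv_slope_gt0.
  + by rewrite expf_neq0// gt_eqF// subr_gt0.
  + by rewrite gt_eqF// zero_fun_gt0.
Qed.

Lemma is_derive_slope_sq (r : R) : is_derive r 1 (fun r : R => Y r ^+ 2)
  (2 * Y r * (nu r * (1 - Y r ^+ 2) ^+ 2 * D r)).
Proof.
have dY := is_derive_slope r.
have -> : (fun r : R => Y r ^+ 2) = (Y * Y)%R by apply/funext => x; rewrite expr2.
apply: is_derive_eq; rewrite /GRing.scale/=; ring.
Qed.

Lemma is_derive_moment_slope n (r : R) : is_derive r 1 (fun r : R => G n (Y r ^+ 2))
  (n.+1%:R * G n.+1 (Y r ^+ 2) * (2 * Y r * (nu r * (1 - Y r ^+ 2) ^+ 2 * D r))).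
Proof.
have [w0 w1] := Ysq r.
exact: (@is_derive1_comp R (G n) (fun r : R => Y r ^+ 2) r _ _
  (moments_derive GP n w1) (is_derive_slope_sq r)).
Qed.

Lemma is_derive_zero_fun (r : R) : is_derive r 1 nu
  (Y r * ((1 - Y r ^+ 2) * G 1 (Y r ^+ 2) + G 0 (Y r ^+ 2)) * D r).
Proof.
have [w0 w1] := Ysq r.
have dZ := @is_derive1_comp R (zero_sq G) (fun r : R => Y r ^+ 2) r _ _
  (is_derive_zero_sq GP w1) (is_derive_slope_sq r).
have dS := is_derive1_sqrt (z0 r).
have := @is_derive1_comp R Num.sqrt (zero_sq G \o (fun r : R => Y r ^+ 2)) r _ _ dS dZ.
rewrite -/(nu r) => h; apply: (is_derive_eq h); have v0 := zero_fun_gt0 r.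
by field; rewrite !gt_eqF// subr_gt0.
Qed.

Lemma is_derive_inv_slope (r : R) : is_derive r 1 D
  (- D r ^+ 2 * (4 * Y r * (nu r * (1 - Y r ^+ 2) ^+ 2 * D r) *
   ((1 - Y r ^+ 2) * (G 1 (Y r ^+ 2) + Y r ^+ 2 * G 2 (Y r ^+ 2))))).
Proof.
have dw := is_derive_slope_sq r.
have dG0 := is_derive_moment_slope 0 r.
have dG1 := is_derive_moment_slope 1 r.
have c1 : is_derive r 1 (cst (1 : R)) 0 by exact: is_derive_cst.
have dQ := is_deriveD dG0 (is_deriveM (is_deriveM dw (is_deriveB c1 dw)) dG1).
have q0 : G 0 (Y r ^+ 2) + Y r ^+ 2 * (1 - Y r ^+ 2) * G 1 (Y r ^+ 2) != 0.
  by rewrite -invr_eq0 gt_eqF// inv_slope_gt0.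
pose Q (r : R) : R := G 0 (Y r ^+ 2) + Y r ^+ 2 * (1 - Y r ^+ 2) * G 1 (Y r ^+ 2).
have h := @is_deriveV R Q r _ 1 q0 dQ.
apply: (is_derive_eq h); rewrite /GRing.scale/= -exprVn -/(D r) /cst/= !fctE; ring.
Qed.

End zero_function.

(** * Regularity and bounds *)
Section smoothness.
Context {R : realType}.
Variables (G : nat -> R -> R) (m M : R).
Hypothesis GP : moments G m M.
Variable Y : R -> R.
Hypotheses (Y_lt1 : forall r, `|Y r| < 1) (YK : forall r, wave G (Y r) = r).

Local Notation nu := (zero_fun G Y).
Local Notation D := (inv_slope G Y).

(** Expressions in the slope, nu, D and the moments along the curve.  Derivatives of
    such expressions are of the same form, which gives all derivatives of nu at
    once. *)
Inductive zexpr :=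
  | Zcst of R | Zslope | Zfun | Zinv | Zmoment of nat
  | Zadd of zexpr & zexpr | Zmul of zexpr & zexpr.

Fixpoint zeval (e : zexpr) (r : R) : R :=
  match e with
  | Zcst c => c
  | Zslope => Y r
  | Zfun => nu r
  | Zinv => D r
  | Zmoment n => G n (Y r ^+ 2)
  | Zadd e1 e2 => zeval e1 r + zeval e2 r
  | Zmul e1 e2 => zeval e1 r * zeval e2 r
  end.

Let Zw := Zmul Zslope Zslope.
Let Za := Zadd (Zcst 1) (Zmul (Zcst (- 1)) Zw).
Let Zdslope := Zmul Zfun (Zmul (Zmul Za Za) Zinv).

Fixpoint zderive (e : zexpr) : zexpr :=
  match e with
  | Zcst _ => Zcst 0
  | Zslope => Zdslope
  | Zfun => Zmul Zslope (Zmul (Zadd (Zmul Za (Zmoment 1)) (Zmoment 0)) Zinv)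
  | Zinv => Zmul (Zmul (Zcst (- 4)) (Zmul Zinv Zinv))
      (Zmul (Zmul Zslope Zdslope)
        (Zmul Za (Zadd (Zmoment 1) (Zmul Zw (Zmoment 2)))))
  | Zmoment n => Zmul (Zmul (Zcst n.+1%:R) (Zmoment n.+1))
      (Zmul (Zcst 2) (Zmul Zslope Zdslope))
  | Zadd e1 e2 => Zadd (zderive e1) (zderive e2)
  | Zmul e1 e2 => Zadd (Zmul (zderive e1) e2) (Zmul e1 (zderive e2))
  end.

Lemma is_derive_zeval (e : zexpr) (r : R) :
  is_derive r 1 (zeval e) (zeval (zderive e) r).
Proof.
elim: e => [c||||n|e1 h1 e2 h2|e1 h1 e2 h2] /=.
- exact: is_derive_cst.
- apply: (is_derive_eq (is_derive_slope GP Y_lt1 YK r)); ring.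
- apply: (is_derive_eq (is_derive_zero_fun GP Y_lt1 YK r)); ring.
- apply: (is_derive_eq (is_derive_inv_slope GP Y_lt1 YK r)); ring.
- apply: (is_derive_eq (is_derive_moment_slope GP Y_lt1 YK n r)); ring.
- exact: is_deriveD.
- apply: (is_derive_eq (is_deriveM h1 h2)); rewrite /GRing.scale/=; ring.
Qed.

Lemma derive1n_zeval (e : zexpr) (n : nat) :
  derive1n n (zeval e) = zeval (iter n zderive e).
Proof.
elim: n => [|n IH]; first by [].
rewrite derive1nS IH; apply/funext => r; rewrite derive1E /=.
by have [_ ->] := is_derive_zeval (iter n zderive e) r.
Qed.

Lemma class_C_zeval (e : zexpr) (n : nat) : class_C n (zeval e).
Proof.
split=> [j r _|r]; rewrite derive1n_zeval.
  by have [] := is_derive_zeval (iter j zderive e) r.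
have [d _] := is_derive_zeval (iter n zderive e) r.
by apply: differentiable_continuous; exact/derivable1_diffP.
Qed.

Lemma class_C_zero_fun (n : nat) : class_C n nu.
Proof. exact: (class_C_zeval Zfun). Qed.

Lemma derive1_zero_fun (r : R) : derive1 nu r =
  Y r * ((1 - Y r ^+ 2) * G 1 (Y r ^+ 2) + G 0 (Y r ^+ 2)) * D r.
Proof. by rewrite derive1E; have [_ ->] := is_derive_zero_fun GP Y_lt1 YK r. Qed.

(** The last summand is nonnegative by Cauchy-Schwarz; the others are products of
    nonnegative factors. *)
Lemma derive2_zero_fun (r : R) :
  let w := Y r ^+ 2 in let a := 1 - w in
  derive1n 2 nu r = nu r * a ^+ 2 * D r ^+ 3 *
    (a * G 0 w ^+ 2 + a ^+ 2 * G 0 w * G 1 w + w * (G 0 w - a * G 1 w) ^+ 2 +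
     4 * w * a ^+ 2 * (G 0 w * G 2 w - G 1 w ^+ 2)).
Proof.
have Q : (G 0 (Y r ^+ 2) + Y r ^+ 2 * (1 - Y r ^+ 2) * G 1 (Y r ^+ 2)) * D r = 1.
  rewrite mulfV// -invr_eq0 gt_eqF//; exact: (inv_slope_gt0 GP Y_lt1).
have := derive1n_zeval Zfun 2; rewrite -[zeval Zfun]/nu => ->.
move=> w a; rewrite /= -/w.
(* terms with D^2 are turned into terms with D^3 by means of 1 = (G_0 + w a G_1) D *)
have -> : nu r * a ^+ 2 * D r ^+ 3 *
    (a * G 0 w ^+ 2 + a ^+ 2 * G 0 w * G 1 w + w * (G 0 w - a * G 1 w) ^+ 2 +
    4 * w * a ^+ 2 * (G 0 w * G 2 w - G 1 w ^+ 2)) =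
  nu r * a ^+ 2 * D r ^+ 3 *
    (a * G 0 w ^+ 2 + a ^+ 2 * G 0 w * G 1 w + w * (G 0 w - a * G 1 w) ^+ 2 +
    4 * w * a ^+ 2 * (G 0 w * G 2 w - G 1 w ^+ 2)) +
  nu r * a ^+ 2 * D r ^+ 2 * (a * G 1 w + G 0 w + 4 * w * a * G 2 w) *
    (1 - (G 0 w + w * a * G 1 w) * D r) by rewrite Q subrr mulr0 addr0.
rewrite /a; move: (G 0 w) (G 1 w) (G 2 w) => g0 g1 g2; rewrite /w.
by move: (Y r) (nu r) (D r) => y v d; ring.
Qed.

(** For a = 1 - w bounded below, the first summand a G_0^2 is bounded below; for
    small a, a G_1 is at most half of G_0 and the square (G_0 - a G_1)^2 takes over. *)
Let bracket_ge (w g0 g1 g2 : R) : 0 <= w -> w < 1 -> 0 < m -> m <= g0 -> g0 <= M ->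
  0 <= g1 -> g1 <= M -> g1 ^+ 2 <= g0 * g2 ->
  let a := 1 - w in
  m ^+ 3 / (16 * M) <= a * g0 ^+ 2 + a ^+ 2 * g0 * g1 + w * (g0 - a * g1) ^+ 2 +
     4 * w * a ^+ 2 * (g0 * g2 - g1 ^+ 2).
Proof.
move=> w0 w1 m0 mg0 g0M g10 g1M cs /=; set a := 1 - w; have a0 : 0 < a by rewrite /a subr_gt0.
have aW := ltW a0.
have M0 : 0 < M by lra.
have t1 : 0 <= a ^+ 2 * g0 * g1 by rewrite !mulr_ge0 ?sqr_ge0//; lra.
have t2 : 0 <= w * (g0 - a * g1) ^+ 2 by rewrite mulr_ge0 ?sqr_ge0.
have t3 : 0 <= 4 * w * a ^+ 2 * (g0 * g2 - g1 ^+ 2).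
  by rewrite -subr_ge0 in cs; rewrite !mulr_ge0 ?sqr_ge0//.
have t0 : 0 <= a * g0 ^+ 2 by rewrite mulr_ge0 ?sqr_ge0// ltW.
rewrite ler_pdivrMr ?mulr_gt0//.
have m2 : m ^+ 2 <= g0 ^+ 2 by rewrite ler_pXn2r// nnegrE; lra.
have m3 : m ^+ 3 <= m ^+ 2 * M by rewrite exprSr ler_pM2l ?exprn_gt0//; lra.
have [h|h] := leP m (2 * M * a).
  have : m ^+ 2 * m <= g0 ^+ 2 * (2 * M * a).
    by apply: ler_pM => //; [exact: sqr_ge0|lra].
  rewrite -exprSr => h1.
  apply: (@le_trans _ _ (a * g0 ^+ 2 * (16 * M))); last first.
    by rewrite ler_wpM2r//; lra.
  have m30 : 0 <= m ^+ 3 by rewrite exprn_ge0// ltW.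
  nra.
have h2 : m / 2 <= g0 - a * g1.
  have : a * g1 <= a * M by rewrite ler_wpM2l// ltW.
  lra.
have h3 : (m / 2) ^+ 2 <= (g0 - a * g1) ^+ 2.
  by rewrite ler_pXn2r// nnegrE; lra.
have w2 : 1 / 2 <= w.
  have : M * (2 * a) < M * 1 by lra.
  by rewrite ltr_pM2l// /a; lra.
have h4 : 1 / 2 * (m / 2) ^+ 2 <= w * (g0 - a * g1) ^+ 2.
  by apply: ler_pM => //; rewrite ?sqr_ge0//; lra.
apply: (@le_trans _ _ (w * (g0 - a * g1) ^+ 2 * (16 * M))); last first.
  by rewrite ler_wpM2r//; lra.
have h5 : 1 / 2 * (m / 2) ^+ 2 * (16 * M) <= w * (g0 - a * g1) ^+ 2 * (16 * M).
  by rewrite ler_wpM2r//; lra.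
apply: le_trans h5; rewrite expr_div_n.
have : 0 <= m ^+ 2 * M by rewrite mulr_ge0 ?sqr_ge0// ltW.
lra.
Qed.

Let bracket_le (w g0 g1 g2 : R) : 0 <= w -> w < 1 -> 0 <= g0 -> g0 <= M ->
  0 <= g1 -> g1 <= M -> 0 <= g2 -> (1 - w) * g2 <= M ->
  let a := 1 - w in
  a * g0 ^+ 2 + a ^+ 2 * g0 * g1 + w * (g0 - a * g1) ^+ 2 +
     4 * w * a ^+ 2 * (g0 * g2 - g1 ^+ 2) <= 7 * M ^+ 2.
Proof.
move=> w0 w1 g00 g0M g10 g1M g20 g2M /=; set a := 1 - w; have a0 : 0 < a by rewrite /a subr_gt0.
have aW := ltW a0.
have a1 : a <= 1 by rewrite /a; lra.
have M0 : 0 <= M by lra.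
have h1 : a * g0 ^+ 2 <= 1 * M ^+ 2.
  by apply: ler_pM; rewrite ?sqr_ge0 ?ler_pXn2r ?nnegrE// ltW.
have h2 : a ^+ 2 * g0 * g1 <= 1 * M * M.
  apply: ler_pM => //; first by rewrite mulr_ge0 ?sqr_ge0.
  by apply: ler_pM; rewrite ?sqr_ge0// exprn_ile1// ltW.
have ag : 0 <= a * g1 <= M.
  rewrite mulr_ge0 ?(ltW a0)//=; apply: le_trans g1M; rewrite ler_piMl//.
have h3 : w * (g0 - a * g1) ^+ 2 <= 1 * M ^+ 2.
  apply: ler_pM; rewrite ?sqr_ge0 ?(ltW w1)//.
  rewrite -(real_normK (num_real (g0 - a * g1))) ler_pXn2r ?nnegrE//.
  move: ag => /andP[? ?]; rewrite ler_norml; lra.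
have h4 : g0 * (a * g2) <= M * M.
  by apply: ler_pM => //; rewrite mulr_ge0// ltW.
have h5 : w * a * (g0 * (a * g2)) <= 1 * (M * M).
  apply: ler_pM => //; first by rewrite mulr_ge0// ltW.
    by rewrite !mulr_ge0// ltW.
  rewrite -(mulr1 1); apply: ler_pM => //; exact: ltW.
have h6 : 0 <= 4 * w * a ^+ 2 * g1 ^+ 2 by rewrite !mulr_ge0 ?sqr_ge0.
have -> : 4 * w * a ^+ 2 * (g0 * g2 - g1 ^+ 2) =
  4 * (w * a * (g0 * (a * g2))) - 4 * w * a ^+ 2 * g1 ^+ 2 by ring.
move: h1 h2 h3 h5; rewrite expr2; lra.
Qed.


Let Ysq (r : R) : 0 <= Y r ^+ 2 /\ Y r ^+ 2 < 1.
Proof. by rewrite sqr_ge0 -(real_normK (num_real (Y r))) expr_lt1. Qed.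

Let m_gt0 : 0 < m := moments_mass GP.

Let mM : m <= M.
Proof. exact: le_trans (moments_ge GP (lexx 0) ltr01) (moments_le0 GP (lexx 0) ltr01). Qed.

Let inv_slope_bounds (r : R) : (2 * M)^-1 <= D r /\ D r <= m^-1.
Proof.
have [w0 w1] := Ysq r; have m0 := m_gt0; have mleM := mM.
have := moments_ge GP w0 w1; have := moments_le0 GP w0 w1.
have := moments_le1 GP w0 w1; have := moments_ge0 GP 1 w1.
rewrite /inv_slope; move: (G 0 _) (G 1 _) => g0 g1 h1 h2 h3 h4.
move: (Y r ^+ 2) w0 w1 => w w0 w1.
have h5 : 0 <= w * (1 - w) * g1 by rewrite !mulr_ge0// subr_ge0 ltW.
have h6 : w * (1 - w) * g1 <= 1 * M.
  apply: ler_pM => //; first by rewrite mulr_ge0// subr_ge0 ltW.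
  nra.
by split; rewrite lef_pV2 ?posrE; lra.
Qed.

Let fun_bounds (r : R) : 0 <= r -> let s := Num.sqrt (1 + r ^+ 2) in
  Num.min 1 m * s <= nu r /\ nu r <= Num.max 1 M * s.
Proof.
move=> r0 s; have [w0 w1] := Ysq r; have m0 := m_gt0.
have s2 : s ^+ 2 = 1 + r ^+ 2 by rewrite sqr_sqrtr// addr_ge0 ?sqr_ge0.
have s0 : 0 <= s := sqrtr_ge0 _.
have v0 := ltW (zero_fun_gt0 GP Y_lt1 r).
have v2 := zero_fun_sqE GP Y_lt1 YK r.
have gm := moments_ge GP w0 w1; have gM := moments_le0 GP w0 w1.
have r2 := sqr_ge0 r.
have k0 : 0 <= Num.min 1 m by rewrite le_min ler01 ltW.
have k1 : Num.min 1 m <= 1 by rewrite ge_min lexx.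
have km : Num.min 1 m <= m by rewrite ge_min lexx orbT.
have K1 : 1 <= Num.max 1 M by rewrite le_max lexx.
have KM : M <= Num.max 1 M by rewrite le_max lexx orbT.
move: (Num.min 1 m) (Num.max 1 M) k0 k1 km K1 KM => k K k0 k1 km K1 KM.
split; rewrite -(@ler_pXn2r _ 2)// ?nnegrE ?mulr_ge0//; try lra.
  rewrite exprMn s2 v2; apply: (@le_trans _ _ (k * (1 + r ^+ 2))).
    by rewrite ler_wpM2r ?expr2 ?ler_piMr// addr_ge0.
  have : k * r ^+ 2 <= r ^+ 2 by rewrite ler_piMl.
  lra.
rewrite exprMn s2 v2; apply: (@le_trans _ _ (K * (1 + r ^+ 2))); last first.
  by rewrite ler_wpM2r ?addr_ge0// expr2 ler_peMr//; lra.
have : r ^+ 2 <= K * r ^+ 2 by rewrite ler_peMl.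
lra.
Qed.

Let derive_bounds (r : R) : 0 <= r -> let s := Num.sqrt (1 + r ^+ 2) in
  m * ((2 * M)^-1 * (Num.max 1 M)^-1) * (r / s) <= derive1 nu r /\
  derive1 nu r <= 2 * M * (m^-1 * (Num.min 1 m)^-1) * (r / s).
Proof.
move=> r0 s; have [w0 w1] := Ysq r; have m0 := m_gt0; have mleM := mM.
have s0 : 0 < s by rewrite sqrtr_gt0 ltr_pwDl// sqr_ge0.
have v0 := zero_fun_gt0 GP Y_lt1 r.
have [vk vK] := fun_bounds r0; rewrite -/s in vk vK.
have YE : Y r = r * (nu r)^-1 by rewrite -[X in X / _](zero_fun_slope YK r) mulfK// gt_eqF.
have k0 : 0 < Num.min 1 m by rewrite lt_min ltr01.
have K0 : 0 < Num.max 1 M by rewrite lt_max ltr01.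
have [d1 d2] := inv_slope_bounds r.
have dM : 0 <= (2 * M)^-1 by rewrite invr_ge0; lra.
have d0 := le_trans dM d1.
have V1 : (Num.max 1 M)^-1 * s^-1 <= (nu r)^-1.
  by rewrite -invfM lef_pV2 ?posrE ?mulr_gt0.
have V2 : (nu r)^-1 <= (Num.min 1 m)^-1 * s^-1.
  by rewrite -invfM lef_pV2 ?posrE ?mulr_gt0.
have V0 : 0 <= (nu r)^-1 by rewrite invr_ge0 ltW.
have gm := moments_ge GP w0 w1; have gM := moments_le0 GP w0 w1.
have g1M := moments_le1 GP w0 w1; have g10 := moments_ge0 GP 1 w1.
have P0 : 0 <= (1 - Y r ^+ 2) * G 1 (Y r ^+ 2) by rewrite mulr_ge0// subr_ge0 ltW.
have P1 : (1 - Y r ^+ 2) * G 1 (Y r ^+ 2) <= M.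
  by apply: le_trans g1M; rewrite ler_piMl// gerBl.
have E : derive1 nu r = r * (nu r)^-1 *
    ((1 - Y r ^+ 2) * G 1 (Y r ^+ 2) + G 0 (Y r ^+ 2)) * D r.
  by rewrite derive1_zero_fun {1}YE.
rewrite E; split.
  rewrite [leLHS](_ : _ = r * ((Num.max 1 M)^-1 * s^-1) * m * (2 * M)^-1); last by ring.
  have i0 : 0 <= (Num.max 1 M)^-1 * s^-1 by rewrite mulr_ge0 ?invr_ge0 ?ltW.
  have Pm : m <= (1 - Y r ^+ 2) * G 1 (Y r ^+ 2) + G 0 (Y r ^+ 2) by lra.
  apply: ler_pM => //; first by apply: mulr_ge0; [exact: mulr_ge0|exact: ltW].
  apply: ler_pM => //; [by rewrite mulr_ge0|exact: ltW|].
  exact: ler_wpM2l.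
rewrite [leRHS](_ : _ = r * ((Num.min 1 m)^-1 * s^-1) * (2 * M) * m^-1); last by ring.
have PM : (1 - Y r ^+ 2) * G 1 (Y r ^+ 2) + G 0 (Y r ^+ 2) <= 2 * M by lra.
have Pm : 0 <= (1 - Y r ^+ 2) * G 1 (Y r ^+ 2) + G 0 (Y r ^+ 2) by lra.
apply: ler_pM => //; first by rewrite !mulr_ge0.
apply: ler_pM => //; first by rewrite mulr_ge0.
exact: ler_wpM2l.
Qed.

(** From (1 - w) nu^2 = G_0 the factor nu (1 - w)^2 equals G_0^2 / nu^3, hence the
    power (1 + r^2)^(-3/2) in the lower bound. *)
Let derive2_bounds (r : R) : 0 <= r -> let s := Num.sqrt (1 + r ^+ 2) in
  m ^+ 2 * (Num.max 1 M) ^- 3 * (2 * M) ^- 3 * (m ^+ 3 / (16 * M)) * s ^- 3 <= derive1n 2 nu r /\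
  derive1n 2 nu r <= (1 + M) * m ^- 3 * (7 * M ^+ 2).
Proof.
move=> r0 s; have [w0 w1] := Ysq r; have m0 := m_gt0; have mleM := mM.
have s0 : 0 < s by rewrite sqrtr_gt0 ltr_pwDl// sqr_ge0.
have v0 := zero_fun_gt0 GP Y_lt1 r.
have [_ vK] := fun_bounds r0; rewrite -/s in vK.
have K0 : 0 < Num.max 1 M by rewrite lt_max ltr01.
have [d1 d2] := inv_slope_bounds r.
have M0 : 0 < 2 * M by lra.
have dM : 0 < (2 * M)^-1 by rewrite invr_gt0.
have d0 := lt_le_trans dM d1.
have gm := moments_ge GP w0 w1; have gM := moments_le0 GP w0 w1.
have g1M := moments_le1 GP w0 w1; have g10 := moments_ge0 GP 1 w1.
have g2M := moments_le2 GP w0 w1; have g20 := moments_ge0 GP 2 w1.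
have B1 := bracket_ge w0 w1 m0 gm gM g10 g1M (moments_CS GP w0 w1).
have B2 := bracket_le w0 w1 (le_trans (ltW m0) gm) gM g10 g1M g20 g2M.
have v2 := zero_fun_sq GP Y_lt1 r.
have a0 : 0 < 1 - Y r ^+ 2 by rewrite subr_gt0.
have a1 : 1 - Y r ^+ 2 <= 1 by rewrite gerBl.
have gE : G 0 (Y r ^+ 2) = nu r ^+ 2 * (1 - Y r ^+ 2) by rewrite v2 mulfVK// gt_eqF.
have C1 : m ^+ 2 * (Num.max 1 M) ^- 3 * s ^- 3 <= nu r * (1 - Y r ^+ 2) ^+ 2.
  have -> : nu r * (1 - Y r ^+ 2) ^+ 2 = G 0 (Y r ^+ 2) ^+ 2 * nu r ^- 3.
    by rewrite gE; field; rewrite gt_eqF.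
  rewrite -mulrA -invfM -exprMn; apply: ler_pM; rewrite ?sqr_ge0//.
  - by rewrite invr_ge0 exprn_ge0// mulr_ge0// ltW.
  - by rewrite ler_pXn2r// nnegrE; lra.
  - by rewrite lef_pV2 ?posrE ?exprn_gt0 ?mulr_gt0// ler_pXn2r// nnegrE ?mulr_ge0// ltW.
have C2 : nu r * (1 - Y r ^+ 2) ^+ 2 <= 1 + M.
  rewrite -(@ler_pXn2r _ 2)// ?nnegrE; last 2 first.
  - by rewrite mulr_ge0 ?sqr_ge0// ltW.
  - lra.
  have -> : (nu r * (1 - Y r ^+ 2) ^+ 2) ^+ 2 = G 0 (Y r ^+ 2) * (1 - Y r ^+ 2) ^+ 3.
    by rewrite gE; ring.
  apply: (@le_trans _ _ (M * 1)); last by nra.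
  by apply: ler_pM; rewrite ?exprn_ge0 ?exprn_ile1 ?(ltW a0)//; lra.
have D1 : (2 * M) ^- 3 <= D r ^+ 3.
  by rewrite -exprVn ler_pXn2r// nnegrE ltW.
have D2 : D r ^+ 3 <= m ^- 3.
  by rewrite -exprVn ler_pXn2r// nnegrE ltW// invr_gt0.
rewrite derive2_zero_fun; split.
  rewrite [leLHS](_ : _ = m ^+ 2 * (Num.max 1 M) ^- 3 * s ^- 3 * (2 * M) ^- 3 *
    (m ^+ 3 / (16 * M))); last by ring.
  have p1 : 0 <= m ^+ 2 * (Num.max 1 M) ^- 3 * s ^- 3.
    by rewrite !mulr_ge0 ?sqr_ge0 ?invr_ge0 ?exprn_ge0// ltW.
  have p2 : 0 <= (2 * M) ^- 3 by rewrite invr_ge0 exprn_ge0// ltW.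
  apply: ler_pM => //; first exact: mulr_ge0.
    by rewrite divr_ge0 ?exprn_ge0//; lra.
  exact: ler_pM.
apply: ler_pM => //.
- by rewrite !mulr_ge0 ?sqr_ge0 ?exprn_ge0// ltW.
- by apply: le_trans B1; rewrite divr_ge0 ?exprn_ge0//; lra.
- by apply: ler_pM => //; rewrite ?mulr_ge0 ?sqr_ge0 ?exprn_ge0// ltW.
Qed.

Let powR_sqrt3 (r : R) : (1 + r ^+ 2) `^ (- (3 / 2)) = Num.sqrt (1 + r ^+ 2) ^- 3.
Proof.
have t0 : 0 < 1 + r ^+ 2 by rewrite ltr_pwDl// sqr_ge0.
rewrite powRN (_ : 3 / 2 = 1 + 2^-1); last by field.
rewrite powRD ?powRr1 ?powR12_sqrt ?(ltW t0)//; last first.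
  by apply/implyP => _; rewrite gt_eqF.
by rewrite [_ ^+ 3]exprSr sqr_sqrtr// ltW.
Qed.

Lemma zero_fun_bounds : exists c0 C0 : R, [/\ 0 < c0, 0 < C0 & forall r : R, 0 <= r ->
  let w := Num.sqrt (1 + r ^+ 2) in
  [/\ c0 * w <= nu r <= C0 * w,
      c0 * (r / w) <= derive1 nu r <= C0 * (r / w)
    & c0 * (1 + r ^+ 2) `^ (- (3 / 2)) <= derive1n 2 nu r <= C0]].
Proof.
have m0 := m_gt0; have mleM := mM; have M0 : 0 < M by lra.
have k0 : 0 < Num.min 1 m by rewrite lt_min ltr01.
have K0 : 0 < Num.max 1 M by rewrite lt_max ltr01.
pose b1 := m * ((2 * M)^-1 * (Num.max 1 M)^-1).
pose b2 := m ^+ 2 * (Num.max 1 M) ^- 3 * (2 * M) ^- 3 * (m ^+ 3 / (16 * M)).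
pose B1 := 2 * M * (m^-1 * (Num.min 1 m)^-1).
pose B2 := (1 + M) * m ^- 3 * (7 * M ^+ 2).
have b10 : 0 < b1 by rewrite !mulr_gt0// ?invr_gt0 ?mulr_gt0.
have b20 : 0 < b2.
  by rewrite !mulr_gt0 ?invr_gt0 ?exprn_gt0 ?mulr_gt0.
exists (Num.min (Num.min 1 m) (Num.min b1 b2)), (Num.max (Num.max 1 M) (Num.max B1 B2)).
split.
- by rewrite !lt_min ltr01 m0 b10 b20.
- by rewrite !lt_max ltr01.
move=> r r0 s; have s0 : 0 <= s := sqrtr_ge0 _.
have rs : 0 <= r / s by rewrite divr_ge0.
have [v1 v2] := fun_bounds r0; have [d1 d2] := derive_bounds r0.
have [e1 e2] := derive2_bounds r0.
split; apply/andP; split.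
- by apply: le_trans v1; rewrite ler_wpM2r// ge_min lexx.
- by apply: le_trans v2 _; rewrite ler_wpM2r// le_max lexx.
- by apply: le_trans d1; rewrite ler_wpM2r// !ge_min lexx !orbT.
- by apply: le_trans d2 _; rewrite ler_wpM2r// !le_max lexx !orbT.
- rewrite powR_sqrt3; apply: le_trans e1.
  by rewrite ler_wpM2r ?invr_ge0 ?exprn_ge0// !ge_min lexx !orbT.
- by apply: le_trans e2 _; rewrite !le_max lexx !orbT.
Qed.

End smoothness.

(** * The zeros of the magnetic dispersion function *)
Section boundary_values.
Context {R : realType}.

Lemma closed_right_half_closure (z : Cpx R) : 0 <= complex.Re z ->
  closure (@open_right_half R) z.
Proof.
move=> z0 B Bz.
have c : (fun t : R => ((complex.Re z + t) +i* complex.Im z : Cpx R)) @ 0^'+ --> z.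
  have cR : (fun t : R => complex.Re z + t) @ 0^'+ --> complex.Re z.
    rewrite -[X in _ --> X]addr0.
    apply: (@cvg_at_right_filter _ _ (fun t : R => complex.Re z + t)).
    by apply: cvgD; [exact: cvg_cst|exact: cvg_id].
  rewrite [X in _ --> X](_ : z = complex.Re z +i* complex.Im z); last by case: (z).
  by apply: cvg_complex => //; exact: cvg_cst.
have h1 : \forall t \near 0^'+, B ((complex.Re z + t) +i* complex.Im z) by exact: c.
have h2 : \forall t \near (0 : R)^'+, 0 < t by exact: nbhs_right_gt.
have [t [Bt t0]] := filter_ex (filterI h1 h2).
by exists ((complex.Re z + t) +i* complex.Im z); split => //; rewrite /open_right_half /= ltr_wpDl.
Qed.

(** A function that is continuous on the whole plane and agrees with M on the open
    half-plane has the limits that define M on the imaginary axis. *)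
Lemma magM_extension (phi : R -> R) (k : 'cV[R]_3) (f : Cpx R -> Cpx R) :
  continuous f -> (forall z : Cpx R, 0 < complex.Re z -> magM_open phi z k = f z) ->
  (forall z : Cpx R, 0 <= complex.Re z -> magM phi z k = f z) /\
  {within @closed_right_half R, continuous (fun z => magM phi z k)}.
Proof.
move=> cf ff; have mf (z : Cpx R) : 0 <= complex.Re z -> magM phi z k = f z.
  move=> z0; rewrite /magM; case: ifPn => [|_]; first exact: ff.
  have PF : ProperFilter (within (@open_right_half R) (nbhs (z : Cpx R))).
    exact: (within_nbhs_proper (closed_right_half_closure z0)).
  apply/cvg_lim; first exact: norm_hausdorff.
  have FF : Filter (nbhs (z : Cpx R)) by exact: nbhs_filter.
  have c : f @ within (@open_right_half R) (nbhs z) --> f z.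
    by apply: cvg_within_filter; exact: cf.
  apply: cvg_trans c; apply: near_eq_cvg.
  by rewrite /prop_near1 /within/=; apply: nearW => w /ff ->.
split=> [//|]; have e : {in @closed_right_half R, f =1 (fun z => magM phi z k)}.
  by move=> z; rewrite inE => z0; rewrite mf.
have cs : {within @closed_right_half R, continuous f} by exact: continuous_subspaceT.
exact: (subspace_eq_continuous e cs).
Qed.

End boundary_values.

Theorem theorem2p18 : exists Nmin : nat,
  forall (R : realType) (N0 : nat) (F : Cpx R -> Cpx R) (phi : R -> R) (n0 : R),
  (Nmin <= N0)%N -> equilibrium N0 F phi n0 ->
  (* the continuous extension of M to the closed half-plane is well defined *)
  (forall k : 'cV[R]_3,
     {within @closed_right_half R, continuous (fun lam => magM phi lam k)}) /\
  exists nu : R -> R,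
    [/\ forall (k : 'cV[R]_3) (lam : Cpx R), complex.Re lam = 0 ->
          (magM phi lam k = 0 <->
           lam = 0 +i* nu (enorm k) \/ lam = 0 -i* nu (enorm k)),
        forall k : 'cV[R]_3, enorm k < nu (enorm k),
        class_C (N0 %/ 2) nu
      & exists c0 C0 : R,
          [/\ 0 < c0, 0 < C0 & forall k : 'cV[R]_3,
            let r := enorm k in
            let w := Num.sqrt (1 + r ^+ 2) in
            [/\ c0 * w <= nu r <= C0 * w,
                c0 * (r / w) <= derive1 nu r <= C0 * (r / w)
              & c0 * (1 + r ^+ 2) `^ (- (3 / 2)) <= derive1n 2 nu r <= C0]]].
Proof.
exists 6%N => R N0 F phi n0 N06 E.
have [Phi [dPhi [A [PhiP phiE dphiE]]]] := equilibrium_profile N06 E.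
have mass := mass_gt0 PhiP phiE (equilibrium_ge0 E) (equilibrium_density E)
  (equilibrium_neq0 E).
pose q (u : R) : R := @disc_area R * mass_density Phi u.
have qP := density_mass_density PhiP (@disc_area_ge0 R) mass.
rewrite -/q in qP.
have openE (k : 'cV[R]_3) (z : Cpx R) : k != 0 -> 0 < complex.Re z ->
    magM_open phi z k = dispersion q (enorm k) z.
  case: z => a b k0 /= a0; rewrite (magM_openE PhiP phiE dphiE)//.
  by rewrite (dispersionE qP)// enorm_gt0.
have open0 (z : Cpx R) : 0 < complex.Re z ->
    magM_open phi z 0 = z * z + (tau0sq phi)%:C.
  by rewrite /magM_open eqxx expr2.
have cont0 : continuous (fun z : Cpx R => z * z + (tau0sq phi)%:C : Cpx R).
  move=> z; have FF : Filter (nbhs (z : Cpx R)) by exact: nbhs_filter.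
  have c1 : (fun w : Cpx R => w * w) @ nbhs z --> z * z by apply: cvgM; exact: cvg_id.
  have c2 : (fun w : Cpx R => (tau0sq phi)%:C : Cpx R) @ nbhs z --> ((tau0sq phi)%:C : Cpx R).
    exact: cvg_cst.
  exact: (@cvgD (Cpx R) (Cpx R) _ _ FF _ _ _ _ c1 c2).
have ext0 := magM_extension cont0 open0.
have ext (k : 'cV[R]_3) (k0 : k != 0) := magM_extension
  (continuous_dispersion qP (enorm_gt0 k0)) (fun z => @openE k z k0).
split=> [k|]; first by have [->|/ext[]] := eqVneq k 0; first by case: ext0.
have GP := moments_density qP.
have [|Y YP] := @choice R R (fun r y => `|y| < 1 /\ wave (moment q) y = r).
  by move=> r; have [y y1 yr] := wave_surj GP r; exists y.
have Y1 r := (YP r).1; have YK r := (YP r).2.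
exists (zero_fun (moment q) Y); split.
- move=> k [a b] /= ->.
  set r := enorm k; set v := zero_fun (moment q) Y r.
  have -> : (0 +i* b = 0 +i* v \/ 0 +i* b = 0 -i* v :> Cpx R) = (b ^+ 2 = v ^+ 2).
    apply/propext; split=> [[[->]|[->]]|/eqP]; rewrite ?sqrrN//.
    by rewrite eqf_sqr => /orP[]/eqP ->; [left|right].
  have r0 : 0 <= r := sqrtr_ge0 _.
  have rv : r < v := zero_fun_gt GP Y1 YK r0.
  have [k0|k0] := eqVneq k 0.
    have rE : r = 0.
      by rewrite /r k0 /enorm (_ : dot 0 0 = 0) ?sqrtr0// dotE !mxE; ring.
    rewrite k0 (ext0.1 (0 +i* b) (lexx 0)).
    have Y0 : Y r = 0.
      have := zero_fun_slope YK r; rewrite -/v [in X in _ = X]rE => /eqP.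
      by rewrite mulf_eq0 (gt_eqF (le_lt_trans r0 rv)) orbF => /eqP.
    have -> : v ^+ 2 = tau0sq phi.
      rewrite (zero_fun_sqE GP Y1 YK) Y0 rE expr0n add0r (tau0sqE PhiP phiE).
      by apply: eq_Rintegral => u _; rewrite mul0r subr0 expr0 expr1 invr1 !mul1r.
    rewrite -[X in X <-> _]/((0 +i* b) * (0 +i* b) + (tau0sq phi)%:C = 0 :> Cpx R).
    split=> [/eqP|E']; last apply/eqP; rewrite eq_complex/=.
      by move=> /andP[/eqP h _]; lra.
    by apply/andP; split; apply/eqP; rewrite -?E'; ring.
  rewrite ((ext k k0).1 (0 +i* b) (lexx 0)) -/r.
  have {}r0 : 0 < r := enorm_gt0 k0.
  have [br|rb] := leP `|b| r.
    have nz := dispersion_neq0 qP r0 br; split=> [/eqP|h]; first by rewrite (negbTE nz).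
    have : b ^+ 2 <= r ^+ 2 by rewrite -(real_normK (num_real b)) ler_pXn2r// nnegrE ltW.
    by rewrite h leNgt ltr_pXn2r ?rv// nnegrE ltW// (lt_trans r0).
  rewrite (dispersion_outside qP r0 rb).
  have rb2 : r ^+ 2 < b ^+ 2 by rewrite -(real_normK (num_real b)) ltr_pXn2r// nnegrE ltW.
  rewrite -(zero_fun_unique GP Y1 YK rb2); split=> [|h].
    by move=> /eqP; rewrite eq_complex/= eqxx andbT => /eqP; lra.
  by rewrite h; congr (_ +i* 0); ring.
- by move=> k; apply: (zero_fun_gt GP Y1 YK) => //; exact: sqrtr_ge0.
- exact: (class_C_zero_fun GP Y1 YK).
- have [c0 [C0 [c00 C00 H]]] := zero_fun_bounds GP Y1 YK.
  by exists c0, C0; split => // k; apply: H; exact: sqrtr_ge0.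
Qed.
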